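(* Let $z_0=\frac{\pi}{2}+i\frac{\pi}{2}$ and $z_1=\overline{z_0}=\frac{\pi}{2}-i\frac{\pi}{2}$ be the upper and lower vertices of $D$. Then $$A^2\left(D,|(z-z_0)(z-z_1)|^{-2}\right)\subset A^2(\Delta)+A^2(\pi-\Delta).$$
   Context: Let $\Delta=\{z\in\mathbb{C}: |\arg(z)|<\frac{\pi}{4}\}$, $\pi-\Delta=\{\pi-z: z\in\Delta\}$, and $D=\Delta\cap(\pi-\Delta)=\{z=x+iy\in\mathbb{C}: |x-\frac{\pi}{2}|+|y|<\frac{\pi}{2}\}$. For a domain $\Omega\subset\mathbb{C}$ and a non-negative measurable function $\omega$ on $\Omega$, the weighted Bergman space $A^2(\Omega,\omega)$ is the set of functions $f$ holomorphic on $\Omega$ with $\int_\Omega |f(x+iy)|^2\,\omega(x+iy)\,dx\,dy<+\infty$; $A^2(\Omega)$ denotes the case $\omega=1$. The sum $A^2(\Delta)+A^2(\pi-\Delta)$ is the space of functions on $D$ of the form $g|_D+h|_D$ with $g\in A^2(\Delta)$, $h\in A^2(\pi-\Delta)$. *)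

(* Defs.v *)
From mathcomp Require Import all_boot all_order all_algebra.
From mathcomp Require Import complex.
From mathcomp Require Import all_classical all_reals all_analysis.
From mathcomp Require Import lra.

Set Implicit Arguments.
Unset Strict Implicit.
Unset Printing Implicit Defensive.

Import Order.TTheory GRing.Theory Num.Theory.
Import numFieldNormedType.Exports.
Import ComplexField.Normc.

Local Open Scope classical_set_scope.
Local Open Scope ring_scope.
Local Open Scope complex_scope.

(* Principal argument, with values in ]-pi, pi]; [carg_polar] and [carg_itv]
   characterize it for z != 0. The value at 0 is irrelevant. *)
Definition carg (R : realType) (z : R[i]) : R :=
  let t := acos (complex.Re z / normc z) in
  if 0 <= complex.Im z then t else - t.

Definition Delta (R : realType) : set R[i] :=
  [set z | z != 0 /\ `|carg z| < pi / 4].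
Arguments Delta R : clear implicits.

Definition pi_sub_Delta (R : realType) : set R[i] :=
  [set (pi : R)%:C - z | z in Delta R].
Arguments pi_sub_Delta R : clear implicits.

Definition D (R : realType) : set R[i] := Delta R `&` pi_sub_Delta R.
Arguments D R : clear implicits.

(* R[i] is a normed module over itself, so [derivable _ z 1] is complex
   differentiability: the increment h ranges over R[i]. *)
Definition holomorphic_on (R : realType) (Omega : set R[i])
    (f : R[i] -> R[i]) : Prop :=
  forall z, Omega z -> derivable (f : R[i]^o -> R[i]^o) z 1.

Definition area_integral (R : realType) (Omega : set R[i])
    (F : R[i] -> R) : \bar R :=
  (\int[lebesgue_measure \x lebesgue_measure]_(p in
       [set p : R * R | Omega (p.1 +i* p.2)])
     (F (p.1 +i* p.2))%:E)%E.

(* Functions on Omega are represented by total functions R[i] -> R[i] whose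
   values outside Omega are arbitrary. *)
Definition bergman (R : realType) (Omega : set R[i]) (w : R[i] -> R) :
    set (R[i] -> R[i]) :=
  [set f | holomorphic_on Omega f /\
    (area_integral Omega (fun z => normc (f z) ^+ 2 * w z)%R < +oo)%E].

Definition bergman1 (R : realType) (Omega : set R[i]) : set (R[i] -> R[i]) :=
  bergman Omega (fun=> 1).

Definition bergman_sum (R : realType) : set (R[i] -> R[i]) :=
  [set f | exists g h, [/\ bergman1 (Delta R) g, bergman1 (pi_sub_Delta R) h
    & forall z, D R z -> f z = g z + h z]].
Arguments bergman_sum R : clear implicits.

Definition z0 (R : realType) : R[i] := (pi / 2) +i* (pi / 2).
Definition z1 (R : realType) : R[i] := (z0 R)^*.

Lemma normcE2 (R : realType) (z : R[i]) :
  normc z ^+ 2 = complex.Re z ^+ 2 + complex.Im z ^+ 2.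
Proof. by case: z => x y /=; rewrite sqr_sqrtr ?addr_ge0 ?sqr_ge0. Qed.

Lemma normc_gt0 (R : realType) (z : R[i]) : z != 0 -> 0 < normc z.
Proof.
move=> z0; rewrite lt_neqAle; apply/andP; split; last first.
  by case: z z0 => x y _; rewrite /= sqrtr_ge0.
by apply: contra_neq z0 => /esym/eq0_normc.
Qed.

Lemma carg_itv_aux (R : realType) (z : R[i]) : z != 0 ->
  -1 <= complex.Re z / normc z <= 1.
Proof.
move=> z_neq0; have r0 := normc_gt0 z_neq0.
rewrite -ler_norml normrM normfV (gtr0_norm r0) ler_pdivrMr // mul1r.
rewrite -(ler_pXn2r (n := 2)) ?nnegrE ?normr_ge0 ?(ltW r0) //.
by rewrite real_normK ?num_real // normcE2 lerDl sqr_ge0.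
Qed.

Lemma carg_polar (R : realType) (z : R[i]) : z != 0 ->
  z = (normc z)%:C * (cos (carg z) +i* sin (carg z)).
Proof.
move=> z_neq0; have r0 := normc_gt0 z_neq0.
have c1 := carg_itv_aux z_neq0; have rn0 := lt0r_neq0 r0.
have cE : cos (carg z) = complex.Re z / normc z.
  by rewrite /carg; case: ifP => _; rewrite ?cosN acosK.
have sE : sin (carg z) = complex.Im z / normc z.
  have sA : sin (acos (complex.Re z / normc z)) = `|complex.Im z| / normc z.
    rewrite sin_acos //.
    have -> : 1 - (complex.Re z / normc z) ^+ 2 = (complex.Im z / normc z) ^+ 2.
      have r2 : normc z ^+ 2 != 0 by rewrite expf_neq0.
      rewrite !expr_div_n; apply: (mulIf r2); rewrite mulrBl !divfK // mul1r.
      by rewrite normcE2 addrAC subrr add0r.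
    by rewrite sqrtr_sqr normrM normfV (gtr0_norm r0).
  rewrite /carg; case: ifPn => [y0|]; first by rewrite sA ger0_norm.
  by rewrite -ltNge => y0; rewrite sinN sA ltr0_norm // mulNr opprK.
rewrite cE sE; case: z z_neq0 r0 c1 rn0 cE sE => x y /= _ _ _ rn0 _ _.
by simpc; rewrite !mulrA ![_ * x]mulrC ![_ * y]mulrC !mulfK.
Qed.

Lemma carg_itv (R : realType) (z : R[i]) : z != 0 -> - pi < carg z <= pi.
Proof.
move=> z_neq0; have c1 := carg_itv_aux z_neq0.
have r0 := normc_gt0 z_neq0.
rewrite /carg; case: ifPn => [_|].
  rewrite acos_lepi // andbT (lt_le_trans _ (acos_ge0 _)) //.
  by rewrite oppr_lt0 pi_gt0.
rewrite -ltNge => y0; rewrite ltrN2 acos_ltpi /=; last first.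
  have /andP[cge ->] := c1; rewrite andbT lt_neqAle cge andbT.
  apply/eqP => /esym e; have := normcE2 z.
  have -> : complex.Re z = - normc z.
    by rewrite -(divfK (lt0r_neq0 r0) (complex.Re z)) e mulN1r.
  move/eqP; rewrite sqrrN -{1}(addr0 (normc z ^+ 2)) (inj_eq (addrI _)) eq_sym.
  by rewrite sqrf_eq0 lt_eqF.
by rewrite (le_trans _ (pi_ge0 R)) // oppr_le0 acos_ge0.
Qed.

Lemma DeltaE (R : realType) (z : R[i]) :
  Delta R z <-> `|complex.Im z| < complex.Re z.
Proof.
rewrite /Delta /=.
have pi4 : 0 < pi / 4 :> R by rewrite divr_gt0 ?pi_gt0.
have s2 : 0 < Num.sqrt 2 :> R by rewrite sqrtr_gt0.
have pi2 : pi / 4 < pi / 2 :> R by have := pi_gt0 R; lra.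
have cos4 : cos (pi / 4) = (Num.sqrt 2)^-1 :> R.
  have c0 : 0 < cos (pi / 4) :> R.
    by rewrite cos_gt0_pihalf // pi2 andbT (lt_trans _ pi4) // oppr_lt0 divr_gt0 // pi_gt0.
  have c2 : cos (pi / 4) ^+ 2 = 2^-1 :> R.
    have := cos_pihalf R.
    have -> : pi / 2 = pi / 4 *+ 2 :> R by rewrite [RHS]mulr2n; lra.
    by rewrite cos_mulr2n => ?; lra.
  by rewrite -sqrtrV // -c2 sqrtr_sqr gtr0_norm.
have main : z != 0 ->
    (`|carg z| < pi / 4) = (`|complex.Im z| < complex.Re z).
  move=> z_neq0; have r0 := normc_gt0 z_neq0; have c1 := carg_itv_aux z_neq0.
  have -> : `|carg z| = acos (complex.Re z / normc z).
    by rewrite /carg; case: ifP => _; rewrite ?normrN ger0_norm // acos_ge0.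
  have -> : (acos (complex.Re z / normc z) < pi / 4) =
      (cos (pi / 4) < complex.Re z / normc z).
    rewrite -[in RHS](acosK c1) ltr_cos // in_itv /=.
      by rewrite acos_ge0 // acos_lepi.
    by rewrite (ltW pi4) ler_pdivrMr // ler_peMr ?pi_ge0 // ler1n.
  rewrite cos4 ltr_pdivlMr //.
  have h0 : 0 < (Num.sqrt 2)^-1 * normc z :> R by rewrite mulr_gt0 ?invr_gt0.
  have eqr : ((Num.sqrt 2)^-1 * normc z) ^+ 2 =
      (complex.Re z ^+ 2 + complex.Im z ^+ 2) / 2.
    by rewrite exprMn exprVn sqr_sqrtr // normcE2 mulrC.
  have [x0|x0] := ltP 0 (complex.Re z); last first.
    rewrite !ltNge (le_trans x0 (ltW h0)) (le_trans x0) //.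
  rewrite -(@ltr_pXn2r _ 2) // ?nnegrE ?(ltW h0) ?(ltW x0) // eqr.
  rewrite -[RHS](@ltr_pXn2r _ 2) // ?nnegrE ?(ltW x0) //.
  rewrite real_normK ?num_real // ltr_pdivrMr // mulr_natr mulr2n.
  by rewrite ltrD2l.
split=> [[z_neq0]|]; first by rewrite main.
move=> h; suff z_neq0 : z != 0 by split=> //; rewrite main.
by apply: contraTneq h => ->; rewrite normr0 ltxx.
Qed.

Lemma DE (R : realType) (z : R[i]) :
  D R z <-> `|complex.Re z - pi / 2| + `|complex.Im z| < pi / 2.
Proof.
rewrite -ltrBrDr ltr_norml; split.
  case=> /DeltaE h1 [u /DeltaE h2 uE]; move: h1; rewrite -uE.
  case: u h2 {uE} => x y /=; rewrite sub0r !normrN => h2 h1.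
  by apply/andP; split; lra.
case/andP=> h1 h2; split; first by apply/DeltaE; lra.
exists (pi%:C - z); last by rewrite opprB addrC subrK.
apply/DeltaE; case: z h1 h2 => x y /=; rewrite sub0r normrN => h1 h2.
by lra.
Qed.

(* Main.v *)
Require Import Defs.
From mathcomp Require Import all_boot all_order all_algebra.
From mathcomp Require Import complex.
From mathcomp Require Import all_classical all_reals all_analysis.
From mathcomp Require Import measurable_realfun.
From mathcomp Require Import ring lra.

(** Put [H = pi / 2]: then [D] is the diamond [|x - H| + |y| < H], the two
    singular vertices are [H +i* H] and [H -i* H], and the two domains are the
    sectors [|y| < H + sg * (x - H)] for [sg = 1] and [sg = -1].

    The lens-shaped curves [x = H + s * hw y] with [hw y = (H^2 - y^2) / (2 * H)]
    and [-1 < s < 1] join the two vertices inside [D].  By Cauchy's formula, a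
    holomorphic function on [D] is, between the curves of parameters [s] and
    [- s], a multiple of the difference of the two Cauchy integrals over these
    curves.  The integral over the left curve is holomorphic to the right of
    that curve, hence on the right part of [Delta]; inside [D] it continues to
    the left as the function minus the integral over the right curve.  This
    gives the summand on [Delta], and the mirror image gives the summand on
    [pi - Delta] ([summand], [summand_holo], [summand_sum]).

    What has to be controlled is square integrability, and it is here that the
    weight enters.  On the curves, [(z - z0) * (z - z1)] is at most a constant
    times [hw], so by hypothesis [f] is [hw * Phi] up to a bounded factor, with
    [Phi] in [L^2(D)].  In the coordinates [(s, y)], of Jacobian [hw y],
    Tonelli's theorem provides a parameter [s] in [[1/3, 2/3]] for which
    [|Phi|^2 * hw] is integrable along both curves ([good_slice]); then
    [|f|^2 / hw] is integrable along both ([arc_l2_of]).  For [z] on the other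
    side of the axis [x = H] than the curve, Cauchy-Schwarz bounds the square of
    the Cauchy integral by a constant times the integral over [t] of
    [hw t / ((s * hw t)^2 + (y - t)^2)] ([cauchyI_sq]).  This is a superposition
    of Poisson kernels, each of integral [pi / s] in [y], so the bound is
    integrable in [y], uniformly in [x] ([kernI_integral]).  Integrability in
    [x] is obtained by working with [F z = f z * (pole - z)], where
    [pole = H +i* (2 * H)] lies outside the closures of both sectors, and
    dividing the summands by [pole - z] ([summand_l2]).

    Cauchy's formula for curves that run into the vertices, where nothing is
    known of [F] pointwise, is [cauchy_arcs].  The difference quotient of [F] at
    [z] is integrated over the boundary of a rectangle in the coordinates
    [(s, y)]; Goursat's bisection makes this integral vanish ([cauchy_rect]), and
    Tonelli provides heights tending to both vertices along which the horizontal
    sides contribute nothing in the limit ([good_heights]).  What has to be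
    known of the index of the closed curve is that it is constant between the
    curves and nonzero: its derivative is a difference of two integrals that
    depend on the endpoints of the curves only, and therefore cancel
    ([windex_const]), and at the centre [H] the contributions of the two curves
    have imaginary parts of the same sign ([windex_neq0]). *)

Set Implicit Arguments.
Unset Strict Implicit.
Unset Printing Implicit Defensive.

Import Order.TTheory GRing.Theory Num.Theory.
Import numFieldNormedType.Exports.
Import ComplexField.Normc.

Local Open Scope classical_set_scope.
Local Open Scope ring_scope.
Local Open Scope complex_scope.

Local Notation Re := complex.Re.
Local Notation Im := complex.Im.

(** * Modulus and complex differentiability *)
Section ComplexModulus.
Variable R : realType.
Implicit Types z w : R[i].

Lemma normc_ge0 z : 0 <= normc z.
Proof. by case: z => x y /=; rewrite sqrtr_ge0. Qed.

Lemma normc_normr z : `|z| = (normc z)%:C.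
Proof. by []. Qed.

Lemma normc_leD z w : normc (z + w) <= normc z + normc w.
Proof. by rewrite -lecR rmorphD /= -!normc_normr ler_normD. Qed.

Lemma normc_opp z : normc (- z) = normc z.
Proof. by apply: complexI; rewrite -!normc_normr normrN. Qed.

Lemma normc_sub z w : normc (z - w) = normc (w - z).
Proof. by rewrite -normc_opp opprB. Qed.

Lemma normc_leB z w : normc (z - w) <= normc z + normc w.
Proof. by rewrite -(normc_opp w) normc_leD. Qed.

Lemma normc_leBB z w u : normc (z - w) <= normc (z - u) + normc (u - w).
Proof. by rewrite (_ : z - w = (z - u) + (u - w)) ?normc_leD//; ring. Qed.

Lemma normc_real (x : R) : normc x%:C = `|x|.
Proof. by rewrite /= expr0n /= addr0 sqrtr_sqr. Qed.

Lemma normc_Re z : `|Re z| <= normc z.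
Proof.
rewrite -(ler_pXn2r (n := 2)) ?nnegrE ?normc_ge0 // real_normK ?num_real //.
by rewrite normcE2 lerDl sqr_ge0.
Qed.

Lemma normc_Im z : `|Im z| <= normc z.
Proof.
rewrite -(ler_pXn2r (n := 2)) ?nnegrE ?normc_ge0 // real_normK ?num_real //.
by rewrite normcE2 lerDr sqr_ge0.
Qed.

Lemma normc_ReIm z : normc z <= `|Re z| + `|Im z|.
Proof.
rewrite -(ler_pXn2r (n := 2)) ?nnegrE ?normc_ge0 ?addr_ge0 //.
rewrite normcE2 sqrrD !real_normK ?num_real //.
have := mulr_ge0 (normr_ge0 (Re z)) (normr_ge0 (Im z)); lra.
Qed.

Lemma normc_eq0 z : (normc z == 0) = (z == 0).
Proof. by apply/eqP/eqP => [/eq0_normc|->]; rewrite ?normc0. Qed.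

Lemma normc_sub_gt0 z w : z != w -> 0 < normc (z - w).
Proof. by move=> zw; rewrite normc_gt0 // subr_eq0. Qed.

Lemma cReD z w : Re (z + w) = Re z + Re w. Proof. by case: z; case: w. Qed.
Lemma cImD z w : Im (z + w) = Im z + Im w. Proof. by case: z; case: w. Qed.
Lemma cReN z : Re (- z) = - Re z. Proof. by case: z. Qed.
Lemma cImN z : Im (- z) = - Im z. Proof. by case: z. Qed.
Lemma cReM z w : Re (z * w) = Re z * Re w - Im z * Im w.
Proof. by case: z; case: w. Qed.
Lemma cImM z w : Im (z * w) = Re z * Im w + Im z * Re w.
Proof. by case: z; case: w. Qed.
Lemma cReV z : Re z^-1 = Re z / normc z ^+ 2.
Proof. by rewrite normcE2; case: z. Qed.
Lemma cImV z : Im z^-1 = - Im z / normc z ^+ 2.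
Proof. by rewrite normcE2 mulNr; case: z. Qed.

Lemma eq_ReIm z w : Re z = Re w -> Im z = Im w -> z = w.
Proof. by case: z => a b; case: w => c d /= -> ->. Qed.

End ComplexModulus.

Section ComplexDerivative.
Variable R : realType.
Implicit Types (z w l : R[i]) (f g : R[i] -> R[i]).

(** Continuity and differentiability with real radii and the real modulus; the
    filters of [R[i]] have radii in [R[i]] itself. *)
Definition ccont f z := forall e : R, 0 < e ->
  exists2 d : R, 0 < d & forall w, normc (w - z) < d -> normc (f w - f z) < e.

Definition cdiff f z l := forall e : R, 0 < e ->
  exists2 d : R, 0 < d & forall w, normc (w - z) < d ->
    normc (f w - f z - l * (w - z)) <= e * normc (w - z).

Lemma derivable_cdiff f z :
  derivable (f : R[i]^o -> R[i]^o) z 1 -> exists l, cdiff f z l.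
Proof.
move=> /cvg_ex [/= l /cvgrPdist_le /= df]; exists l => e e0.
have /df : 0 < e%:C by rewrite ltcR.
rewrite near_withinE => -[/= d d0 H]; exists (Re d).
  by move: d0; rewrite ltcE => /andP[].
have dR : d = (Re d)%:C by rewrite RRe_real // gtr0_real.
move=> w wz; have [->|wNz] := eqVneq w z.
  by rewrite !subrr mulr0 subr0 normc0 mulr0.
have wz0 : w - z != 0 by rewrite subr_eq0.
have /H : ball_ [eta Num.norm] 0 d (w - z).
  by rewrite /ball_ /= sub0r normrN normc_normr dR ltcR.
move=> /(_ wz0) /=.
rewrite -[_ *: 1]/((w - z) * 1) mulr1 subrK.
rewrite -[_ *: (_ - _)]/((w - z)^-1 * (f w - f z)) => {}H.
have -> : f w - f z - l * (w - z) = - (l - (w - z)^-1 * (f w - f z)) * (w - z).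
  by rewrite mulNr mulrBl mulrAC mulVf // mul1r opprB.
rewrite normcM normc_opp ler_wpM2r ?normc_ge0 //.
by move: H; rewrite normc_normr lecR.
Qed.

Lemma cdiff_derivable f z l : cdiff f z l ->
  derivable (f : R[i]^o -> R[i]^o) z 1.
Proof.
move=> df; apply/cvg_ex; exists l; apply/cvgrPdist_le => /= e e0.
have eR : e = (Re e)%:C by rewrite RRe_real // gtr0_real.
have /df[d d0 H] : 0 < Re e by move: e0; rewrite ltcE => /andP[].
rewrite near_withinE; exists d%:C => /=; first by rewrite ltcR.
move=> h; rewrite /ball_ /= sub0r normrN normc_normr ltcR => hd h0.
rewrite -[_ *: 1]/(h * 1) mulr1 -[_ *: (_ - _)]/(h^-1 * (f (h + z) - f z)).
have := H (h + z); rewrite addrK => /(_ hd).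
rewrite normc_normr {}[in X in _ -> X]eR lecR.
have -> : l - h^-1 * (f (h + z) - f z) = - (f (h + z) - f z - l * h) / h.
  by rewrite opprB mulrBl mulfK // mulrC.
by rewrite normcM normc_opp normcV ler_pdivrMr // normc_gt0.
Qed.

Lemma cdiff_ccont f z l : cdiff f z l -> ccont f z.
Proof.
move=> df e e0; have [d d0 H] := df 1 ltr01.
have c0 : 0 < 2 + normc l by rewrite ltr_wpDr ?normc_ge0.
exists (Num.min d (e / (2 + normc l))).
  by rewrite lt_min d0 divr_gt0.
move=> w; rewrite lt_min => /andP[wd we].
have -> : f w - f z = (f w - f z - l * (w - z)) + l * (w - z) by rewrite subrK.
apply: le_lt_trans (normc_leD _ _) _; rewrite normcM.
have := H w wd; rewrite mul1r; move: we; rewrite ltr_pdivlMr // mulrDr.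
rewrite (mulrC (normc l)).
have := normc_ge0 (w - z); lra.
Qed.

Lemma cdiff_local f g z l (d : R) : 0 < d ->
  (forall w, normc (w - z) < d -> g w = f w) -> cdiff f z l -> cdiff g z l.
Proof.
move=> d0 fg df e /df[d' d'0 H]; exists (Num.min d d').
  by rewrite lt_min d0.
move=> w; rewrite lt_min => /andP[wd wd']; rewrite !fg ?subrr ?normc0 //.
exact: H.
Qed.

End ComplexDerivative.

(** * Curves in the plane and their integrals *)

Section CurveContinuity.
Variable R : realType.
Implicit Types (F G : R -> R[i]) (t : R).

Lemma continuous_for_ext (f g : R -> R) t : (forall u, f u = g u) ->
  {for t, continuous f} -> {for t, continuous g}.
Proof. by move=> /funext ->. Qed.

(** Componentwise, so that real integration applies to both components;
    [contRP] is the equivalent form in terms of the modulus. *)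
Definition contR F t :=
  {for t, continuous (fun u => Re (F u))} /\
  {for t, continuous (fun u => Im (F u))}.

Lemma contRP F t : contR F t <-> forall e : R, 0 < e ->
  exists2 d : R, 0 < d & forall u, `|u - t| < d -> normc (F u - F t) < e.
Proof.
split=> [[cR cI] e e0|H].
  have e2 : 0 < e / 2 by rewrite divr_gt0.
  have nb : \forall u \near t, normc (F u - F t) < e.
    have H1 := (cvgrPdist_lt _ _).1 cR _ e2.
    have H2 := (cvgrPdist_lt _ _).1 cI _ e2.
    near=> u; apply: le_lt_trans (normc_ReIm _) _.
    rewrite cReD cImD cReN cImN -(normrN (_ - _)) -(normrN (Im _ - _)) !opprB.
    have h1 : `|Re (F t) - Re (F u)| < e / 2 by near: u; exact: H1.
    have h2 : `|Im (F t) - Im (F u)| < e / 2 by near: u; exact: H2.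
    lra.
  move: nb => /nbhs_ballP[d /= d0 H]; exists d => // u ut.
  by apply: H; rewrite /ball /= distrC.
split; apply/cvgrPdist_lt => e /H[d d0 Hd]; apply/nbhs_ballP; exists d => //=.
  move=> u; rewrite /ball /= distrC => /Hd; rewrite normc_sub.
  by apply: le_lt_trans; rewrite -cReN -cReD normc_Re.
move=> u; rewrite /ball /= distrC => /Hd; rewrite normc_sub.
by apply: le_lt_trans; rewrite -cImN -cImD normc_Im.
Unshelve. all: by end_near. Qed.

Lemma contR_comp (f : R[i] -> R[i]) F t :
  ccont f (F t) -> contR F t -> contR (fun u => f (F u)) t.
Proof.
move=> cf /contRP cF; apply/contRP => e /cf[d d0 H].
by have [d' d'0 H'] := cF _ d0; exists d' => // u /H' /H.
Qed.

Lemma contR_cst (c : R[i]) t : contR (fun=> c) t.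
Proof. by split; exact: cvg_cst. Qed.

Lemma contRD F G t : contR F t -> contR G t -> contR (fun u => F u + G u) t.
Proof.
move=> [a b] [c d]; split.
  apply: (continuous_for_ext (fun u => esym (cReD (F u) (G u)))).
  exact: (@continuousD _ _ _ _ _ t a c).
apply: (continuous_for_ext (fun u => esym (cImD (F u) (G u)))).
exact: (@continuousD _ _ _ _ _ t b d).
Qed.

Lemma contRN F t : contR F t -> contR (fun u => - F u) t.
Proof.
move=> [a b]; split.
  apply: (continuous_for_ext (fun u => esym (cReN (F u)))).
  exact: (@continuousN _ _ _ _ t a).
apply: (continuous_for_ext (fun u => esym (cImN (F u)))).
exact: (@continuousN _ _ _ _ t b).
Qed.

Lemma contRB F G t : contR F t -> contR G t -> contR (fun u => F u - G u) t.
Proof. by move=> cF cG; apply: contRD => //; exact: contRN. Qed.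

Lemma contRM F G t : contR F t -> contR G t -> contR (fun u => F u * G u) t.
Proof.
move=> [a b] [c d]; split.
  have E u : Re (F u) * Re (G u) - Im (F u) * Im (G u) = Re (F u * G u).
    by rewrite cReM.
  apply: (@continuous_for_ext _ _ t E).
  exact: (@continuousB _ _ _ _ _ t (@continuousM _ _ _ _ t a c) (@continuousM _ _ _ _ t b d)).
have E u : Re (F u) * Im (G u) + Im (F u) * Re (G u) = Im (F u * G u).
  by rewrite cImM.
apply: (@continuous_for_ext _ _ t E).
exact: (@continuousD _ _ _ _ _ t (@continuousM _ _ _ _ t a d) (@continuousM _ _ _ _ t b c)).
Qed.

Lemma contR_normc2 F t : contR F t -> {for t, continuous (fun u => normc (F u) ^+ 2)}.
Proof.
move=> [a b]; apply: (continuous_for_ext (fun u => esym (normcE2 (F u)))).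
exact: (@continuousD _ _ _ _ _ t (@continuousM _ _ _ _ t a a) (@continuousM _ _ _ _ t b b)).
Qed.

Lemma contR_normc F t : contR F t -> {for t, continuous (fun u => normc (F u))}.
Proof.
move=> /contR_normc2 c2.
have E u : Num.sqrt (normc (F u) ^+ 2) = normc (F u).
  by rewrite sqrtr_sqr ger0_norm // normc_ge0.
apply: (continuous_for_ext E).
by apply: continuous_comp => //; exact: sqrt_continuous.
Qed.

Lemma contRV F t : F t != 0 -> contR F t -> contR (fun u => (F u)^-1) t.
Proof.
move=> F0 cF; have [a b] := cF; have c2 := contR_normc2 cF.
have n0 : normc (F t) ^+ 2 != 0 by rewrite sqrf_eq0 normc_eq0.
split.
  apply: (continuous_for_ext (fun u => esym (cReV (F u)))).
  exact: (@continuousM _ _ _ _ t a (@continuousV _ _ _ t n0 c2)).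
apply: (continuous_for_ext (fun u => esym (cImV (F u)))).
exact: (@continuousM _ _ _ _ t (@continuousN _ _ _ _ t b) (@continuousV _ _ _ t n0 c2)).
Qed.

End CurveContinuity.

Section ComplexIntegral.
Variable R : realType.
Notation mu := (@lebesgue_measure R).
Implicit Types (D : set R) (F G : R -> R[i]) (c : R[i]).

Definition cintegrable D F :=
  mu.-integrable D (EFin \o (fun t => Re (F t))) /\
  mu.-integrable D (EFin \o (fun t => Im (F t))).

Definition cint D F : R[i] :=
  (\int[mu]_(t in D) Re (F t)) +i* (\int[mu]_(t in D) Im (F t)).

Lemma eq_cint D F G : (forall t, D t -> F t = G t) -> cint D F = cint D G.
Proof.
by move=> FG; congr (_ +i* _); apply: eq_Rintegral => t /set_mem /FG ->.
Qed.

Lemma cintegrableD D F G : measurable D ->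
  cintegrable D F -> cintegrable D G -> cintegrable D (fun t => F t + G t).
Proof.
move=> mD [a b] [c d]; split.
  rewrite (_ : _ \o _ = ((EFin \o (fun t => Re (F t))) \+ (EFin \o (fun t => Re (G t))))%E).
    exact: integrableD.
  by apply/funext => t /=; rewrite cReD.
rewrite (_ : _ \o _ = ((EFin \o (fun t => Im (F t))) \+ (EFin \o (fun t => Im (G t))))%E).
  exact: integrableD.
by apply/funext => t /=; rewrite cImD.
Qed.

Lemma cintD D F G : measurable D -> cintegrable D F -> cintegrable D G ->
  cint D (fun t => F t + G t) = cint D F + cint D G.
Proof.
move=> mD [a b] [c d]; apply: eq_ReIm; rewrite ?cReD ?cImD /=.
  by under eq_Rintegral do rewrite cReD; rewrite RintegralD.
by under eq_Rintegral do rewrite cImD; rewrite RintegralD.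
Qed.

Lemma integrable_scale D (k : R) (f : R -> R) : measurable D ->
  mu.-integrable D (EFin \o f) -> mu.-integrable D (EFin \o (fun t => k * f t)).
Proof.
move=> mD fi; rewrite (_ : _ \o _ = (fun t => k%:E * (EFin \o f) t)%E).
  exact: integrableZl.
by apply/funext => t /=; rewrite EFinM.
Qed.

Lemma cintegrableZ D c F : measurable D ->
  cintegrable D F -> cintegrable D (fun t => c * F t).
Proof.
move=> mD [a b]; split.
  rewrite (_ : _ \o _ = ((EFin \o (fun t => (Re c * Re (F t))%R)) \- (EFin \o (fun t => (Im c * Im (F t))%R)))%E).
    by apply: integrableB => //; exact: integrable_scale.
  by apply/funext => t /=; rewrite cReM EFinB.
rewrite (_ : _ \o _ = ((EFin \o (fun t => (Re c * Im (F t))%R)) \+ (EFin \o (fun t => (Im c * Re (F t))%R)))%E).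
  by apply: integrableD => //; exact: integrable_scale.
by apply/funext => t /=; rewrite cImM EFinD.
Qed.

Lemma cintZ D c F : measurable D -> cintegrable D F ->
  cint D (fun t => c * F t) = c * cint D F.
Proof.
move=> mD [a b]; apply: eq_ReIm; rewrite ?cReM ?cImM /=.
  under eq_Rintegral do rewrite cReM.
  by rewrite RintegralB ?RintegralZl//; exact: integrable_scale.
under eq_Rintegral do rewrite cImM.
by rewrite RintegralD ?RintegralZl//; exact: integrable_scale.
Qed.

Lemma cintegrableN D F : measurable D ->
  cintegrable D F -> cintegrable D (fun t => - F t).
Proof.
move=> mD /(cintegrableZ (-1) mD); congr cintegrable; apply/funext => t.
by rewrite mulN1r.
Qed.

Lemma cintN D F : measurable D -> cintegrable D F ->
  cint D (fun t => - F t) = - cint D F.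
Proof.
move=> mD Fi; rewrite -mulN1r -cintZ //; apply: eq_cint => t _.
by rewrite mulN1r.
Qed.

Lemma cintegrableB D F G : measurable D ->
  cintegrable D F -> cintegrable D G -> cintegrable D (fun t => F t - G t).
Proof. by move=> mD Fi Gi; apply: cintegrableD => //; exact: cintegrableN. Qed.

Lemma cintB D F G : measurable D -> cintegrable D F -> cintegrable D G ->
  cint D (fun t => F t - G t) = cint D F - cint D G.
Proof.
by move=> mD Fi Gi; rewrite cintD ?cintN //; exact: cintegrableN.
Qed.

Lemma cintegrableS D1 D2 F : measurable D1 -> measurable D2 -> D1 `<=` D2 ->
  cintegrable D2 F -> cintegrable D1 F.
Proof.
by move=> m1 m2 D12 [a b]; split; apply: (@integrableS _ _ _ mu D2) => //.
Qed.

Definition cmeasurable D F := measurable_fun D (fun t => Re (F t)) /\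
  measurable_fun D (fun t => Im (F t)).

Lemma cmeasurable_integrable D F (g : R -> R) : measurable D ->
  cmeasurable D F -> mu.-integrable D (EFin \o g) ->
  (forall t, D t -> normc (F t) <= g t) -> cintegrable D F.
Proof.
move=> mD [mR mI] gi Fg; split; apply: le_integrable gi => //.
- exact/measurable_EFinP.
- move=> t Dt /=; rewrite lee_fin (le_trans (normc_Re _)) //.
  by rewrite (le_trans (Fg _ Dt)) // ler_norm.
- exact/measurable_EFinP.
- move=> t Dt /=; rewrite lee_fin (le_trans (normc_Im _)) //.
  by rewrite (le_trans (Fg _ Dt)) // ler_norm.
Qed.

(** The constant 2 is the price of estimating the two components separately. *)
Lemma cint_norm_le D F (g : R -> R) : measurable D ->
  cintegrable D F -> mu.-integrable D (EFin \o g) ->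
  (forall t, D t -> normc (F t) <= g t) ->
  normc (cint D F) <= 2 * \int[mu]_(t in D) g t.
Proof.
move=> mD [a b] gi Fg; apply: le_trans (normc_ReIm _) _.
rewrite mulr_natl mulr2n /= lerD //.
  apply: le_trans (@le_normr_Rintegral _ _ _ mu D (fun t => Re (F t)) mD a) _.
  apply: le_Rintegral => //; last first.
    by move=> t Dt; rewrite (le_trans (normc_Re _)) ?Fg.
  by move/integrable_norm : a; apply: eq_integrable.
apply: le_trans (@le_normr_Rintegral _ _ _ mu D (fun t => Im (F t)) mD b) _.
apply: le_Rintegral => //; last first.
  by move=> t Dt; rewrite (le_trans (normc_Im _)) ?Fg.
by move/integrable_norm : b; apply: eq_integrable.
Qed.

Lemma cont_cmeasurable (a b : R) F :
  (forall t, a < t < b -> contR F t) -> cmeasurable `]a, b[ F.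
Proof.
move=> cF; split; apply: open_continuous_measurable_fun => // t /set_mem /=;
  by rewrite in_itv /= => /cF[].
Qed.

Lemma cont_integrable (a b : R) (f : R -> R) :
  (forall t, a <= t <= b -> {for t, continuous f}) ->
  mu.-integrable `[a, b] (EFin \o f).
Proof.
move=> cf; apply: continuous_compact_integrable; first exact: segment_compact.
by apply: continuous_in_subspaceT => t /set_mem /=; rewrite in_itv /=; exact: cf.
Qed.

Lemma cont_cintegrable (a b : R) F :
  (forall t, a <= t <= b -> contR F t) -> cintegrable `[a, b] F.
Proof. by move=> cF; split; apply: cont_integrable => t /cF[]. Qed.

Lemma Rintegral_segment_cst (a b k : R) : a <= b ->
  \int[mu]_(t in `[a, b]) k = k * (b - a).
Proof.
move=> ab; have -> : b - a = fine (mu `[a, b]).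
  rewrite lebesgue_measure_itv /= lte_fin.
  by move: ab; rewrite le_eqVlt => /predU1P[->|->] //; rewrite ltxx subrr.
exact: (@Rintegral_cst _ _ _ mu).
Qed.

Lemma segment_cst_integrable (a b k : R) : mu.-integrable `[a, b] (EFin \o (fun=> k)).
Proof. by apply: cont_integrable => t _; exact: cvg_cst. Qed.

Lemma cint_segment_le (a b : R) F (k : R) : a <= b ->
  cintegrable `[a, b] F ->
  (forall t, a <= t <= b -> normc (F t) <= k) ->
  normc (cint `[a, b] F) <= 2 * (k * (b - a)).
Proof.
move=> ab Fi Fk; rewrite -Rintegral_segment_cst //.
apply: cint_norm_le => //; exact: segment_cst_integrable.
Qed.

Lemma Rintegral_segment_split (a b c : R) (f : R -> R) : a <= b -> b <= c ->
  mu.-integrable `[a, c] (EFin \o f) ->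
  \int[mu]_(t in `[a, c]) f t =
  \int[mu]_(t in `[a, b]) f t + \int[mu]_(t in `[b, c]) f t.
Proof.
move=> ab bc fi; apply/eqP; rewrite addrC -subr_eq; apply/eqP.
rewrite (Rintegral_itvB fi) ?bnd_simp // Rintegral_itv_obnd_cbnd //.
by apply: integrableS fi => //; apply: subset_itvr; rewrite bnd_simp.
Qed.

Lemma cint_split (a b c : R) F : a <= b -> b <= c -> cintegrable `[a, c] F ->
  cint `[a, c] F = cint `[a, b] F + cint `[b, c] F.
Proof.
by move=> ab bc [i1 i2]; apply: eq_ReIm; rewrite /= ; apply: Rintegral_segment_split.
Qed.

Definition cderiv F (t : R) (l : R[i]) :=
  is_derive t (1 : R) (fun u => Re (F u)) (Re l) /\
  is_derive t (1 : R) (fun u => Im (F u)) (Im l).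

Lemma is_derive_ext (f g : R -> R) (t k l : R) : (forall u, f u = g u) -> k = l ->
  is_derive t (1 : R) f k -> is_derive t (1 : R) g l.
Proof. by move=> /funext -> ->. Qed.

Lemma is_derive_mulR (f g : R -> R) (t k l : R) :
  is_derive t (1 : R) f k -> is_derive t (1 : R) g l ->
  is_derive t (1 : R) (fun u => f u * g u) (k * g t + f t * l).
Proof.
move=> df dg; have [dfg E] := is_deriveM df dg; split => //.
by rewrite E; transitivity (f t * l + g t * k) => //; ring.
Qed.

Lemma is_derive_invR (f : R -> R) (t k : R) : f t != 0 ->
  is_derive t (1 : R) f k -> is_derive t (1 : R) (fun u => (f u)^-1) (- k / f t ^+ 2).
Proof.
move=> f0 df; have [dfV E] := is_deriveV f0 df; split => //.
by rewrite E; transitivity (- (f t ^+ 2)^-1 * k) => //; rewrite mulNr mulrC mulNr.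
Qed.

Lemma is_derive_continuous (f : R -> R) (t k : R) :
  is_derive t (1 : R) f k -> {for t, continuous f}.
Proof. by case=> d _; apply: differentiable_continuous; apply/derivable1_diffP. Qed.

Lemma cderiv_contR F t l : cderiv F t l -> contR F t.
Proof.
by move=> [d1 d2]; split; [exact: is_derive_continuous d1|exact: is_derive_continuous d2].
Qed.

Lemma cderiv_cst c t : cderiv (fun=> c) t 0.
Proof. by split; exact: is_derive_cst. Qed.

Lemma cderivD F G t k l : cderiv F t k -> cderiv G t l ->
  cderiv (fun u => F u + G u) t (k + l).
Proof.
move=> [a b] [c d]; split.
  by apply: is_derive_ext (is_deriveD a c) => [u|]; rewrite /= cReD.
by apply: is_derive_ext (is_deriveD b d) => [u|]; rewrite /= cImD.
Qed.

Lemma cderivM F G t k l : cderiv F t k -> cderiv G t l ->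
  cderiv (fun u => F u * G u) t (k * G t + F t * l).
Proof.
move=> [a b] [c d]; split.
  apply: is_derive_ext (is_deriveB (is_derive_mulR a c) (is_derive_mulR b d)) => [u|].
    by rewrite /= cReM.
  by rewrite cReD !cReM; ring.
apply: is_derive_ext (is_deriveD (is_derive_mulR a d) (is_derive_mulR b c)) => [u|].
  by rewrite /= cImM.
by rewrite cImD !cImM; ring.
Qed.

Lemma cderivV F t l : F t != 0 -> cderiv F t l ->
  cderiv (fun u => (F u)^-1) t (- l / F t ^+ 2).
Proof.
move=> F0 [a b].
have n0 : Re (F t) ^+ 2 + Im (F t) ^+ 2 != 0.
  by rewrite -normcE2 sqrf_eq0 normc_eq0.
have n : is_derive t (1 : R) (fun u => Re (F u) * Re (F u) + Im (F u) * Im (F u))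
    (2 * (Re (F t) * Re l + Im (F t) * Im l)).
  apply: is_derive_ext (is_deriveD (is_derive_mulR a a) (is_derive_mulR b b)) => //.
  by ring.
have n0' : Re (F t) * Re (F t) + Im (F t) * Im (F t) != 0 by rewrite -!expr2.
have nV := @is_derive_invR (fun u => Re (F u) * Re (F u) + Im (F u) * Im (F u)) t _ n0' n.
have E2 (x y : R) : (x * x - y * y) ^+ 2 + (x * y + y * x) ^+ 2 = (x * x + y * y) ^+ 2.
  by ring.
have bN : is_derive t (1 : R) (fun u => - Im (F u)) (- Im l) by exact: is_deriveN b.
split.
  apply: is_derive_ext (is_derive_mulR a nV) => [u|]; first by rewrite cReV normcE2.
  rewrite expr2 cReM cReV cImV cReN cImN normcE2 !cReM !cImM.
  by field; apply/andP; split => //; rewrite (E2 (Re (F t)) (Im (F t))) expf_neq0.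
apply: is_derive_ext (is_derive_mulR bN nV) => [u|].
  by rewrite cImV normcE2.
rewrite expr2 cImM cReV cImV cReN cImN normcE2 !cReM !cImM.
by field; apply/andP; split => //; rewrite (E2 (Re (F t)) (Im (F t))) expf_neq0.
Qed.

Lemma Rintegral_derive (f g : R -> R) (a b : R) : a <= b ->
  (forall t, a <= t <= b -> is_derive t (1 : R) f (g t)) ->
  (forall t, a <= t <= b -> {for t, continuous g}) ->
  \int[mu]_(t in `[a, b]) g t = f b - f a.
Proof.
rewrite le_eqVlt => /predU1P[-> _ _|ab df cg].
  by rewrite set_itv1 Rintegral_set1 subrr.
have cf t : a <= t <= b -> {for t, continuous f}.
  by move=> /df; exact: is_derive_continuous.
rewrite /Rintegral (@continuous_FTC2 _ g f) //.
- by apply: continuous_in_subspaceT => t /set_mem /=; rewrite in_itv /=; exact: cg.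
- split.
  + by move=> t /[!in_itv] /= /andP[at_ tb]; case: (df t) => //; rewrite !ltW.
  + by apply: cvg_at_right_filter; apply: cf; rewrite lexx ltW.
  + by apply: cvg_at_left_filter; apply: cf; rewrite lexx ltW.
- move=> t /[!in_itv] /= /andP[at_ tb]; rewrite derive1E.
  by case: (df t) => //; rewrite !ltW.
Qed.

(** The fundamental theorem of calculus, componentwise. *)
Lemma cint_derive F G (a b : R) : a <= b ->
  (forall t, a <= t <= b -> cderiv F t (G t)) ->
  (forall t, a <= t <= b -> contR G t) ->
  cint `[a, b] G = F b - F a.
Proof.
move=> ab dF cG; apply: eq_ReIm; rewrite ?cReD ?cImD ?cReN ?cImN /=.
  apply: (@Rintegral_derive (fun t => Re (F t)) (fun t => Re (G t))) => //.
    by move=> t /dF[].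
  by move=> t /cG[].
apply: (@Rintegral_derive (fun t => Im (F t)) (fun t => Im (G t))) => //.
  by move=> t /dF[].
by move=> t /cG[].
Qed.

End ComplexIntegral.

(** * Goursat's bisection argument *)

(** The argument is carried out for an arbitrary function of rectangles; the one
    of interest is the integral along the image of the boundary of
    [[a, b] x [c, d]] under the parametrization of the diamond by arcs. *)
Section Goursat.
Variable R : realType.
Variable mu : R -> R -> R -> R -> R[i].
Variables A B C E : R.

Definition additive_rect :=
  (forall a m b c d, A <= a -> a <= m -> m <= b -> b <= B ->
     C <= c -> c <= d -> d <= E -> mu a b c d = mu a m c d + mu m b c d) /\
  (forall a b c m d, A <= a -> a <= b -> b <= B ->
     C <= c -> c <= m -> m <= d -> d <= E -> mu a b c d = mu a b c m + mu a b m d).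

(** At a point where the integrand is differentiable, the integral along the
    boundary of a rectangle is negligible before the square of its diameter. *)
Definition small_at (p r : R) := forall e : R, 0 < e ->
  exists2 d : R, 0 < d & forall a b c g, A <= a -> a <= p -> p <= b -> b <= B ->
    C <= c -> c <= r -> r <= g -> g <= E -> b - a < d -> g - c < d ->
    normc (mu a b c g) <= e * ((b - a) + (g - c)) ^+ 2.

Let rect := ((R * R) * (R * R))%type.
Let mur (q : rect) := mu q.1.1 q.1.2 q.2.1 q.2.2.

Definition quarter (q : rect) (i j : bool) : rect :=
  let: ((a, b), (c, d)) := q in
  ((if i then (a, (a + b) / 2) else ((a + b) / 2, b)),
   (if j then (c, (c + d) / 2) else ((c + d) / 2, d))).

Definition quarter_big (q : rect) (i j : bool) :=
  normc (mur q) <= 4 * normc (mur (quarter q i j)).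

Definition bisect (q : rect) : rect :=
  if quarter_big q true true then quarter q true true else
  if quarter_big q true false then quarter q true false else
  if quarter_big q false true then quarter q false true else
  quarter q false false.

Lemma midpoint (x y : R) : x <= y -> [/\ x <= (x + y) / 2, (x + y) / 2 <= y,
  (x + y) / 2 - x = (y - x) / 2 & y - (x + y) / 2 = (y - x) / 2].
Proof. by move=> xy; split; lra. Qed.

Let inside (q : rect) := [/\ A <= q.1.1, q.1.1 <= q.1.2, q.1.2 <= B,
  C <= q.2.1 & q.2.1 <= q.2.2 /\ q.2.2 <= E].

Lemma bisect_quarter q : exists i j, bisect q = quarter q i j.
Proof.
by rewrite /bisect; do ?case: ifP => _; do 2 eexists.
Qed.

Lemma bisect_inside q : inside q -> inside (bisect q).
Proof.
have [i [j ->]] := bisect_quarter q.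
case: q => -[a b] [c d] [/= h1 h2 h3 h4 [h5 h6]].
by case: i; case: j; split => //=; try split; lra.
Qed.

(** By additivity, one of the four quarters carries at least a quarter of the
    modulus. *)
Lemma bisect_big q : additive_rect -> inside q ->
  normc (mur q) <= 4 * normc (mur (bisect q)).
Proof.
move=> [hs ht] iq.
suff H : [|| quarter_big q true true, quarter_big q true false,
    quarter_big q false true | quarter_big q false false].
  rewrite /bisect; case: ifPn => [//|h1]; case: ifPn => [//|h2].
  case: ifPn => [//|h3].
  by move: H; rewrite (negPf h1) (negPf h2) (negPf h3).
apply/negPn; rewrite !negb_or /quarter_big -!ltNge; apply/negP => /and4P[].
case: q iq => -[a b] [c d] [/= h1 h2 h3 h4 [h5 h6]]; rewrite /mur /=.
set m := (a + b) / 2; set n := (c + d) / 2 => k1 k2 k3 k4.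
have am : a <= m by rewrite /m; lra.
have mb : m <= b by rewrite /m; lra.
have cn : c <= n by rewrite /n; lra.
have nd : n <= d by rewrite /n; lra.
have e1 := hs a m b c d h1 am mb h3 h4 h5 h6.
have e2 := ht a m c n d h1 am (le_trans mb h3) h4 cn nd h6.
have e3 := ht m b c n d (le_trans h1 am) mb h3 h4 cn nd h6.
have : normc (mu a b c d) <= (normc (mu a m c n) + normc (mu a m n d)) +
   (normc (mu m b c n) + normc (mu m b n d)).
  rewrite e1; apply: le_trans (normc_leD _ _) _.
  by rewrite e2 e3 lerD // normc_leD.
lra.
Qed.

(** After [n] bisections the modulus has lost a factor [4 ^+ n] at most, while
    smallness at the common point of the nested rectangles makes it negligible
    before the square of the diameter, that is before [4 ^- n]. *)
Lemma goursat a b c d : additive_rect ->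
  A <= a -> a <= b -> b <= B -> C <= c -> c <= d -> d <= E ->
  (forall p r, a <= p <= b -> c <= r <= d -> small_at p r) ->
  mu a b c d = 0.
Proof.
move=> add h1 h2 h3 h4 h5 h6 small.
pose q n : rect := iter n bisect ((a, b), (c, d)).
have iq n : inside (q n).
  by elim: n => [|n IH]; [split|exact: bisect_inside].
have step n : [/\ (q n).1.1 <= (q n.+1).1.1, (q n.+1).1.2 <= (q n).1.2,
    (q n).2.1 <= (q n.+1).2.1 & (q n.+1).2.2 <= (q n).2.2] /\
    ((q n.+1).1.2 - (q n.+1).1.1 = ((q n).1.2 - (q n).1.1) / 2 /\
     (q n.+1).2.2 - (q n.+1).2.1 = ((q n).2.2 - (q n).2.1) / 2).
  have -> : q n.+1 = bisect (q n) by [].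
  have [i [j ->]] := bisect_quarter (q n).
  case: (q n) (iq n) => -[a' b'] [c' d'] [/= k1 k2 k3 k4 [k5 k6]].
  have [m1 m2 m3 m4] := midpoint k2; have [n1 n2 n3 n4] := midpoint k5.
  by case: i; case: j.
have width n : (q n).1.2 - (q n).1.1 = (b - a) / 2 ^+ n /\
    (q n).2.2 - (q n).2.1 = (d - c) / 2 ^+ n.
  elim: n => [|n [IH1 IH2]]; first by rewrite expr0 !divr1.
  have [_ [-> ->]] := step n; rewrite IH1 IH2 exprSr invfM.
  by rewrite !mulrA.
have big n : normc (mu a b c d) <= 4 ^+ n * normc (mur (q n)).
  elim: n => [|n IH]; first by rewrite expr0 mul1r.
  apply: le_trans IH _; rewrite exprSr -mulrA ler_wpM2l ?exprn_ge0 //.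
  exact: bisect_big.
have mono n m : (n <= m)%N -> [/\ (q n).1.1 <= (q m).1.1, (q m).1.2 <= (q n).1.2,
    (q n).2.1 <= (q m).2.1 & (q m).2.2 <= (q n).2.2].
  move=> /subnKC <-; elim: (m - n)%N => [|k [IH1 IH2 IH3 IH4]].
    by rewrite addn0; split.
  rewrite addnS; have [[s1 s2 s3 s4] _] := step (n + k)%N.
  by split; [exact: le_trans s1|exact: le_trans IH2|exact: le_trans s3|
    exact: le_trans IH4].
have cross n m : (q n).1.1 <= (q m).1.2 /\ (q n).2.1 <= (q m).2.2.
  have [i1 i2 i3 i4 [i5 i6]] := iq n; have [j1 j2 j3 j4 [j5 j6]] := iq m.
  have [/mono[k1 k2 k3 k4]|/ltnW /mono[k1 k2 k3 k4]] := leqP n m.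
    by split; [exact: le_trans j2|exact: le_trans j5].
  by split; [exact: le_trans k2|exact: le_trans k4].
pose p := sup (range (fun n => (q n).1.1)).
pose r := sup (range (fun n => (q n).2.1)).
have pP n : (q n).1.1 <= p <= (q n).1.2.
  apply/andP; split.
    apply: ub_le_sup; last by exists n.
    by exists b => _ [m _ <-]; exact: (cross m 0%N).1.
  by apply: ge_sup; [exists a; exists 0%N|move=> _ [m _ <-]; exact: (cross m n).1].
have rP n : (q n).2.1 <= r <= (q n).2.2.
  apply/andP; split.
    apply: ub_le_sup; last by exists n.
    by exists d => _ [m _ <-]; exact: (cross m 0%N).2.
  by apply: ge_sup; [exists c; exists 0%N|move=> _ [m _ <-]; exact: (cross m n).2].
apply: eq0_normc; apply/eqP; rewrite eq_le normc_ge0 andbT.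
pose S := (b - a) + (d - c).
have S0 : 0 <= S by rewrite addr_ge0 // subr_ge0.
apply/ler_addgt0Pr => e e0; rewrite add0r.
have e'0 : 0 < e / (S ^+ 2 + 1) by rewrite divr_gt0 // ltr_wpDl // sqr_ge0.
have [del del0 H] := small p r (pP 0%N) (rP 0%N) _ e'0.
(* [n] is large enough for the [n]-th rectangle to have sides shorter than [del]. *)
pose n := Num.bound (S / del).
have pw : S / 2 ^+ n < del.
  rewrite ltr_pdivrMr ?exprn_gt0 // mulrC -ltr_pdivrMr //.
  apply: lt_le_trans (archi_boundP _) _; first by rewrite divr_ge0 // ltW.
  by rewrite -natrX ler_nat ltnW // ltn_expl.
have [w1 w2] := width n; have [i1 i2 i3 i4 [i5 i6]] := iq n.
have /andP[p1 p2] := pP n; have /andP[r1 r2] := rP n.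
have pw0 : 0 < 2 ^+ n :> R by rewrite exprn_gt0.
have := H _ _ _ _ i1 p1 p2 i3 i4 r1 r2 i6.
rewrite w1 w2 => /(_ _ _)/wrap[].
- by apply: le_lt_trans pw; rewrite ler_pM2r ?invr_gt0 // /S lerDl subr_ge0.
- by apply: le_lt_trans pw; rewrite ler_pM2r ?invr_gt0 // /S lerDr subr_ge0.
rewrite -mulrDl -/S => Hn; apply: le_trans (big n) _.
apply: le_trans (ler_wpM2l _ Hn) _; first by rewrite exprn_ge0.
have -> : 4 ^+ n * (e / (S ^+ 2 + 1) * (S / 2 ^+ n) ^+ 2) =
    e * (S ^+ 2 / (S ^+ 2 + 1)).
  have -> : 4 ^+ n = (2 ^+ n) ^+ 2 :> R.
    by rewrite -exprM mulnC exprM; congr (_ ^+ n); ring.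
  have S1 : S ^+ 2 + 1 != 0 by rewrite gt_eqF // ltr_wpDl // sqr_ge0.
  by field; rewrite S1 gt_eqF.
rewrite ler_piMr ?(ltW e0) // ler_pdivrMr ?mul1r ?lerDl //.
by rewrite ltr_wpDl // sqr_ge0.
Qed.

(** Four rectangles that avoid the exceptional point surround a square of
    half-side [h] around it and contribute nothing, so the value of [mu] is that
    of the square, which tends to 0 with [h]. *)
Lemma goursat_except a b c d (s0 t0 r0 K : R) : additive_rect ->
  A <= a -> a <= b -> b <= B -> C <= c -> c <= d -> d <= E ->
  a < s0 < b -> c < t0 < d -> 0 < r0 -> 0 <= K ->
  (forall h, 0 < h -> h <= r0 ->
     normc (mu (s0 - h) (s0 + h) (t0 - h) (t0 + h)) <= K * h) ->
  (forall p r, a <= p <= b -> c <= r <= d -> (p != s0) || (r != t0) ->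
     small_at p r) ->
  mu a b c d = 0.
Proof.
move=> add h1 h2 h3 h4 h5 h6 /andP[s1 s2] /andP[t1 t2] r00 K0 bnd small.
apply: eq0_normc; apply/eqP; rewrite eq_le normc_ge0 andbT.
apply/ler_addgt0Pr => e e0; rewrite add0r.
have K1 : 0 < K + 1 by rewrite ltr_wpDl.
have [h [h0 he hr [ha hb] [hc hd]]] : exists h : R, [/\ 0 < h, h <= e / (K + 1),
    h <= r0, h <= s0 - a /\ h <= b - s0 & h <= t0 - c /\ h <= d - t0].
  exists (Num.min (Num.min (e / (K + 1)) r0) (Num.min (Num.min (s0 - a) (b - s0))
    (Num.min (t0 - c) (d - t0)))).
  by rewrite !lt_min !ge_min !subr_gt0 s1 s2 t1 t2 r00 divr_gt0 // !lexx !orbT.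
have [hs ht] := add.
have l1 : a <= s0 - h by lra.
have l2 : s0 - h <= s0 + h by lra.
have l3 : s0 + h <= b by lra.
have l4 : c <= t0 - h by lra.
have l5 : t0 - h <= t0 + h by lra.
have l6 : t0 + h <= d by lra.
have l7 : s0 - h <= b by exact: le_trans l3.
have l8 : t0 - h <= d by exact: le_trans l6.
have l9 : A <= s0 - h by exact: le_trans l1.
have l10 : C <= t0 - h by exact: le_trans l4.
have l11 : A <= s0 + h by exact: le_trans l2.
have l12 : C <= t0 + h by exact: le_trans l5.
have l13 : s0 + h <= B by exact: le_trans h3.
have l14 : t0 + h <= E by exact: le_trans h6.
have l15 : s0 - h <= B by exact: le_trans l13.
have l16 : t0 - h <= E by exact: le_trans l14.
have e1 : mu a b c d = mu a (s0 - h) c d + (mu (s0 - h) (s0 + h) c d + mu (s0 + h) b c d).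
  rewrite (hs a (s0 - h) b c d h1 l1 l7 h3 h4 h5 h6).
  by rewrite (hs (s0 - h) (s0 + h) b c d l9 l2 l3 h3 h4 h5 h6).
have e2 : mu (s0 - h) (s0 + h) c d = mu (s0 - h) (s0 + h) c (t0 - h) +
   (mu (s0 - h) (s0 + h) (t0 - h) (t0 + h) + mu (s0 - h) (s0 + h) (t0 + h) d).
  rewrite (ht _ _ c (t0 - h) d l9 l2 l13 h4 l4 l8 h6).
  by rewrite (ht _ _ (t0 - h) (t0 + h) d l9 l2 l13 l10 l5 l6 h6).
have z1 : mu a (s0 - h) c d = 0.
  apply: goursat => // p r /andP[p1 p2] rcd; apply: small => //.
    by rewrite p1 (le_trans p2).
  by rewrite lt_eqF // (le_lt_trans p2) // ltrBlDr ltrDl.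
have z2 : mu (s0 + h) b c d = 0.
  apply: goursat => // p r /andP[p1 p2] rcd; apply: small => //.
    by rewrite p2 (le_trans _ p1) // (le_trans l1).
  by rewrite gt_eqF // (lt_le_trans _ p1) // ltrDl.
have z3 : mu (s0 - h) (s0 + h) c (t0 - h) = 0.
  apply: goursat => // p r /andP[p1 p2] /andP[r1 r2]; apply: small.
  - by rewrite (le_trans l1) // (le_trans p2).
  - by rewrite r1 (le_trans r2).
  - by rewrite orbC lt_eqF // (le_lt_trans r2) // ltrBlDr ltrDl.
have z4 : mu (s0 - h) (s0 + h) (t0 + h) d = 0.
  apply: goursat => // p r /andP[p1 p2] /andP[r1 r2]; apply: small.
  - by rewrite (le_trans l1) // (le_trans p2).
  - by rewrite r2 (le_trans _ r1) // (le_trans l4).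
  - by rewrite orbC gt_eqF // (lt_le_trans _ r1) // ltrDl.
rewrite e1 e2 z1 z2 z3 z4 !add0r !addr0.
apply: le_trans (bnd _ h0 hr) _.
move: he; rewrite ler_pdivlMr //; lra.
Qed.

End Goursat.

(** * The arcs joining the two vertices *)

Section Arcs.
Variables (R : realType) (H : R).
Hypothesis H0 : 0 < H.
Implicit Types (s t : R) (F : R[i] -> R[i]).

(** Half-width at height [t] of a lens with the vertices of the diamond.  Its
    graph stays in the diamond ([hw_le]), and it is smooth up to the vertices,
    contrary to the half-width [H - `|t|] of the diamond. *)
Definition hw t := (H ^+ 2 - t ^+ 2) / (2 * H).
Definition carc s t : R[i] := (H + s * hw t) +i* t.
Definition dcarc s t : R[i] := (- (s * t / H)) +i* 1.

Let H20 : 0 < 2 * H. Proof. by rewrite mulr_gt0. Qed.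
Let HN0 : H != 0. Proof. by rewrite gt_eqF. Qed.

Lemma hw_gt0 t : - H < t -> t < H -> 0 < hw t.
Proof. by move=> t1 t2; rewrite divr_gt0 //; nra. Qed.

Lemma hw_ge0 t : - H <= t -> t <= H -> 0 <= hw t.
Proof. by move=> t1 t2; rewrite divr_ge0 ?(ltW H20) //; nra. Qed.

Lemma hwE t : hw t * (2 * H) = H ^+ 2 - t ^+ 2.
Proof. by rewrite divfK // gt_eqF. Qed.

Lemma hw_leH t : hw t <= H.
Proof. by rewrite ler_pdivrMr //; nra. Qed.

Lemma hw_le t : `|t| <= H -> hw t <= H - `|t|.
Proof.
move=> tH; rewrite ler_pdivrMr // -(real_normK (num_real t)).
by have := normr_ge0 t; nra.
Qed.

Lemma hw_vertex : hw H = 0 /\ hw (- H) = 0.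
Proof. by rewrite /hw sqrrN subrr mul0r. Qed.

Lemma hw_lip t t' : - H <= t -> t <= H -> - H <= t' -> t' <= H ->
  `|hw t - hw t'| <= `|t - t'|.
Proof.
move=> a b c d.
have -> : hw t - hw t' = (t' - t) * ((t' + t) / (2 * H)).
  by rewrite /hw; field; rewrite HN0.
rewrite normrM distrC ler_piMr // normrM normfV (gtr0_norm H20).
by rewrite ler_pdivrMr // mul1r ler_norml; lra.
Qed.

Lemma carc_vertex s : carc s H = carc 0 H /\ carc s (- H) = carc 0 (- H).
Proof. by have [a b] := hw_vertex; rewrite /carc a b !mulr0. Qed.

Lemma carc_sub s t s' t' : - H <= t -> t <= H -> - H <= t' -> t' <= H ->
  `|s'| <= 1 ->
  normc (carc s t - carc s' t') <= (H + 2) * (`|s - s'| + `|t - t'|).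
Proof.
move=> a b c d s1; apply: le_trans (normc_ReIm _) _; rewrite /carc /=.
have -> : H + s * hw t - (H + s' * hw t') = (s - s') * hw t + s' * (hw t - hw t').
  by ring.
have l1 : `|(s - s') * hw t| <= `|s - s'| * H.
  by rewrite normrM ler_wpM2l // ger0_norm ?hw_ge0 // hw_leH.
have l2 : `|s' * (hw t - hw t')| <= `|t - t'|.
  by rewrite normrM -[leRHS]mul1r ler_pM // hw_lip.
have := ler_normD ((s - s') * hw t) (s' * (hw t - hw t')).
have := normr_ge0 (s - s'); have := mulr_ge0 (ltW H0) (normr_ge0 (t - t')).
lra.
Qed.

Lemma dcarc_le s t : `|s| <= 1 -> - H <= t -> t <= H -> normc (dcarc s t) <= 2.
Proof.
move=> s1 a b; apply: le_trans (normc_ReIm _) _; rewrite /= normrN normr1.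
suff : `|s * t / H| <= 1 by lra.
rewrite normrM normfV (gtr0_norm H0) ler_pdivrMr // normrM ler_pM //.
by rewrite ler_norml a.
Qed.

Lemma hw_diff t : is_derive t (1 : R) hw (- t / H).
Proof.
have := @is_derive_mulR _ (fun u => (H ^+ 2 - u * u)) (fun=> (2 * H)^-1) t _ _
  (is_deriveB (is_derive_cst _ _ _) (is_derive_mulR (is_derive_id t 1) (is_derive_id t 1)))
  (is_derive_cst _ _ _).
apply: is_derive_ext => [u|]; first by rewrite /hw expr2.
by field; rewrite HN0.
Qed.

Lemma carc_cderiv s t : cderiv (carc s) t (dcarc s t).
Proof.
split => /=; last exact: is_derive_id.
have := is_deriveD (is_derive_cst H t 1) (is_derive_mulR (is_derive_cst s t 1) (hw_diff t)).
by apply: is_derive_ext => //=; field; rewrite HN0.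
Qed.

Lemma carc_cderiv_s s t : cderiv (carc^~ t) s (hw t)%:C.
Proof.
split => /=; last exact: is_derive_cst.
have := is_deriveD (is_derive_cst H s 1) (is_derive_mulR (is_derive_id s 1) (is_derive_cst (hw t) s 1)).
by apply: is_derive_ext => //=; ring.
Qed.

Lemma dcarc_contR s t : contR (dcarc s) t.
Proof.
split => /=; last exact: cvg_cst.
apply: (@continuous_for_ext _ (fun u => (- s / H) * u)); first by move=> u; field.
by apply: (@continuousM _ _ _ _ t) => //; exact: cvg_cst.
Qed.

Lemma carcF_contR F s t : ccont F (carc s t) ->
  contR (fun u => F (carc s u) * dcarc s u) t.
Proof.
move=> cF; apply: contRM; last exact: dcarc_contR.
by apply: contR_comp => //; exact: cderiv_contR (carc_cderiv s t).
Qed.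

Lemma carcF_contR_s F s t : ccont F (carc s t) ->
  contR (fun u => F (carc u t) * (hw t)%:C) s.
Proof.
move=> cF; apply: contRM; last exact: contR_cst.
by apply: (@contR_comp _ _ (carc^~ t)) => //; exact: cderiv_contR (carc_cderiv_s s t).
Qed.

(** The integral of [F] along the image under [carc] of the boundary of
    [[a, b] x [c, d]]; [(hw t)%:C] is the derivative of [carc] in [s]. *)
Definition loop F (a b c d : R) : R[i] :=
  cint `[c, d] (fun t => F (carc b t) * dcarc b t) -
  cint `[c, d] (fun t => F (carc a t) * dcarc a t) -
  cint `[a, b] (fun s => F (carc s d) * (hw d)%:C) +
  cint `[a, b] (fun s => F (carc s c) * (hw c)%:C).

Definition cont_on F (a b c d : R) :=
  forall s t, a <= s <= b -> c <= t <= d -> ccont F (carc s t).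

Lemma cont_on_integrable F a b c d : cont_on F a b c d ->
  (forall s, a <= s <= b -> cintegrable `[c, d] (fun t => F (carc s t) * dcarc s t)) /\
  (forall t, c <= t <= d -> cintegrable `[a, b] (fun s => F (carc s t) * (hw t)%:C)).
Proof.
move=> cF; split=> u ub; apply: cont_cintegrable => v vb.
  by apply: carcF_contR; exact: cF.
by apply: carcF_contR_s; exact: cF.
Qed.

Lemma cont_onS F a b c d a' b' c' d' : a <= a' -> b' <= b -> c <= c' -> d' <= d ->
  cont_on F a b c d -> cont_on F a' b' c' d'.
Proof.
move=> aa bb cc dd cF s t /andP[s1 s2] /andP[t1 t2]; apply: cF.
  by rewrite (le_trans aa) // (le_trans s2).
by rewrite (le_trans cc) // (le_trans t2).
Qed.

Lemma loop_additive F A B C E : cont_on F A B C E -> additive_rect (loop F) A B C E.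
Proof.
move=> cF; split.
  move=> a m b c d Aa am mb bB Cc cd dE.
  have [i1 i2] := cont_on_integrable (cont_onS Aa bB Cc dE cF).
  rewrite /loop (@cint_split _ a m b (fun s => F (carc s d) * _)) //; last first.
    by apply: i2; rewrite cd lexx.
  rewrite (@cint_split _ a m b (fun s => F (carc s c) * _)) //; last first.
    by apply: i2; rewrite cd lexx.
  have E0 (v w u x1 x2 y1 y2 : R[i]) : v - w - (x1 + x2) + (y1 + y2) =
    (u - w - x1 + y1) + (v - u - x2 + y2) by ring.
  exact: E0.
move=> a b c m d Aa ab bB Cc cm md dE.
have [i1 i2] := cont_on_integrable (cont_onS Aa bB Cc dE cF).
rewrite /loop (@cint_split _ c m d (fun s => F (carc b s) * _)) //; last first.
  by apply: i1; rewrite ab lexx.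
rewrite (@cint_split _ c m d (fun s => F (carc a s) * _)) //; last first.
  by apply: i1; rewrite ab lexx.
have E0 (x1 x2 y1 y2 u v w : R[i]) : (x1 + x2) - (y1 + y2) - v + w =
  (x1 - y1 - u + w) + (x2 - y2 - v + u) by ring.
exact: E0.
Qed.

Lemma loopD F G a b c d : a <= b -> c <= d -> cont_on F a b c d -> cont_on G a b c d ->
  loop (fun w => F w + G w) a b c d = loop F a b c d + loop G a b c d.
Proof.
move=> ab cd cF cG; have [f1 f2] := cont_on_integrable cF.
have [g1 g2] := cont_on_integrable cG.
have la : a <= a <= b by rewrite lexx.
have lb : a <= b <= b by rewrite lexx ab.
have lc : c <= c <= d by rewrite lexx.
have ld : c <= d <= d by rewrite lexx cd.
have E1 s : a <= s <= b ->
    cint `[c, d] (fun t => (F (carc s t) + G (carc s t)) * dcarc s t) =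
    cint `[c, d] (fun t => F (carc s t) * dcarc s t) +
    cint `[c, d] (fun t => G (carc s t) * dcarc s t).
  move=> sab; rewrite -cintD //; [|exact: f1|exact: g1].
  by apply: eq_cint => ? _; rewrite mulrDl.
have E2 t : c <= t <= d ->
    cint `[a, b] (fun s => (F (carc s t) + G (carc s t)) * (hw t)%:C) =
    cint `[a, b] (fun s => F (carc s t) * (hw t)%:C) +
    cint `[a, b] (fun s => G (carc s t) * (hw t)%:C).
  move=> tcd; rewrite -cintD //; [|exact: f2|exact: g2].
  by apply: eq_cint => ? _; rewrite mulrDl.
have E0 (x1 x2 y1 y2 u1 u2 v1 v2 : R[i]) : (x1 + x2) - (y1 + y2) - (u1 + u2) + (v1 + v2) =
  (x1 - y1 - u1 + v1) + (x2 - y2 - u2 + v2) by ring.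
by rewrite /loop !E1 ?E2 //; exact: E0.
Qed.

Lemma loop_le F a b c d (k : R) : -1 <= a -> a <= b -> b <= 1 ->
  - H <= c -> c <= d -> d <= H -> cont_on F a b c d ->
  (forall s t, a <= s <= b -> c <= t <= d -> normc (F (carc s t)) <= k) ->
  normc (loop F a b c d) <= 8 * (1 + H) * k * ((b - a) + (d - c)).
Proof.
move=> a1 ab b1 c1 cd d1 cF Fk; have [f1 f2] := cont_on_integrable cF.
have la : a <= a <= b by rewrite lexx.
have lb : a <= b <= b by rewrite lexx ab.
have lc : c <= c <= d by rewrite lexx.
have ld : c <= d <= d by rewrite lexx cd.
have k0 : 0 <= k by apply: le_trans (Fk a c la lc); exact: normc_ge0.
have V s : a <= s <= b ->
    normc (cint `[c, d] (fun t => F (carc s t) * dcarc s t)) <= 2 * (k * 2 * (d - c)).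
  move=> sab; apply: cint_segment_le => //; first exact: f1.
  move=> t tcd; rewrite normcM ler_pM ?normc_ge0 ?Fk //.
  apply: dcarc_le; first by rewrite ler_norml; move: sab; lra.
    by move: tcd; lra.
  by move: tcd; lra.
have U t : c <= t <= d ->
    normc (cint `[a, b] (fun s => F (carc s t) * (hw t)%:C)) <= 2 * (k * H * (b - a)).
  move=> tcd; apply: cint_segment_le => //; first exact: f2.
  move=> s' sab; rewrite normcM ler_pM ?normc_ge0 ?Fk //.
  by rewrite normc_real ger0_norm ?hw_leH // hw_ge0 //; move: tcd; lra.
rewrite /loop; set v1 := cint _ _; set v2 := cint _ _; set u1 := cint _ _; set u2 := cint _ _.
have := normc_leD (v1 - v2 - u1) u2; have := normc_leB (v1 - v2) u1.
have := normc_leB v1 v2.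
have := V b lb; rewrite -/v1; have := V a la; rewrite -/v2.
have := U d ld; rewrite -/u1; have := U c lc; rewrite -/u2.
set x1 := normc _; set x2 := normc _; set x3 := normc _; set x4 := normc _.
set x5 := normc _; set x6 := normc _; set x7 := normc _.
move=> i1 i2 i3 i4 i5 i6 i7.
have j1 : 0 <= k * (b - a) by rewrite mulr_ge0 // subr_ge0.
have j2 : 0 <= k * (d - c) by rewrite mulr_ge0 // subr_ge0.
have j3 : 0 <= H * (k * (b - a)) by rewrite mulr_ge0 // ltW.
have j4 : 0 <= H * (k * (d - c)) by rewrite mulr_ge0 // ltW.
have -> : 8 * (1 + H) * k * (b - a + (d - c)) = 8 * (k * (b - a)) + 8 * (k * (d - c)) +
  8 * (H * (k * (b - a))) + 8 * (H * (k * (d - c))) by ring.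
have e1 : 2 * (k * H * (b - a)) = 2 * (H * (k * (b - a))) by ring.
have e2 : 2 * (k * 2 * (d - c)) = 4 * (k * (d - c)) by ring.
move: i1 i2 i3 i4; rewrite e1 e2; move: j1 j2 j3 j4.
set y1 := k * (b - a); set y2 := k * (d - c); set y3 := H * y1; set y4 := H * y2.
lra.
Qed.

End Arcs.

(** * Cauchy's theorem in the coordinates given by the arcs *)

Section CauchyRect.
Variables (R : realType) (H : R).
Hypothesis H0 : 0 < H.
Implicit Types (s t : R) (F : R[i] -> R[i]).
Local Notation carc := (carc H).
Local Notation loop := (loop H).
Local Notation cont_on := (cont_on H).

Lemma ccont_affine (al be ze z : R[i]) : ccont (fun w => al + be * (w - ze)) z.
Proof.
apply: (@cdiff_ccont _ _ z be) => e e0; exists 1 => // w _.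
rewrite (_ : _ - _ - _ = 0); last by ring.
by rewrite normc0 mulr_ge0 ?normc_ge0 // ltW.
Qed.

Lemma ccontD F G z : ccont F z -> ccont G z -> ccont (fun w => F w + G w) z.
Proof.
move=> cF cG e e0; have e2 : 0 < e / 2 by rewrite divr_gt0.
have [d1 d10 k1] := cF _ e2; have [d2 d20 k2] := cG _ e2.
exists (Num.min d1 d2); first by rewrite lt_min d10.
move=> w; rewrite lt_min => /andP[/k1 w1 /k2 w2].
rewrite (_ : _ - _ = (F w - F z) + (G w - G z)); last by ring.
by apply: le_lt_trans (normc_leD _ _) _; lra.
Qed.

Lemma loop_affine (al be ze : R[i]) a b c d : a <= b -> c <= d ->
  loop (fun w => al + be * (w - ze)) a b c d = 0.
Proof.
move=> ab cd.
pose Q (w : R[i]) := al * w + be * ((w - ze) * (w - ze)) / 2.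
have dQ (g : R -> R[i]) t l : cderiv g t l ->
    cderiv (fun u => Q (g u)) t ((al + be * (g t - ze)) * l).
  move=> dg; have dgz := cderivD dg (cderiv_cst (- ze) t).
  have := cderivD (cderivM (cderiv_cst al t) dg)
    (cderivM (cderivM (cderiv_cst be t) (cderivM dgz dgz)) (cderiv_cst 2^-1 t)).
  by congr cderiv; rewrite /=; field.
have V s : cint `[c, d] (fun t => (al + be * (carc s t - ze)) * dcarc H s t) =
    Q (carc s d) - Q (carc s c).
  apply: (@cint_derive _ (fun t => Q (carc s t))
    (fun t => (al + be * (carc s t - ze)) * dcarc H s t) _ _ cd) => t _.
    exact/dQ/(carc_cderiv H0).
  by apply: (@carcF_contR _ _ H0 (fun w => al + be * (w - ze))); exact: ccont_affine.
have U t : cint `[a, b] (fun s => (al + be * (carc s t - ze)) * (hw H t)%:C) =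
    Q (carc b t) - Q (carc a t).
  apply: (@cint_derive _ (fun s => Q (carc s t))
    (fun s => (al + be * (carc s t - ze)) * (hw H t)%:C) _ _ ab) => s _.
    exact/(@dQ (carc^~ t))/carc_cderiv_s.
  by apply: (@carcF_contR_s _ _ (fun w => al + be * (w - ze))); exact: ccont_affine.
by rewrite /loop !V !U; ring.
Qed.

(** The first-order Taylor polynomial has a primitive and does not contribute;
    the remainder is negligible before the diameter of the rectangle, as is then
    its integral before the diameter times the perimeter. *)
Lemma small_at_cdiff F A B C E p r l : -1 <= A -> B <= 1 -> - H <= C -> E <= H ->
  cont_on F A B C E -> cdiff F (carc p r) l ->
  small_at (loop F) A B C E p r.
Proof.
move=> A1 B1 CH EH cF dF e e0.
have k0 : 0 < 8 * (1 + H) * (H + 2) by rewrite !mulr_gt0 // addr_gt0.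
have [d d0 Hd] := dF _ (divr_gt0 e0 k0).
have k20 : 0 < 2 * (H + 2) by rewrite mulr_gt0 // addr_gt0.
exists (d / (2 * (H + 2))); first by rewrite divr_gt0.
move=> a b c g Aa ap pb bB Cc cr rg gE; rewrite !ltr_pdivlMr // => ba gc.
set ze := carc p r.
pose A1' w := F ze + l * (w - ze).
pose A2' w := - F ze + (- l) * (w - ze).
pose Er w := F w + A2' w.
have cA z : ccont A1' z by exact: ccont_affine.
have cE : cont_on Er a b c g.
  move=> s t /andP[s1 s2] /andP[t1 t2]; apply: ccontD; last exact: ccont_affine.
  by apply: cF; [rewrite (le_trans Aa) // (le_trans s2)|
    rewrite (le_trans Cc) // (le_trans t2)].
have -> : F = (fun w => A1' w + Er w).
  by apply/funext => w; rewrite /A1' /Er /A2'; ring.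
have ab : a <= b by exact: le_trans pb.
have cg : c <= g by exact: le_trans rg.
have cA2 : cont_on A1' a b c g by move=> ? ? _ _; exact: cA.
rewrite (loopD H0 ab cg cA2 cE).
rewrite [X in X + _]loop_affine // add0r.
pose S := (b - a) + (g - c).
have -> : e * (b - a + (g - c)) ^+ 2 =
    8 * (1 + H) * (e / (8 * (1 + H) * (H + 2)) * ((H + 2) * S)) * (b - a + (g - c)).
  rewrite -/S; field; rewrite !gt_eqF //= ?addr_gt0 //.
have a1 : -1 <= a := le_trans A1 Aa.
have b1 : b <= 1 := le_trans bB B1.
have c1 : - H <= c := le_trans CH Cc.
have g1 : g <= H := le_trans gE EH.
apply: (loop_le H0 a1 ab b1 c1 cg g1 cE).
move=> s t sab tcg.
have sp : `|s - p| <= b - a by rewrite ler_norml; move: sab; lra.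
have tr : `|t - r| <= g - c by rewrite ler_norml; move: tcg; lra.
have dist : normc (carc s t - ze) <= (H + 2) * S.
  have [tc tg] := andP tcg.
  have t1 : - H <= t by exact: le_trans (le_trans CH Cc) tc.
  have t2 : t <= H by exact: le_trans (le_trans tg gE) EH.
  have r1 : - H <= r by exact: le_trans (le_trans CH Cc) cr.
  have r2 : r <= H by exact: le_trans (le_trans rg gE) EH.
  have p1 : `|p| <= 1.
    by rewrite ler_norml (le_trans A1 (le_trans Aa ap)) (le_trans pb (le_trans bB B1)).
  apply: le_trans (@carc_sub _ _ H0 s t p r t1 t2 r1 r2 p1) _.
  by rewrite ler_wpM2l ?lerD // ltW // addr_gt0.
have := Hd (carc s t); rewrite -/ze => Hst.
have -> : Er (carc s t) = F (carc s t) - F ze - l * (carc s t - ze).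
  by rewrite /Er /A2'; ring.
apply: le_trans (Hst _) _.
  by apply: le_lt_trans dist _; rewrite /S mulrDr; lra.
by rewrite ler_wpM2l // divr_ge0 // ltW.
Qed.

(** At the exceptional point, continuity is enough: the integrand is bounded
    nearby, so the integral along a small square is of the order of its
    perimeter. *)
Lemma cauchy_rect F a b c d s0 t0 : -1 <= a -> b <= 1 -> - H <= c -> d <= H ->
  a < s0 < b -> c < t0 < d -> cont_on F a b c d ->
  (forall s t, a <= s <= b -> c <= t <= d -> (s != s0) || (t != t0) ->
     exists l, cdiff F (carc s t) l) ->
  loop F a b c d = 0.
Proof.
move=> a1 b1 cH dH s0ab t0cd cF dF.
have /andP[as0 s0b] := s0ab; have /andP[ct0 t0d] := t0cd.
have [del del0 near0] := cF s0 t0 (introT andP (conj (ltW as0) (ltW s0b)))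
  (introT andP (conj (ltW ct0) (ltW t0d))) 1 ltr01.
pose k := normc (F (carc s0 t0)) + 1.
have k0 : 0 <= k by rewrite addr_ge0 ?normc_ge0.
have h20 : 0 < 2 * (H + 2) by rewrite mulr_gt0 // addr_gt0.
pose m1 := Num.min (s0 - a) (b - s0).
pose m2 := Num.min (t0 - c) (d - t0).
pose r0 := Num.min (del / (2 * (H + 2)) / 2) (Num.min m1 m2).
have r00 : 0 < r0 by rewrite !lt_min !subr_gt0 as0 s0b ct0 t0d !divr_gt0.
have ab : a <= b by exact: ltW (lt_trans as0 s0b).
have cd : c <= d by exact: ltW (lt_trans ct0 t0d).
apply: (@goursat_except _ (loop F) a b c d a b c d s0 t0 r0 (8 * (1 + H) * k * 4)) => //.
- exact: loop_additive.
- by rewrite !mulr_ge0 // addr_ge0 // ltW.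
- move=> h h0; rewrite !le_min => /andP[hd /andP[/andP[h1 h2] /andP[h3 h4]]].
  have := @loop_le _ _ H0 F (s0 - h) (s0 + h) (t0 - h) (t0 + h) k.
  have -> : s0 + h - (s0 - h) + (t0 + h - (t0 - h)) = 4 * h by ring.
  have i1 : a <= s0 - h by lra.
  have i2 : s0 + h <= b by lra.
  have i3 : c <= t0 - h by lra.
  have i4 : t0 + h <= d by lra.
  have i5 : -1 <= s0 - h := le_trans a1 i1.
  have i6 : s0 - h <= s0 + h by lra.
  have i7 : s0 + h <= 1 := le_trans i2 b1.
  have i8 : - H <= t0 - h := le_trans cH i3.
  have i9 : t0 - h <= t0 + h by lra.
  have i10 : t0 + h <= H := le_trans i4 dH.
  rewrite mulrA; apply => //; first exact: (cont_onS i1 i2 i3 i4 cF).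
  move=> s t sh th; rewrite /k -lerBlDl.
  suff : normc (F (carc s t) - F (carc s0 t0)) <= 1.
    by have := normc_leD (F (carc s t) - F (carc s0 t0)) (F (carc s0 t0)); rewrite subrK; lra.
  have [th1 th2] := andP th.
  have t1 : - H <= t := le_trans i8 th1.
  have t2 : t <= H := le_trans th2 i10.
  have t3 : - H <= t0 := le_trans cH (ltW ct0).
  have t4 : t0 <= H := le_trans (ltW t0d) dH.
  have s01 : `|s0| <= 1.
    by rewrite ler_norml (le_trans a1 (ltW as0)) (le_trans (ltW s0b) b1).
  apply/ltW/near0; apply: le_lt_trans (@carc_sub _ _ H0 s t s0 t0 t1 t2 t3 t4 s01) _.
  move: hd; rewrite 2?ler_pdivlMr // => hd.
  have dt : `|t - t0| <= h by rewrite ler_distl.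
  have ds : `|s - s0| <= h by rewrite ler_distl.
  have : (H + 2) * (`|s - s0| + `|t - t0|) <= (H + 2) * (h + h).
    by rewrite ler_wpM2l ?lerD // ltW // addr_gt0.
  by lra.
move=> p r pab rcd ne; have [l dl] := dF p r pab rcd ne.
exact: small_at_cdiff dl.
Qed.

End CauchyRect.

(** * Cauchy transforms along a curve *)

Section CauchyTransform.
Variable (R : realType).
Notation mu := (@lebesgue_measure R).
Variables (a b : R) (gam Phi : R -> R[i]).
Hypothesis cgam : forall t, a < t < b -> contR gam t.
Hypothesis cPhi : forall t, a < t < b -> contR Phi t.
Hypothesis iPhi : cintegrable `]a, b[ Phi.

Definition ctransform (z : R[i]) := cint `]a, b[ (fun t => Phi t / (gam t - z)).

(** The derivative of [ctransform] off the curve. *)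
Definition ctransform2 (z : R[i]) := cint `]a, b[ (fun t => Phi t / (gam t - z) ^+ 2).

Definition separated_by (z : R[i]) (d : R) := forall t, a < t < b -> d <= normc (gam t - z).

Lemma normc_integrable : mu.-integrable `]a, b[ (EFin \o (fun t => normc (Phi t))).
Proof.
have [i1 i2] := iPhi.
have i3 : mu.-integrable `]a, b[ ((EFin \o (fun t => `|Re (Phi t)|%R)) \+
    (EFin \o (fun t => `|Im (Phi t)|%R)))%E.
  apply: integrableD => //.
    by move/integrable_norm : i1; apply: eq_integrable.
  by move/integrable_norm : i2; apply: eq_integrable.
apply: le_integrable i3 => //; last first.
  move=> t _ /=; rewrite lee_fin ger0_norm ?normc_ge0 // ger0_norm ?addr_ge0 //.
  exact: normc_ReIm.
apply/measurable_EFinP; apply: open_continuous_measurable_fun => // t /set_mem /=.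
by rewrite in_itv /= => /cPhi /contR_normc.
Qed.

Lemma cintegrable_mul (k : R -> R[i]) (K : R) :
  (forall t, a < t < b -> contR k t) ->
  (forall t, a < t < b -> normc (k t) <= K) ->
  cintegrable `]a, b[ (fun t => Phi t * k t).
Proof.
move=> ck kK; apply: (@cmeasurable_integrable _ _ _ (fun t => K * normc (Phi t))) => //.
- by apply: cont_cmeasurable => t tab; apply: contRM; [exact: cPhi|exact: ck].
- by apply: integrable_scale => //; exact: normc_integrable.
- move=> t /=; rewrite in_itv /= => tab; rewrite normcM mulrC.
  by rewrite ler_wpM2r ?normc_ge0 ?kK.
Qed.

Section Separated.
Variables (z : R[i]) (d : R).
Hypotheses (d0 : 0 < d) (sepz : separated_by z d).

Lemma separated_neq0 t : a < t < b -> gam t - z != 0.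
Proof.
by move=> /sepz; apply: contraTneq => ->; rewrite normc0 -ltNge.
Qed.

Lemma contR_pole t : a < t < b -> contR (fun u => (gam u - z)^-1) t.
Proof.
move=> tab; apply: contRV; first exact: separated_neq0.
by apply: contRB; [exact: cgam|exact: contR_cst].
Qed.

Lemma normc_pole t : a < t < b -> normc (gam t - z)^-1 <= d^-1.
Proof.
move=> tab; rewrite normcV lef_pV2 ?posrE ?sepz //.
by apply: lt_le_trans d0 _; exact: sepz.
Qed.

Lemma pole_integrable : cintegrable `]a, b[ (fun t => Phi t / (gam t - z)).
Proof. by apply: cintegrable_mul => t; [exact: contR_pole|exact: normc_pole]. Qed.

Lemma pole2_integrable : cintegrable `]a, b[ (fun t => Phi t / (gam t - z) ^+ 2).
Proof.
rewrite (_ : (fun t => _) = (fun t => Phi t * ((gam t - z)^-1 * (gam t - z)^-1))).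
  apply: (@cintegrable_mul _ (d^-1 * d^-1)) => t tab.
    by apply: contRM; exact: contR_pole.
  by rewrite normcM ler_pM ?normc_ge0 ?normc_pole.
by apply/funext => t; rewrite expr2 invfM.
Qed.

End Separated.

(** The integrand on the left is [Phi] times
    [h ^+ 2 / ((gam - z) ^+ 2 * (gam - (z + h)))], and [gam] is still at distance
    [d / 2] from [z + h]. *)
Lemma ctransform_quadratic z d h : 0 < d -> separated_by z d -> normc h <= d / 2 ->
  normc (ctransform (z + h) - ctransform z - h * ctransform2 z) <=
  4 / d ^+ 3 * (\int[mu]_(t in `]a, b[) normc (Phi t)) * normc h ^+ 2.
Proof.
move=> d0 sepz hd.
have d20 : 0 < d / 2 by rewrite divr_gt0.
have seph : separated_by (z + h) (d / 2).
  move=> t tab; have := normc_leD (gam t - (z + h)) h.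
  rewrite (_ : gam t - (z + h) + h = gam t - z); last by ring.
  have := sepz t tab; lra.
have i1 := pole_integrable d20 seph.
have i2 := pole_integrable d0 sepz.
have i3 := pole2_integrable d0 sepz.
have i4 := cintegrableZ h (measurable_itv `]a, b[) i3.
have i12 := cintegrableB (measurable_itv `]a, b[) i1 i2.
have E : ctransform (z + h) - ctransform z - h * ctransform2 z =
    cint `]a, b[ (fun t => Phi t / (gam t - (z + h)) - Phi t / (gam t - z) -
       h * (Phi t / (gam t - z) ^+ 2)).
  by rewrite cintB // cintB // cintZ.
rewrite {}E.
have iN := normc_integrable.
have -> : 4 / d ^+ 3 * (\int[mu]_(t in `]a, b[) normc (Phi t)) * normc h ^+ 2 =
    2 * \int[mu]_(t in `]a, b[) ((2 / d ^+ 3 * normc h ^+ 2) * normc (Phi t)).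
  rewrite RintegralZl //; ring.
apply: cint_norm_le => //.
- exact: cintegrableB.
- exact: integrable_scale.
move=> t /=; rewrite in_itv /= => tab.
have n1 := separated_neq0 d0 sepz tab; have n2 := separated_neq0 d20 seph tab.
have -> : Phi t / (gam t - (z + h)) - Phi t / (gam t - z) - h * (Phi t / (gam t - z) ^+ 2)
    = h ^+ 2 * ((gam t - z)^-1 * (gam t - z)^-1 * (gam t - (z + h))^-1) * Phi t.
  by field; rewrite n1 n2.
rewrite !normcM ler_wpM2r ?normc_ge0 //.
have -> : 2 / d ^+ 3 * normc h ^+ 2 = normc h * normc h * (d^-1 * d^-1 * (d / 2)^-1).
  by field; rewrite gt_eqF.
rewrite ler_wpM2l ?mulr_ge0 ?normc_ge0 //.
rewrite ler_pM ?mulr_ge0 ?normc_ge0 //; last exact: normc_pole seph _ tab.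
by rewrite ler_pM ?normc_ge0 //; exact: normc_pole sepz _ tab.
Qed.

Lemma ctransform_cdiff z d : 0 < d -> separated_by z d ->
  cdiff ctransform z (ctransform2 z).
Proof.
move=> d0 sepz e e0.
pose K := 4 / d ^+ 3 * (\int[mu]_(t in `]a, b[) normc (Phi t)).
have K0 : 0 <= K.
  rewrite mulr_ge0 ?divr_ge0 ?exprn_ge0 ?(ltW d0) //.
  by apply: Rintegral_ge0 => t _; exact: normc_ge0.
have K1 : 0 < K + 1 by rewrite ltr_wpDl.
exists (Num.min (d / 2) (e / (K + 1))); first by rewrite lt_min !divr_gt0.
move=> w; rewrite lt_min => /andP[w1 w2].
have := ctransform_quadratic d0 sepz (ltW w1).
rewrite (_ : z + (w - z) = w) -?/K ?(mulrC (w - z)); last by ring.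
move=> /le_trans; apply.
rewrite expr2 mulrA ler_wpM2r ?normc_ge0 //.
move: w2; rewrite ltr_pdivlMr // mulrDr mulr1 (mulrC K).
have := normc_ge0 (w - z); lra.
Qed.

End CauchyTransform.

(** Cutting [[0, 1]] into [n] equal steps bounds the total increment by
    [n * C / n ^+ 2]. *)
Lemma quadratic_const (R : realType) (f : R -> R[i]) (C eta : R) : 0 <= C -> 0 < eta ->
  (forall u v, 0 <= u <= 1 -> 0 <= v <= 1 -> `|u - v| <= eta -> normc (f u - f v) <= C * (u - v) ^+ 2) ->
  f 0 = f 1.
Proof.
move=> C0 eta0 fC; apply/eqP; rewrite -subr_eq0; apply/eqP/eq0_normc/eqP.
rewrite eq_le normc_ge0 andbT.
apply/ler_addgt0Pr => e e0; rewrite add0r.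
pose n := Num.bound (C / e + eta^-1).
have Ce0 : 0 <= C / e by rewrite divr_ge0 // ltW.
have eV0 : 0 < eta^-1 by rewrite invr_gt0.
have nb : C / e + eta^-1 < n.+1%:R.
  apply: lt_le_trans (archi_boundP _) _; first by rewrite addr_ge0 // ltW.
  by rewrite ler_nat.
have n0 : C < e * n.+1%:R by rewrite mulrC -ltr_pdivrMr //; lra.
have n1 : n.+1%:R^-1 <= eta.
  by rewrite -(invrK eta) lef_pV2 ?posrE ?ltr0Sn //; lra.
pose N := n.+1.
have N0 : 0 < N%:R :> R by rewrite ltr0n.
have H (k : nat) : (k <= N)%N ->
    normc (f 0 - f (k%:R / N%:R)) <= k%:R * (C / N%:R ^+ 2).
  elim: k => [|k IH] kN; first by rewrite !mul0r subrr normc0.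
  apply: le_trans (normc_leBB _ _ (f (k%:R / N%:R))) _.
  rewrite -[in X in _ <= X](addn1 k) natrD mulrDl lerD ?IH ?(ltnW kN) // mul1r.
  apply: le_trans (fC _ _ _ _ _) _.
  - by rewrite divr_ge0 ?ler0n //= ler_pdivrMr // mul1r ler_nat ltnW.
  - by rewrite divr_ge0 ?ler0n //= ler_pdivrMr // mul1r ler_nat.
  - rewrite -mulrBl -[in k.+1%:R](addn1 k) natrD opprD addrA subrr add0r mulN1r.
    by rewrite normrN ger0_norm // invr_ge0 ler0n.
  - rewrite -mulrBl -[in k.+1%:R](addn1 k) natrD opprD addrA subrr add0r mulN1r sqrrN.
    by rewrite exprVn.
have := H N (leqnn N); rewrite divff ?gt_eqF // => /le_trans; apply.
have -> : N%:R * (C / N%:R ^+ 2) = C / N%:R :> R by field; rewrite gt_eqF.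
by rewrite ler_pdivrMr // ltW.
Qed.

(** * The index of the closed curve formed by two arcs *)

Section Winding.
Variables (R : realType) (H : R).
Hypothesis H0 : 0 < H.
Notation mu := (@lebesgue_measure R).
Implicit Types (s t : R) (z w : R[i]).
Local Notation carc := (carc H).
Local Notation dcarc := (dcarc H).
Local Notation hw := (hw H).

(** Integral of [dw / (w - z)] along the arc of parameter [s]. *)
Definition winding s z := ctransform (- H) H (carc s) (dcarc s) z.

(** A lens around the axis, far enough from the arcs with [3^-1 <= `|s|] for
    Cauchy integrals over them to be differentiable there. *)
Definition middle z := `|Re z - H| <= hw (Im z) / 6 /\ `|Im z| < H.

(** Either the heights of the two points differ by a definite fraction of
    [hw (Im z)], or [hw t] is comparable to [hw (Im z)] and the abscissas
    differ. *)
Lemma middle_sep s z t : 3^-1 <= `|s| -> middle z -> - H <= t -> t <= H ->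
  hw (Im z) / 12 <= normc (carc s t - z).
Proof.
move=> s3 [zx zy] t1 t2.
have y0 : 0 <= hw (Im z) by move: zy; rewrite ltr_norml => zy; apply: hw_ge0 => //; lra.
have t0 : 0 <= hw t by exact: hw_ge0.
have [far|near] := leP (hw (Im z) / 12) `|t - Im z|.
  apply: le_trans far _; apply: le_trans (normc_Im _).
  by rewrite cImD cImN /=.
have lip : hw (Im z) - hw t <= `|t - Im z|.
  rewrite distrC; apply: le_trans (ler_norm _) _.
  by move: zy; rewrite ltr_norml => zy; apply: hw_lip => //; lra.
apply: le_trans (normc_Re _); rewrite cReD cReN /=.
have -> : H + s * hw t - Re z = s * hw t - (Re z - H) by ring.
have := lerB_dist (s * hw t) (Re z - H).
rewrite normrM (ger0_norm t0).
have : 3^-1 * hw t <= `|s| * hw t by rewrite ler_wpM2r.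
lra.
Qed.

Lemma middle_separated s z : 3^-1 <= `|s| -> middle z ->
  separated_by (- H) H (carc s) z (hw (Im z) / 12).
Proof. by move=> s3 mz t /andP[t1 t2]; apply: middle_sep => //; exact: ltW. Qed.

Lemma middle_hw_gt0 z : middle z -> 0 < hw (Im z) / 12.
Proof.
by case=> _; rewrite ltr_norml => /andP[? ?]; rewrite divr_gt0 ?hw_gt0.
Qed.

Lemma carc_contR s t : contR (carc s) t.
Proof. exact: cderiv_contR (carc_cderiv H0 s t). Qed.

Lemma cintegrable_oo (a b : R) (F : R -> R[i]) : cintegrable `[a, b] F ->
  cintegrable `]a, b[ F.
Proof.
apply: cintegrableS; [exact: measurable_itv|exact: measurable_itv|].
exact: subset_itv_oo_cc.
Qed.

Lemma cint_oo_cc (a b : R) (F : R -> R[i]) : cintegrable `[a, b] F ->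
  cint `]a, b[ F = cint `[a, b] F.
Proof.
move=> iF; have [i1 i2] := cintegrable_oo iF.
have [j1 j2] : cintegrable `]a, b] F.
  move: iF; apply: cintegrableS; [exact: measurable_itv|exact: measurable_itv|].
  exact: subset_itv_oc_cc.
by congr (_ +i* _); rewrite Rintegral_itv_bndo_bndc // Rintegral_itv_obnd_cbnd.
Qed.

Lemma dcarc_integrable s : cintegrable `]- H, H[ (dcarc s).
Proof.
by apply: cintegrable_oo; apply: cont_cintegrable => t _; exact: dcarc_contR.
Qed.

(** The integrand has the primitive [- (carc s t - z)^-1], and all arcs have the
    same endpoints: the derivative of [winding s] does not depend on [s]. *)
Lemma winding2E s z : 3^-1 <= `|s| -> middle z ->
  ctransform2 (- H) H (carc s) (dcarc s) z =
  (carc 0 (- H) - z)^-1 - (carc 0 H - z)^-1.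
Proof.
move=> s3 mz; have d0 := middle_hw_gt0 mz.
have n0 t : - H <= t <= H -> carc s t - z != 0.
  move=> /andP[t1 t2]; have := middle_sep s3 mz t1 t2.
  by apply: contraTneq => ->; rewrite normc0 -ltNge.
have cg t : - H <= t <= H -> contR (fun u => - dcarc s u / (carc s u - z) ^+ 2) t.
  move=> tH; apply: contRM; first by apply: contRN; exact: dcarc_contR.
  have cz : contR (fun u => carc s u - z) t.
    by apply: contRB; [exact: carc_contR|exact: contR_cst].
  by apply: contRV; [rewrite expf_neq0 // n0|exact: (contRM cz cz)].
have i1 := cont_cintegrable cg.
have HH : - H <= H by rewrite ge0_cp ?ltW.
have E : cint `[- H, H] (fun u => - dcarc s u / (carc s u - z) ^+ 2) =
    (carc s H - z)^-1 - (carc s (- H) - z)^-1.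
  apply: (@cint_derive _ (fun u => (carc s u - z)^-1)) => // t tH.
  apply: cderivV; first exact: n0.
  rewrite -[dcarc s t]addr0; apply: cderivD; first exact: carc_cderiv.
  exact: cderiv_cst.
have [E1 E2] := carc_vertex H s.
rewrite /ctransform2; transitivity (- cint `]- H, H[ (fun u => - dcarc s u / (carc s u - z) ^+ 2)).
  rewrite -cintN //; first by apply: eq_cint => t _; rewrite mulNr opprK.
  exact: cintegrable_oo.
by rewrite cint_oo_cc // E E1 E2 opprB.
Qed.

(** Up to the factor [2 * pi * i], the index of [z] with respect to the arc [s]
    followed by the arc [- s] run backwards. *)
Definition windex s z := winding s z - winding (- s) z.

(** By [winding2E] the derivatives of the two terms of [windex] cancel, so along
    the segment from the centre to [z] its increments are quadratic. *)
Lemma windex_const s z : 3^-1 <= s -> middle z -> windex s z = windex s H%:C.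
Proof.
move=> s3 mz; have d0 := middle_hw_gt0 mz; set d := hw (Im z) / 12 in d0.
have [zx zy] := mz.
pose p (u : R) : R[i] := H%:C + u%:C * (z - H%:C).
have pR u : Re (p u) - H = u * (Re z - H).
  by rewrite /p cReD cReM cReD cReN cImD cImN /=; ring.
have pI u : Im (p u) = u * Im z.
  by rewrite /p cImD cImM cReD cReN cImD cImN /=; ring.
have hwp u : 0 <= u <= 1 -> hw (Im z) <= hw (Im (p u)).
  move=> /andP[u0 u1]; rewrite pI ler_pM2r ?invr_gt0 ?mulr_gt0 //.
  rewrite lerB // exprMn -[leRHS]mul1r ler_wpM2r ?sqr_ge0 //.
  by rewrite expr_le1.
have mp u : 0 <= u <= 1 -> middle (p u).
  move=> u01; have /andP[u0 u1] := u01; split.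
    rewrite pR normrM ger0_norm //.
    apply: le_trans (_ : hw (Im z) / 6 <= _).
      by apply: le_trans zx; rewrite ler_piMl.
    by rewrite ler_wpM2r ?hwp.
  by rewrite pI normrM ger0_norm // (le_lt_trans _ zy) // ler_piMl.
have sp r u : 3^-1 <= `|r| -> 0 <= u <= 1 -> separated_by (- H) H (carc r) (p u) d.
  move=> r3 u01 t tH; apply: le_trans (middle_separated r3 (mp u u01) tH).
  by rewrite ler_wpM2r // hwp.
have as3 : 3^-1 <= `|s| by rewrite (le_trans s3) // ler_norm.
have aNs3 : 3^-1 <= `|- s| by rewrite normrN.
pose K (r : R) := 4 / d ^+ 3 * (\int[mu]_(t in `]- H, H[) normc (dcarc r t)).
have K0 r : 0 <= K r.
  rewrite mulr_ge0 ?divr_ge0 ?exprn_ge0 ?(ltW d0) //.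
  by apply: Rintegral_ge0 => t _; exact: normc_ge0.
have quad r u v : 3^-1 <= `|r| -> 0 <= u <= 1 -> 0 <= v <= 1 ->
    normc (p u - p v) <= d / 2 ->
    normc (winding r (p u) - winding r (p v) - (p u - p v) *
      ctransform2 (- H) H (carc r) (dcarc r) (p v)) <= K r * normc (p u - p v) ^+ 2.
  move=> r3 u01 v01 h; have := @ctransform_quadratic _ (- H) H (carc r) (dcarc r)
   (fun t _ => carc_contR r t) (fun t _ => dcarc_contR H0 r t) (dcarc_integrable r) (p v) d
   (p u - p v) d0 (sp r v r3 v01) h.
  by rewrite (_ : p v + (p u - p v) = p u); last ring.
pose L := normc (z - H%:C) + 1.
have L0 : 0 < L by rewrite ltr_wpDl ?normc_ge0.
have puv u v : normc (p u - p v) <= `|u - v| * L.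
  have -> : p u - p v = (u - v)%:C * (z - H%:C) by rewrite /p rmorphB /=; ring.
  by rewrite normcM normc_real ler_wpM2l // /L lerDl.
have -> : z = p 1 by rewrite /p mul1r; ring.
have -> : H%:C = p 0 by rewrite /p mul0r addr0.
apply/esym; apply: (@quadratic_const _ (fun u => windex s (p u)) ((K s + K (- s)) * L ^+ 2)
   (d / 2 / L)) => //.
- by rewrite mulr_ge0 ?sqr_ge0 // addr_ge0.
- by apply: divr_gt0 => //; apply: divr_gt0.
move=> u v u01 v01; rewrite ler_pdivlMr // => uv.
have h : normc (p u - p v) <= d / 2 by apply: le_trans uv.
have q1 := quad s u v as3 u01 v01 h.
have q2 := quad (- s) u v aNs3 u01 v01 h.
rewrite winding2E // in q1; last exact: mp.
rewrite winding2E // in q2; last exact: mp.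
(* [c] is the common derivative of the two terms at [p v]. *)
set c := (_ - _^-1) in q1 q2; rewrite /windex.
have tele (x y x' y' k : R[i]) : x - y - (x' - y') = (x - x' - k) - (y - y' - k) by ring.
rewrite (tele _ _ _ _ ((p u - p v) * c)).
apply: le_trans (normc_leB _ _) _; apply: le_trans (lerD q1 q2) _.
rewrite -mulrDl -mulrA ler_wpM2l ?addr_ge0 //.
rewrite mulrC -exprMn -[leRHS]real_normK ?num_real // normrM (gtr0_norm L0).
by rewrite lerXn2r ?nnegrE ?mulr_ge0 ?normc_ge0 // ltW.
Qed.

(** At the centre of the diamond, the imaginary part of the integrand of
    [winding r] has the sign of [r], so the two terms of [windex] add up. *)
Lemma windex_neq0 s z : 3^-1 <= s -> s <= 1 -> middle z -> windex s z != 0.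
Proof.
move=> s3 s1 mz; rewrite windex_const //.
have s0 : 0 < s by apply: lt_le_trans s3; rewrite invr_gt0.
have mH : middle H%:C.
  rewrite /middle /= subrr !normr0; split => //.
  by rewrite divr_ge0 // hw_ge0 // ?oppr_le0 ltW.
have d0 := middle_hw_gt0 mH.
have as3 (r : R) : `|r| = s -> 3^-1 <= `|r| by move=> ->.
have ir (r : R) : `|r| = s -> cintegrable `]- H, H[ (fun t => dcarc r t / (carc r t - H%:C)).
  move=> rs; exact: (@pole_integrable _ (- H) H (carc r) (dcarc r)
   (fun t _ => carc_contR r t) (fun t _ => dcarc_contR H0 r t) (dcarc_integrable r) _ _ d0
   (middle_separated (as3 r rs) mH)).
have ImE (r t : R) : `|r| = s -> - H < t < H ->
   Im (dcarc r t / (carc r t - H%:C)) =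
   r * ((H ^+ 2 + t ^+ 2) / (2 * H)) / ((r * hw t) ^+ 2 + t ^+ 2).
  move=> rs tH; rewrite cImM cReV cImV normcE2 cReD cReN cImD cImN /=.
  have -> : H + r * hw t - H = r * hw t by ring.
  rewrite !subr0.
  have n0 : (r * hw t) ^+ 2 + t ^+ 2 != 0.
    rewrite gt_eqF //; have [->|tN0] := eqVneq t 0.
      rewrite expr0n /= addr0 exprn_even_gt0 //= mulf_neq0 //.
        by rewrite -normr_gt0 rs.
      by rewrite gt_eqF // hw_gt0 //; lra.
    by rewrite ltr_wpDl ?sqr_ge0 // exprn_even_gt0.
  apply: (mulIf n0); rewrite divfK //.
  rewrite mulrDl -!mulrA !mulVf // !mulr1.
  by field; rewrite gt_eqF.
have spos : `|s| = s by rewrite gtr0_norm.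
have sneg : `|- s| = s by rewrite normrN.
suff : 0 < Im (windex s H%:C) by apply: contraTneq => ->; rewrite ltxx.
rewrite /windex cImD cImN /winding /ctransform /=.
have [_ is_] := ir s spos; have [_ iNs] := ir (- s) sneg.
have low : s / (4 * H) * (H - - H) <= \int[mu]_(t in `]- H, H[) Im (dcarc s t / (carc s t - H%:C)).
  rewrite -Rintegral_segment_cst; last by have := H0; lra.
  rewrite -Rintegral_itv_obnd_cbnd; last first.
    by apply: integrableS (segment_cst_integrable (- H) H _) => //; exact: subset_itv_oc_cc.
  rewrite -Rintegral_itv_bndo_bndc; last first.
    by apply: integrableS (segment_cst_integrable (- H) H _) => //; exact: subset_itv_oo_cc.
  apply: le_Rintegral => //.
    by apply: integrableS (segment_cst_integrable (- H) H _) => //; exact: subset_itv_oo_cc.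
  move=> t tI; have tH : - H < t < H by move: tI; rewrite /= in_itv.
  rewrite ImE //.
  have [t1 t2] := andP tH.
  have tt : t ^+ 2 <= H ^+ 2 by nra.
  have hh : (s * hw t) ^+ 2 <= H ^+ 2.
    rewrite lerXn2r ?nnegrE ?(ltW H0) //; first by rewrite mulr_ge0 ?hw_ge0 ?ltW.
    by rewrite -[leRHS]mul1r ler_pM ?(ltW s0) ?hw_leH // hw_ge0 // ltW.
  have n0 : 0 < (s * hw t) ^+ 2 + t ^+ 2.
    by rewrite ltr_pwDl ?sqr_ge0 // exprn_gt0 // mulr_gt0 // hw_gt0.
  rewrite ler_pdivlMr // -mulrA ler_wpM2l ?(ltW s0) //.
  apply: le_trans (_ : (4 * H)^-1 * (2 * H ^+ 2) <= _).
    by rewrite ler_wpM2l ?invr_ge0 ?mulr_ge0 ?(ltW H0) //; lra.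
  have -> : (4 * H)^-1 * (2 * H ^+ 2) = H ^+ 2 / (2 * H) by field; rewrite gt_eqF.
  by rewrite ler_wpM2r ?invr_ge0 ?mulr_ge0 ?(ltW H0) // lerDl sqr_ge0.
have up : \int[mu]_(t in `]- H, H[) Im (dcarc (- s) t / (carc (- s) t - H%:C)) <= 0.
  have <- : \int[mu]_(t in `]- H, H[) (0 : R) = 0 by rewrite /Rintegral integral0.
  apply: le_Rintegral => //.
    by apply: integrableS (segment_cst_integrable (- H) H _) => //; exact: subset_itv_oo_cc.
  move=> t tI; have tH : - H < t < H by move: tI; rewrite /= in_itv.
  rewrite ImE // !mulNr oppr_le0.
  rewrite mulr_ge0 ?invr_ge0 ?addr_ge0 ?sqr_ge0 // mulr_ge0 ?(ltW s0) //.
  by rewrite divr_ge0 ?addr_ge0 ?sqr_ge0 // mulr_ge0 // ltW.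
have : 0 < s / (4 * H) * (H - - H).
  by rewrite opprK mulr_gt0 ?addr_gt0 // divr_gt0 // mulr_gt0.
by move=> pos; rewrite subr_gt0; apply: le_lt_trans up _; apply: lt_le_trans low.
Qed.

End Winding.

(** * Holomorphy at a point *)

(** The algebra of values is that of [K], whereas derivability refers to [K] as a
    module over itself. *)
Lemma derivable_mul (K : numFieldType) (F G : K^o -> K^o) (z : K^o) :
  derivable F z 1 -> derivable G z 1 ->
  derivable ((fun w => (F w : K) * (G w : K)) : K^o -> K^o) z 1.
Proof. by move=> f g; exact: (derivableM f g). Qed.

Lemma derivable_inv (K : numFieldType) (F : K^o -> K^o) (z : K^o) : F z != 0 ->
  derivable F z 1 -> derivable ((fun w => (F w : K)^-1) : K^o -> K^o) z 1.
Proof. by move=> F0 f; exact: (derivableV F0 f). Qed.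

Section CdiffAlgebra.
Variable R : realType.
Implicit Types (F G : R[i] -> R[i]) (z : R[i]).

Definition holo_at F z := exists l, cdiff F z l.

Lemma holo_atP F z : holo_at F z <-> derivable (F : R[i]^o -> R[i]^o) z 1.
Proof. by split=> [[l]|]; [exact: cdiff_derivable|exact: derivable_cdiff]. Qed.

Lemma holo_cst c z : holo_at (fun=> c) z.
Proof. by apply/holo_atP; exact: derivable_cst. Qed.

Lemma holo_id z : holo_at id z.
Proof. by apply/holo_atP; exact: derivable_id. Qed.

Lemma holoD F G z : holo_at F z -> holo_at G z -> holo_at (fun w => F w + G w) z.
Proof. by move=> /holo_atP f /holo_atP g; apply/holo_atP; exact: derivableD. Qed.

Lemma holoN F z : holo_at F z -> holo_at (fun w => - F w) z.
Proof. by move=> /holo_atP f; apply/holo_atP; exact: derivableN. Qed.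

Lemma holoB F G z : holo_at F z -> holo_at G z -> holo_at (fun w => F w - G w) z.
Proof. by move=> f g; apply: holoD => //; exact: holoN. Qed.

Lemma holoM F G z : holo_at F z -> holo_at G z -> holo_at (fun w => F w * G w) z.
Proof. by move=> /holo_atP f /holo_atP g; apply/holo_atP; exact: (derivable_mul f g). Qed.

Lemma holoV F z : F z != 0 -> holo_at F z -> holo_at (fun w => (F w)^-1) z.
Proof. by move=> n /holo_atP f; apply/holo_atP; exact: (derivable_inv n f). Qed.

Lemma holo_local F G z (d : R) : 0 < d ->
  (forall w, normc (w - z) < d -> G w = F w) -> holo_at F z -> holo_at G z.
Proof. by move=> d0 FG [l df]; exists l; exact: (cdiff_local d0 FG df). Qed.

Lemma holo_ccont F z : holo_at F z -> ccont F z.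
Proof. by case=> l; exact: cdiff_ccont. Qed.

Definition diff_quot F z l w := if w == z then l else (F w - F z) / (w - z).

Lemma diff_quot_ccont F z l : cdiff F z l -> ccont (diff_quot F z l) z.
Proof.
move=> dF e e0; have [d d0 Hd] := dF _ (divr_gt0 e0 (ltr0Sn R 1)).
exists d => // w /Hd Hw; rewrite /diff_quot eqxx; have [_|wz] := eqVneq w z.
  by rewrite subrr normc0.
have n0 : w - z != 0 by rewrite subr_eq0.
have -> : (F w - F z) / (w - z) - l = (F w - F z - l * (w - z)) / (w - z).
  by field.
rewrite normcM normcV; apply: le_lt_trans (_ : e / 2 < _); last by lra.
by rewrite ler_pdivrMr ?normc_gt0.
Qed.

Lemma diff_quot_holo F z l w : w != z -> holo_at F w -> holo_at (diff_quot F z l) w.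
Proof.
move=> wz hF; have d0 := normc_sub_gt0 wz.
have n0 : w - z != 0 by rewrite subr_eq0.
apply: (@holo_local (fun u => (F u - F z) * (u - z)^-1) _ _ _ d0).
  move=> u uw; rewrite /diff_quot ifN //.
  by apply: contraTneq uw => ->; rewrite normc_sub -leNgt.
apply: holoM; first by apply: holoB => //; exact: holo_cst.
by apply: holoV => //; apply: holoB; [exact: holo_id|exact: holo_cst].
Qed.

End CdiffAlgebra.

(** * Cauchy's formula on the arcs *)

Section ArcData.
Variables (R : realType) (H : R).
Hypothesis H0 : 0 < H.
Notation mu := (@lebesgue_measure R).
Implicit Types (s t : R) (z w : R[i]) (F : R[i] -> R[i]).
Local Notation carc := (carc H).
Local Notation dcarc := (dcarc H).
Local Notation hw := (hw H).

Definition arc_holo F := forall s t, `|s| < 1 -> - H < t < H -> holo_at F (carc s t).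

(** The weight [(hw t)^-1] is the one that Cauchy-Schwarz pairs with the Poisson
    kernel [kern]; it also makes [F] integrable along the arc, since
    [`|F| <= `|F| ^+ 2 / hw + hw]. *)
Definition arc_l2 F s := mu.-integrable `]- H, H[
  (EFin \o (fun t => normc (F (carc s t)) ^+ 2 / hw t)).

(** Chords of the lens as close as desired to both vertices, on which the mean
    square of [F] is controlled.  The factor [hw T] is the speed at which [carc]
    runs through the chord. *)
Definition heights F s K := forall h : R, 0 < h -> h < H ->
  (exists T : R, [/\ H - h < T, T < H &
     hw T * \int[mu]_(r in `[- s, s]) (normc (F (carc r T)) ^+ 2) <= K * h]) /\
  (exists T : R, [/\ - H < T, T < - (H - h) &
     hw T * \int[mu]_(r in `[- s, s]) (normc (F (carc r T)) ^+ 2) <= K * h]).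

Definition cauchyI F s z :=
  ctransform (- H) H (carc s) (fun t => F (carc s t) * dcarc s t) z.

Lemma cintegrable_subitv (I J : interval R) (G : R -> R[i]) : (I <= J)%O ->
  cintegrable [set` J] G -> cintegrable [set` I] G.
Proof.
by move=> IJ; apply: cintegrableS; [exact: measurable_itv|exact: measurable_itv|by move=> t; exact: (subitvP IJ)].
Qed.

Lemma cint_oo_split (a c d b : R) (G : R -> R[i]) : a < c -> c <= d -> d < b ->
  cintegrable `]a, b[ G ->
  cint `]a, b[ G = cint `]a, c[ G + cint `[c, d] G + cint `]d, b[ G.
Proof.
move=> ac cd db iG.
have i1 : cintegrable `]a, c[ G.
  by apply: cintegrable_subitv iG; rewrite subitvE !bnd_simp ltW // (le_lt_trans cd).
have i2 : cintegrable `]c, b[ G.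
  by apply: cintegrable_subitv iG; rewrite subitvE !bnd_simp ltW.
have i3 : cintegrable `]c, d] G.
  by apply: cintegrable_subitv iG; rewrite subitvE !bnd_simp (ltW ac).
suff E (f : R -> R) : mu.-integrable `]a, b[ (EFin \o f) ->
    mu.-integrable `]a, c[ (EFin \o f) -> mu.-integrable `]c, b[ (EFin \o f) ->
    mu.-integrable `]c, d] (EFin \o f) ->
    \int[mu]_(t in `]a, b[) f t = \int[mu]_(t in `]a, c[) f t +
      \int[mu]_(t in `[c, d]) f t + \int[mu]_(t in `]d, b[) f t.
  have [a1 a2] := iG; have [b1 b2] := i1; have [c1 c2] := i2; have [d1 d2] := i3.
  by apply: eq_ReIm; rewrite !(cReD, cImD) /=; exact: E.
move=> f0 f1 f2 f3.
have := @Rintegral_itvB _ f (BRight a) (BLeft b) c f0.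
rewrite !bnd_simp => /(_ (ltW ac) (le_lt_trans cd db)) E1.
have := @Rintegral_itvB _ f (BRight c) (BLeft b) d f2.
rewrite !bnd_simp => /(_ cd db) E2.
have chain (x y z u v : R) : x - y = z -> z - u = v -> x = y + u + v by lra.
by rewrite (Rintegral_itv_bndo_bndc f1) -(Rintegral_itv_obnd_cbnd f3); exact: chain E1 E2.
Qed.

End ArcData.

Section CauchyFormula.
Variables (R : realType) (H : R).
Hypothesis H0 : 0 < H.
Notation mu := (@lebesgue_measure R).
Implicit Types (s t : R) (z w : R[i]) (F : R[i] -> R[i]).
Local Notation carc := (carc H).
Local Notation dcarc := (dcarc H).
Local Notation hw := (hw H).
Local Notation arc_holo := (arc_holo H).
Local Notation arc_l2 := (arc_l2 H).
Local Notation heights := (heights H).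
Local Notation cauchyI := (cauchyI H).
Local Notation winding := (winding H).
Local Notation middle := (middle H).

Lemma integrable_subitv (I J : interval R) (f : R -> \bar R) : (I <= J)%O ->
  mu.-integrable [set` J] f -> mu.-integrable [set` I] f.
Proof.
move=> IJ; apply: (@integrableS _ _ _ mu [set` J]); [exact: measurable_itv|exact: measurable_itv|].
by move=> t; exact: (subitvP IJ).
Qed.

Lemma oo_cst_integrable (a b k : R) : mu.-integrable `]a, b[ (EFin \o (fun=> k)).
Proof.
apply: integrable_subitv (segment_cst_integrable a b k).
by rewrite subitvE !bnd_simp.
Qed.

Lemma Rintegral_subset (I J : interval R) (f : R -> R) : (I <= J)%O ->
  mu.-integrable [set` J] (EFin \o f) -> (forall t, t \in J -> 0 <= f t) ->
  \int[mu]_(t in [set` I]) f t <= \int[mu]_(t in [set` J]) f t.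
Proof.
move=> IJ fi f0; have sub : [set` I] `<=` [set` J] by move=> t; exact: (subitvP IJ).
have fI := integrable_subitv IJ fi.
rewrite /Rintegral fine_le //; [exact: integrable_fin_num|exact: integrable_fin_num|].
apply: ge0_subset_integral => //.
exact: (measurable_int mu fi).
Qed.

Lemma arcF_contR F s t : arc_holo F -> `|s| < 1 -> - H < t < H ->
  contR (fun u => F (carc s u)) t.
Proof.
move=> hF s1 tH; apply: contR_comp; first by apply: holo_ccont; exact: hF.
exact: carc_contR.
Qed.

Lemma arc_density_integrable F s : arc_holo F -> `|s| < 1 -> arc_l2 F s ->
  cintegrable `]- H, H[ (fun t => F (carc s t) * dcarc s t).
Proof.
move=> hF s1 lF.
apply: (@cmeasurable_integrable _ _ _
  (fun t => 2 * (normc (F (carc s t)) ^+ 2 / hw t) + 2 * H)) => //.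
- apply: cont_cmeasurable => t tH; apply: contRM; first exact: arcF_contR.
  exact: dcarc_contR.
- rewrite (_ : _ \o _ = ((EFin \o (fun t => (2 * (normc (F (carc s t)) ^+ 2 / hw t))%R))
      \+ (EFin \o (fun=> 2 * H)%R))%E); last by apply/funext => t /=; rewrite EFinD.
  apply: integrableD => //; first exact: integrable_scale.
  exact: oo_cst_integrable.
move=> t /=; rewrite in_itv /= => tH; have [t1 t2] := andP tH.
have q0 := hw_gt0 H0 t1 t2; have qH := hw_leH H0 t.
rewrite normcM; have d2 : normc (dcarc s t) <= 2.
  by apply: dcarc_le => //; exact: ltW.
set a := normc (F _); have a0 : 0 <= a by exact: normc_ge0.
apply: le_trans (_ : a * 2 <= _); first by rewrite ler_wpM2l.
rewrite mulrC -mulrDr ler_pM2l //.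
suff : a <= a ^+ 2 / hw t + hw t by lra.
rewrite -(ler_pM2r q0) mulrDl divfK ?gt_eqF //.
by have := sqr_ge0 (a - hw t); have := sqr_ge0 a; have := mulr_ge0 a0 (ltW q0); nra.
Qed.

(** Near a vertex [hw <= h], so that [`|F| ^+ 2 <= h * (`|F| ^+ 2 / hw)]: the
    integral of [`|F| <= `|F| ^+ 2 + 1] over an end of the arc is of order [h]. *)
Lemma diff_quot_tail F s z l (c d h del : R) : arc_holo F -> `|s| < 1 -> arc_l2 F s ->
  - H <= c -> c <= d -> d <= H -> d - c <= h -> 0 < h -> 0 < del ->
  (forall t, c < t < d -> hw t <= h) ->
  (forall t, c < t < d -> del <= `|t - Im z|) ->
  cintegrable `]c, d[ (fun t => diff_quot F z l (carc s t) * dcarc s t) ->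
  normc (cint `]c, d[ (fun t => diff_quot F z l (carc s t) * dcarc s t)) <=
  4 / del * (\int[mu]_(t in `]- H, H[) (normc (F (carc s t)) ^+ 2 / hw t) +
     (1 + normc (F z))) * h.
Proof.
move=> hF s1 lF cH cd dH dch h0 del0 qh zdel iG.
have q0 t : t \in `]- H, H[ -> 0 < hw t.
  by rewrite in_itv /= => /andP[]; exact: hw_gt0.
set M := Rintegral _ _ _.
pose g t := (2 / del) * (h * (normc (F (carc s t)) ^+ 2 / hw t) + (1 + normc (F z))).
have sub : (`]c, d[ <= `]- H, H[)%O by rewrite subitvE !bnd_simp cH.
have i1 : mu.-integrable `]c, d[ (EFin \o (fun t => normc (F (carc s t)) ^+ 2 / hw t)).
  exact: integrable_subitv lF.
have i2 : mu.-integrable `]c, d[ (EFin \o (fun=> 1 + normc (F z))).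
  exact: oo_cst_integrable.
have i3 : mu.-integrable `]c, d[ (EFin \o (fun t => h * (normc (F (carc s t)) ^+ 2 / hw t))).
  exact: integrable_scale.
have i4 : mu.-integrable `]c, d[ (EFin \o (fun t => h * (normc (F (carc s t)) ^+ 2 / hw t) + (1 + normc (F z)))).
  rewrite (_ : _ \o _ = ((EFin \o (fun t => (h * (normc (F (carc s t)) ^+ 2 / hw t))%R))
      \+ (EFin \o (fun=> 1 + normc (F z))%R))%E); last by apply/funext => t /=; rewrite EFinD.
  exact: integrableD.
apply: le_trans (@cint_norm_le _ _ _ g _ iG _ _) _ => //.
- exact: integrable_scale.
- move=> t /=; rewrite in_itv /= => tcd; have tI : t \in `]- H, H[.
    by apply: (subitvP sub); rewrite in_itv.
  have := q0 _ tI; have := qh _ tcd; set q := hw t => qh' q0'.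
  move: tI; rewrite in_itv /= => /andP[t1 t2].
  have d2 : normc (dcarc s t) <= 2 by apply: dcarc_le => //; exact: ltW.
  have zt : del <= normc (carc s t - z).
    apply: le_trans (zdel _ tcd) _; apply: le_trans (normc_Im _).
    by rewrite cImD cImN.
  have n0 : carc s t != z.
    by apply: contraTneq zt => ->; rewrite subrr normc0 -ltNge.
  rewrite /diff_quot ifN // normcM normcM normcV /g.
  set a := normc (F (carc s t)); have a0 : 0 <= a by exact: normc_ge0.
  have dl : (normc (carc s t - z))^-1 <= del^-1.
    by rewrite lef_pV2 ?posrE // (lt_le_trans del0).
  have -> : 2 / del * (h * (a ^+ 2 / q) + (1 + normc (F z))) =
     (h * (a ^+ 2 / q) + (1 + normc (F z))) * del^-1 * 2 by ring.
  rewrite ler_pM ?mulr_ge0 ?invr_ge0 ?normc_ge0 // ler_pM ?invr_ge0 ?normc_ge0 //.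
  apply: le_trans (normc_leB _ _) _; rewrite -/a addrA lerD2r.
  apply: le_trans (_ : a ^+ 2 + 1 <= _); first by nra.
  rewrite lerD2r mulrCA ler_peMr ?sqr_ge0 //.
  by rewrite ler_pdivlMr // mul1r.
rewrite /g RintegralZl // RintegralD // RintegralZl //.
have -> : \int[mu]_(x in `]c, d[) (1 + normc (F z)) = (1 + normc (F z)) * (d - c).
  rewrite -Rintegral_segment_cst // Rintegral_itv_bndo_bndc //.
  rewrite Rintegral_itv_obnd_cbnd //.
  by apply: integrable_subitv (segment_cst_integrable c d _); rewrite subitvE !bnd_simp.
have Mle := @Rintegral_subset _ _ (fun t => normc (F (carc s t)) ^+ 2 / hw t) sub lF
   (fun t tI => divr_ge0 (sqr_ge0 _) (ltW (q0 t tI))).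
rewrite -/M in Mle.
set B := 1 + normc (F z); have B0 : 0 <= B by rewrite addr_ge0 ?normc_ge0.
set I := Rintegral mu `]c, d[ _ in Mle *.
have -> : 2 * (2 / del * (h * I + B * (d - c))) = 4 / del * (h * I + B * (d - c)) by ring.
rewrite -[leRHS]mulrA ler_wpM2l ?divr_ge0 ?(ltW del0) // [leRHS]mulrDl lerD //.
  by rewrite mulrC ler_wpM2r // ltW.
by rewrite ler_wpM2l.
Qed.

Lemma diff_quot_cont F z l (a b c d : R) : cdiff F z l ->
  (forall s t, a <= s <= b -> c <= t <= d -> holo_at F (carc s t)) ->
  cont_on H (diff_quot F z l) a b c d.
Proof.
move=> dF hF s t sab tcd; have [->|ne] := eqVneq (carc s t) z; first exact: diff_quot_ccont.
by apply: holo_ccont; apply: diff_quot_holo => //; exact: hF.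
Qed.

Lemma carc_inj s t s' t' : - H < t < H -> carc s t = carc s' t' -> s = s' /\ t = t'.
Proof.
move=> /andP[t1 t2] [+ tE]; rewrite -{}tE => /addrI /mulIf ->; first by [].
by rewrite gt_eqF // hw_gt0.
Qed.

Lemma middle_carc z : middle z -> exists2 s0, `|s0| <= 6^-1 & z = carc s0 (Im z).
Proof.
move=> [zx zy]; have q0 : 0 < hw (Im z).
  by move: zy; rewrite ltr_norml => /andP[]; exact: hw_gt0.
exists ((Re z - H) / hw (Im z)).
  by rewrite normrM normfV (gtr0_norm q0) ler_pdivrMr // mulrC.
by apply: eq_ReIm; rewrite //= divfK ?gt_eqF //; ring.
Qed.

Lemma diff_quot_truncate F s z l (c d h del : R) : arc_holo F -> `|s| < 1 -> arc_l2 F s ->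
  - H < c -> c < - (H - h) -> H - h < d -> d < H -> 0 < h -> h <= H -> 0 < del ->
  del <= H - h - `|Im z| ->
  cintegrable `]- H, H[ (fun t => diff_quot F z l (carc s t) * dcarc s t) ->
  normc (cint `]- H, H[ (fun t => diff_quot F z l (carc s t) * dcarc s t) -
         cint `[c, d] (fun t => diff_quot F z l (carc s t) * dcarc s t)) <=
  2 * (4 / del * (\int[mu]_(t in `]- H, H[) (normc (F (carc s t)) ^+ 2 / hw t) +
     (1 + normc (F z)))) * h.
Proof.
move=> hF s1 lF cH ch dh dH h0 hH del0 delz iG.
have hH0 : 0 <= H - h by rewrite subr_ge0.
have c0 : c < 0 by rewrite (lt_le_trans ch) // oppr_le0.
have d0 : 0 < d by exact: le_lt_trans dh.
have cd : c <= d by exact: ltW (lt_trans c0 d0).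
have far t : H - h <= `|t| -> hw t <= h \/ H < `|t|.
  have [tH ht|//] := leP `|t| H; last by right.
  by left; apply: le_trans (hw_le H0 tH) _; rewrite lerBlDl -lerBlDr.
have farz t : H - h <= `|t| -> del <= `|t - Im z|.
  move=> ht; apply: le_trans delz _; apply: le_trans (lerB_dist _ _).
  by rewrite lerD2r.
have bot t : t < c -> H - h <= `|t|.
  move=> tc; rewrite ltr0_norm ?(lt_trans tc) // lerNr ltW //.
  exact: lt_trans ch.
have top t : d < t -> H - h <= `|t|.
  move=> dt; rewrite gtr0_norm ?(lt_trans d0) // ltW //; exact: lt_trans dt.
rewrite (cint_oo_split cH cd dH iG).
set G := fun t => _; set i1 := cint _ _; set i2 := cint _ _; set i3 := cint _ _.
have -> : i1 + i2 + i3 - i2 = i1 + i3 by ring.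
set E := _ * _ * h; apply: le_trans (normc_leD _ _) _.
have q t : - H < t -> t < H -> H - h <= `|t| -> hw t <= h.
  move=> t1 t2 /far[//|]; rewrite ltNge.
  by have -> : `|t| <= H by rewrite ler_norml !ltW.
have b1 : normc i1 <= 4 / del *
    (\int[mu]_(t in `]- H, H[) (normc (F (carc s t)) ^+ 2 / hw t) + (1 + normc (F z))) * h.
  apply: diff_quot_tail => //.
  - exact: ltW.
  - exact: ltW (lt_trans c0 H0).
  - by rewrite opprK -lerBrDr; apply: ltW; apply: lt_le_trans ch _; rewrite opprB.
  - move=> t /andP[t1 t2]; apply: q => //; last exact: bot.
    by rewrite (lt_trans t2) // (lt_trans c0).
  - by move=> t /andP[t1 t2]; apply: farz; exact: bot.
  - apply: cintegrable_subitv iG; rewrite subitvE !bnd_simp ?lexx /=.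
    exact: ltW (lt_trans c0 H0).
have b3 : normc i3 <= 4 / del *
    (\int[mu]_(t in `]- H, H[) (normc (F (carc s t)) ^+ 2 / hw t) + (1 + normc (F z))) * h.
  apply: diff_quot_tail => //.
  - exact: ltW (lt_trans cH (lt_trans c0 d0)).
  - exact: ltW.
  - by rewrite lerBlDr -lerBlDl ltW.
  - move=> t /andP[t1 t2]; apply: q => //; last exact: top.
    by rewrite (lt_trans _ t1) // (lt_trans cH) // (lt_trans c0).
  - by move=> t /andP[t1 t2]; apply: farz; exact: top.
  - apply: cintegrable_subitv iG; rewrite subitvE !bnd_simp ?lexx ?andbT.
    exact: ltW (lt_trans cH (lt_trans c0 d0)).
apply: le_trans (lerD b1 b3) _.
by rewrite le_eqVlt; apply/orP; left; apply/eqP; rewrite /E; ring.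
Qed.

(** [`|F| <= `|F| ^+ 2 + 1] again, with the mean square on the chord bounded by
    the hypothesis and the constant by [hw t <= h]. *)
Lemma diff_quot_horizontal F s z l (t h del K : R) : 0 < s -> s <= 1 ->
  - H <= t -> t <= H -> hw t <= h -> 0 < del -> del <= `|t - Im z| ->
  (forall r, - s <= r <= s -> holo_at F (carc r t)) ->
  hw t * \int[mu]_(r in `[- s, s]) (normc (F (carc r t)) ^+ 2) <= K * h ->
  cintegrable `[- s, s] (fun r => diff_quot F z l (carc r t) * (hw t)%:C) ->
  normc (cint `[- s, s] (fun r => diff_quot F z l (carc r t) * (hw t)%:C)) <=
    (2 / del * (K + 2 * (1 + normc (F z)))) * h.
Proof.
move=> s0 s1 tH1 tH2 qh del0 nz hol hor iQ.
have q0 : 0 <= hw t by exact: hw_ge0.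
set B := 1 + normc (F z).
have B0 : 0 <= B by rewrite addr_ge0 ?normc_ge0.
have i5 : mu.-integrable `[- s, s] (EFin \o (fun r => normc (F (carc r t)) ^+ 2)).
  apply: cont_integrable => r rs; apply: contR_normc2.
  apply: (@contR_comp _ _ (carc^~ t)); first by apply: holo_ccont; exact: hol.
  exact: cderiv_contR (carc_cderiv_s _ _ _).
have i6 : mu.-integrable `[- s, s] (EFin \o (fun r => normc (F (carc r t)) ^+ 2 + B)).
  rewrite (_ : _ \o _ = ((EFin \o (fun r => (normc (F (carc r t)) ^+ 2)%R))
    \+ (EFin \o (fun=> B)))%E); last by apply/funext => r /=; rewrite EFinD.
  by apply: integrableD => //; exact: segment_cst_integrable.
apply: le_trans (@cint_norm_le _ _ _
   (fun r => (hw t / del) * (normc (F (carc r t)) ^+ 2 + B)) _ _ _ _) _ => //.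
- exact: integrable_scale.
- move=> r _; rewrite normcM normc_real (ger0_norm q0) mulrC -mulrA ler_wpM2l //.
  have zt : del <= normc (carc r t - z).
    by apply: le_trans nz _; apply: le_trans (normc_Im _); rewrite cImD cImN.
  have n0 : carc r t != z.
    by apply: contraTneq zt => ->; rewrite subrr normc0 -ltNge.
  rewrite /diff_quot ifN // normcM normcV mulrC ler_pM ?invr_ge0 ?normc_ge0 //.
    by rewrite lef_pV2 ?posrE // (lt_le_trans del0).
  apply: le_trans (normc_leB _ _) _; rewrite /B addrA lerD2r.
  have := normc_ge0 (F (carc r t)); set a := normc _ => a0.
  by clear -a0; nra.
rewrite RintegralZl // RintegralD //; last exact: segment_cst_integrable.
have sNs : - s <= s by rewrite ge0_cp // ltW.
rewrite Rintegral_segment_cst //.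
set I := Rintegral _ _ _ in hor *.
have -> : 2 * (hw t / del * (I + B * (s - - s))) =
    2 / del * (hw t * I + B * (2 * s) * hw t) by ring.
rewrite -[leRHS]mulrA; apply: ler_wpM2l; first by rewrite divr_ge0 // ltW.
rewrite [leRHS]mulrDl; apply: lerD => //; apply: ler_pM => //.
  by rewrite mulr_ge0 // mulr_ge0 // ltW.
by rewrite [leRHS]mulrC ler_wpM2l // -[leRHS]mulr1 ler_wpM2l.
Qed.

(** The difference quotient [G] of [F] at [z] is continuous, and holomorphic
    except at [z], so its integral along the boundary of a rectangle of the
    coordinates [(s, t)] vanishes.  Choosing the lower and upper sides among the
    chords of [heights] and letting them tend to the vertices, the integrals of
    [G] along the arcs [s] and [- s] agree; expanding the quotient gives the
    formula. *)
Lemma cauchy_arcs F s z K : arc_holo F -> 3^-1 <= s -> s < 1 -> 0 <= K ->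
  arc_l2 F s -> arc_l2 F (- s) -> heights F s K -> middle z ->
  cauchyI F s z - cauchyI F (- s) z = F z * windex H s z.
Proof.
move=> hF s3 s1 K0 lF lFN hts mz.
have s0 : 0 < s by apply: lt_le_trans s3; rewrite invr_gt0.
have [_ zy] := mz; move: (zy); rewrite ltr_norml => /andP[zy1 zy2].
have [s' s'6 zE] := middle_carc mz; set t0 := Im z in zy zy1 zy2 zE.
have [l dF] : holo_at F z.
  by rewrite zE; apply: hF; rewrite ?zy1 // (le_lt_trans s'6) // invf_lt1 // ltr1n.
have abs (r : R) : `|r| = s -> 3^-1 <= `|r| /\ `|r| < 1 by move=> ->.
pose G r t := diff_quot F z l (carc r t) * dcarc r t.
have d0 := middle_hw_gt0 H0 mz.
have dens r : `|r| = s -> arc_l2 F r ->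
    cintegrable `]- H, H[ (fun t => F (carc r t) * dcarc r t).
  by move=> /abs[_ r1]; exact: arc_density_integrable.
have cdens r t : `|r| = s -> - H < t < H -> contR (fun t => F (carc r t) * dcarc r t) t.
  by move=> /abs[_ r1] tH; apply: contRM; [exact: arcF_contR|exact: dcarc_contR].
have sep r : `|r| = s -> separated_by (- H) H (carc r) z (hw t0 / 12).
  by move=> /abs[r3 _]; exact: middle_separated.
have ne r t : `|r| = s -> - H < t < H -> carc r t != z.
  move=> rs tH; rewrite -subr_eq0; exact: (separated_neq0 d0 (sep r rs) tH).
have i1 r : `|r| = s -> arc_l2 F r ->
   cintegrable `]- H, H[ (fun t => F (carc r t) * dcarc r t / (carc r t - z)).
  move=> rs lr; exact: (@pole_integrable _ (- H) H (carc r) _ (fun t _ => carc_contR H0 r t)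
    (fun t tH => cdens r t rs tH) (dens r rs lr) _ _ d0 (sep r rs)).
have i2 r : `|r| = s -> cintegrable `]- H, H[ (fun t => dcarc r t / (carc r t - z)).
  move=> rs; exact: (@pole_integrable _ (- H) H (carc r) _ (fun t _ => carc_contR H0 r t)
    (fun t tH => dcarc_contR H0 r t) (dcarc_integrable H0 r) _ _ d0 (sep r rs)).
have GE r t : `|r| = s -> t \in `]- H, H[ ->
   G r t = F (carc r t) * dcarc r t / (carc r t - z) - F z * (dcarc r t / (carc r t - z)).
  move=> rs; rewrite in_itv /= => tH; rewrite /G /diff_quot ifN ?ne //; ring.
have iG r : `|r| = s -> arc_l2 F r -> cintegrable `]- H, H[ (G r).
  move=> rs lr; have [j1 j2] := cintegrableB (measurable_itv _) (i1 r rs lr)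
    (cintegrableZ (F z) (measurable_itv _) (i2 r rs)).
  by split; [move: j1|move: j2]; apply: eq_integrable => // t /set_mem tH; rewrite /= GE.
have AE r : `|r| = s -> arc_l2 F r ->
    cint `]- H, H[ (G r) = cauchyI F r z - F z * winding r z.
  move=> rs lr; have -> : cauchyI F r z = cint `]- H, H[ (fun t => F (carc r t) * dcarc r t / (carc r t - z)).
    by [].
  have -> : winding r z = cint `]- H, H[ (fun t => dcarc r t / (carc r t - z)) by [].
  rewrite -(cintZ (F z) (measurable_itv _) (i2 r rs)).
  rewrite -(cintB (measurable_itv _) (i1 r rs lr)); last first.
    exact: cintegrableZ (measurable_itv _) (i2 r rs).
  by apply: eq_cint => t tH; rewrite GE.
have sp : `|s| = s by rewrite gtr0_norm.
have sn : `|- s| = s by rewrite normrN.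
suff : cint `]- H, H[ (G s) - cint `]- H, H[ (G (- s)) = 0.
  rewrite !AE // /windex => E; apply/eqP; rewrite -subr_eq0 -E; apply/eqP; ring.
pose M r := \int[mu]_(t in `]- H, H[) (normc (F (carc r t)) ^+ 2 / hw t).
pose B := 1 + normc (F z).
pose del := (H - `|t0|) / 2.
have del0 : 0 < del by rewrite divr_gt0 // subr_gt0.
pose C := 2 * (4 / del * (M s + B)) + 2 * (4 / del * (M (- s) + B)) + 2 * (2 / del * (K + 2 * B)).
have M0 r : 0 <= M r.
  apply: Rintegral_ge0 => t; rewrite /= in_itv /= => /andP[t1 t2].
  by rewrite divr_ge0 ?sqr_ge0 // hw_ge0 // ltW.
have B0 : 0 <= B by rewrite addr_ge0 ?normc_ge0.
(* It suffices to compare the two integrals up to a multiple of the distance [h]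
   of the chords to the vertices. *)
suff bound h : 0 < h -> h < del -> normc (cint `]- H, H[ (G s) - cint `]- H, H[ (G (- s))) <= C * h.
  apply: eq0_normc; apply/eqP; rewrite eq_le normc_ge0 andbT.
  have C1 : 0 < C + 1.
    have Mr r : 0 <= 2 * (4 / del * (M r + B)).
      apply: mulr_ge0 => //; apply: mulr_ge0; first by rewrite divr_ge0 // ltW.
      by apply: addr_ge0 => //; exact: M0.
    rewrite ltr_wpDl //; apply: addr_ge0; first exact: addr_ge0.
    apply: mulr_ge0 => //; apply: mulr_ge0; first by rewrite divr_ge0 // ltW.
    by apply: addr_ge0 => //; exact: mulr_ge0.
  apply/ler_addgt0Pr => e e0; rewrite add0r.
  pose h := Num.min (e / (C + 1)) (del / 2).
  have h0 : 0 < h by rewrite lt_min; apply/andP; split; exact: divr_gt0.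
  have hd : h < del.
    apply: le_lt_trans (_ : del / 2 < _); first by rewrite ge_min lexx orbT.
    by rewrite ltr_pdivrMr // ltr_pMr // ltr1n.
  apply: le_trans (bound h h0 hd) _.
  have : h <= e / (C + 1) by rewrite ge_min lexx.
  rewrite ler_pdivlMr // mulrDr mulr1 (mulrC h) => he.
  by apply: le_trans he; rewrite lerDl ltW.
move=> h0 hd.
have tn := normr_ge0 t0.
have hH : h < H.
  apply: lt_le_trans hd _; rewrite ler_pdivrMr //.
  by apply: le_trans (_ : H <= _); rewrite ?gerBl // ler_pMr // ler1n.
have delz : del <= H - h - `|t0|.
  have dd : del + del = H - `|t0| by rewrite /del; clear; field.
  by rewrite addrAC -dd lerBrDr lerD2l ltW.
have [[T [T1 T2 hor1]] [T' [T'1 T'2 hor2]]] := hts h h0 hH.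
have tT : `|t0| < H - h by rewrite -subr_gt0 (lt_le_trans del0).
have [t0T T't0] : t0 < T /\ T' < t0.
  move: tT; rewrite ltr_norml => /andP[a1 a2]; split; first exact: lt_trans T1.
  exact: lt_trans a1.
have T'T : T' <= T by exact: ltW (lt_trans T't0 t0T).
have splt r : `|r| = s -> arc_l2 F r -> normc (cint `]- H, H[ (G r) - cint `[T', T] (G r))
    <= 2 * (4 / del * (M r + B)) * h.
  move=> rs lr; have [_ r1] := abs r rs.
  by apply: diff_quot_truncate => //; [exact: ltW|exact: iG].
have ss : - s <= s by rewrite ge0_cp // ltW.
have hol r t : - s <= r <= s -> T' <= t <= T -> holo_at F (carc r t).
  move=> /andP[r1 r2] /andP[t1 t2]; apply: hF.
    by rewrite ltr_norml (lt_le_trans _ r1) ?(le_lt_trans r2) // ltrN2.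
  by rewrite (lt_le_trans T'1) // (le_lt_trans t2).
have cQ := diff_quot_cont dF hol.
have cau : loop H (diff_quot F z l) (- s) s T' T = 0.
  have s'b : - s < s' < s.
    suff : `|s'| < s by rewrite ltr_norml.
    apply: le_lt_trans s'6 _; apply: lt_le_trans s3.
    by rewrite ltf_pV2 ?posrE // ltr_nat.
  apply: (@cauchy_rect _ _ H0 _ _ _ _ _ s' t0) => //.
  - by rewrite lerN2 ltW.
  - exact: ltW.
  - exact: ltW.
  - exact: ltW.
  - by rewrite T't0.
  move=> r t rs tT2 rne; apply: diff_quot_holo; last exact: hol.
  apply: contraTneq rne; rewrite zE => /carc_inj[].
    have /andP[t1 t2] := tT2.
    by rewrite (lt_le_trans T'1) // (le_lt_trans t2).
  by move=> -> ->; rewrite !eqxx.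
have [_ j2] := cont_on_integrable H0 cQ.
have U t : T' <= t <= T -> hw t <= h -> del <= `|t - t0| ->
   hw t * \int[mu]_(r in `[- s, s]) (normc (F (carc r t)) ^+ 2) <= K * h ->
   normc (cint `[- s, s] (fun r => diff_quot F z l (carc r t) * (hw t)%:C)) <= (2 / del * (K + 2 * B)) * h.
  move=> tT2 qh tt hor; have /andP[t1 t2] := tT2; apply: diff_quot_horizontal => //.
  - exact: ltW.
  - exact: ltW (lt_le_trans T'1 t1).
  - exact: ltW (le_lt_trans t2 T2).
  - by move=> r rs; exact: hol.
  - exact: j2.
move: cau; rewrite /loop.
set vs := cint _ _; set vn := cint _ _; set u1 := cint _ _; set u2 := cint _ _ => cau.
have E : cint `]- H, H[ (G s) - cint `]- H, H[ (G (- s)) =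
   (cint `]- H, H[ (G s) - vs) - (cint `]- H, H[ (G (- s)) - vn) + (u1 - u2).
  have -> : u1 = vs - vn + u2 - (vs - vn - u1 + u2) by ring.
  by rewrite cau; ring.
rewrite {}E; apply: le_trans (normc_leD _ _) _.
have hH0 : 0 < H - h by rewrite subr_gt0.
have T0 : 0 < T by exact: lt_trans T1.
have T'0 : T' < 0 by rewrite (lt_trans T'2) // oppr_lt0.
have U1 : normc u1 <= (2 / del * (K + 2 * B)) * h.
  apply: U => //; first by rewrite lexx T'T.
    apply: le_trans (hw_le H0 _) _; rewrite gtr0_norm // ?(ltW T2) //.
    by rewrite lerBlDl -lerBlDr ltW.
  apply: le_trans delz _; apply: le_trans (lerB_dist _ _).
  by rewrite lerD2r gtr0_norm // ltW.
have U2 : normc u2 <= (2 / del * (K + 2 * B)) * h.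
  apply: U => //; first by rewrite lexx T'T.
    apply: le_trans (hw_le H0 _) _; rewrite ltr0_norm //; last first.
      by rewrite lerBlDl -lerBlDr lerNr ltW.
    by rewrite lerNl ltW.
  apply: le_trans delz _; apply: le_trans (lerB_dist _ _).
  by rewrite lerD2r ltr0_norm // lerNr ltW.
have S1 := splt s sp lF; have S2 := splt (- s) sn lFN.
have k1 := normc_leB (cint `]- H, H[ (G s) - vs) (cint `]- H, H[ (G (- s)) - vn).
have k2 := normc_leB u1 u2.
apply: le_trans (lerD k1 k2) _.
apply: le_trans (lerD (lerD S1 S2) (lerD U1 U2)) _.
by rewrite le_eqVlt; apply/orP; left; apply/eqP; rewrite /C; ring.
Qed.

End CauchyFormula.

(** * Measurability of continuous functions in the plane *)

Section PlaneMeasurability.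
Variable R : realType.
Implicit Types (A : set (R * R)) (g : R * R -> R).

(** Openness and continuity in terms of squares, from which [open2_measurable]
    extracts a countable cover by products of rational intervals. *)
Definition open2 A := forall p, A p -> exists2 r : R, 0 < r &
  forall p', `|p'.1 - p.1| < r -> `|p'.2 - p.2| < r -> A p'.

Definition cont2 g p := forall e : R, 0 < e -> exists2 r : R, 0 < r &
  forall p', `|p'.1 - p.1| < r -> `|p'.2 - p.2| < r -> `|g p' - g p| < e.

Lemma open2_measurable A : open2 A -> measurable A.
Proof.
move=> oA.
pose box (q : (rat * rat) * (rat * rat)) : set (R * R) :=
  `]ratr q.1.1, ratr q.1.2[ `*` `]ratr q.2.1, ratr q.2.2[.
pose F q := if pselect (box q `<=` A) then box q else set0.
have -> : A = \bigcup_q F q.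
  apply/seteqP; split=> [p Ap|p [q _]]; last first.
    by rewrite /F; by case: pselect => // sub; exact: sub.
  have [r r0 pA] := oA p Ap.
  have l (x : R) : x - r < x by rewrite ltrBlDr ltrDl.
  have u (x : R) : x < x + r by rewrite ltrDl.
  have [a] := rat_in_itvoo (l p.1); have [b] := rat_in_itvoo (u p.1).
  have [c] := rat_in_itvoo (l p.2); have [d] := rat_in_itvoo (u p.2).
  rewrite !in_itv /= => /andP[d1 d2] /andP[c1 c2] /andP[b1 b2] /andP[a1 a2].
  exists ((a, b), (c, d)) => //; rewrite /F; case: pselect => [sub|nsub] /=.
    by split; rewrite /= in_itv /=; apply/andP.
  case: nsub => -[x y] [] /=; rewrite !in_itv /= => /andP[x1 x2] /andP[y1 y2].
  apply: pA => /=; rewrite ltr_norml; apply/andP; split.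
  - by rewrite ltrBrDl; exact: lt_trans a1 x1.
  - by rewrite ltrBlDl; exact: lt_trans x2 b2.
  - by rewrite ltrBrDl; exact: lt_trans c1 y1.
  - by rewrite ltrBlDl; exact: lt_trans y2 d2.
apply: countable_bigcupT_measurable; first exact: countableP.
move=> q; rewrite /F; case: pselect => [sub|nsub] /=; last exact: measurable0.
by apply: measurableX; exact: measurable_itv.
Qed.

Lemma cont2_measurable A g : open2 A -> (forall p, A p -> cont2 g p) ->
  measurable_fun A g.
Proof.
move=> oA cg; apply: (measurability _ (RGenOInfty.measurableE R)).
move=> _ [_ [a ->] <-]; apply: open2_measurable => p [Ap /=].
rewrite in_itv /= andbT => ap.
have [r r0 rA] := oA p Ap.
have [r' r'0 rg] : exists2 r : R, 0 < r &
  forall p', `|p'.1 - p.1| < r -> `|p'.2 - p.2| < r -> `|g p' - g p| < g p - a.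
  by apply: cg => //; rewrite subr_gt0.
exists (Num.min r r'); first by rewrite lt_min r0.
move=> p'; rewrite !lt_min => /andP[p1 p1'] /andP[p2 p2']; split; first exact: rA.
rewrite /= in_itv /= andbT; have := rg p' p1' p2'; rewrite ltr_norml; lra.
Qed.

Definition cplx (p : R * R) : R[i] := p.1 +i* p.2.

Lemma cont2_normc2 (f : R[i] -> R[i]) (c : R * R -> R[i]) p :
  (forall e : R, 0 < e -> exists2 r : R, 0 < r &
    forall p', `|p'.1 - p.1| < r -> `|p'.2 - p.2| < r -> normc (c p' - c p) < e) ->
  ccont f (c p) -> cont2 (fun p => normc (f (c p)) ^+ 2) p.
Proof.
move=> cc cf e e0; set b := normc (f (c p)).
have b0 : 0 <= b by exact: normc_ge0.
have k0 : 0 < 2 * b + 1 by rewrite ltr_wpDl // mulr_ge0.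
have e'0 : 0 < Num.min 1 (e / (2 * b + 1)) by rewrite lt_min ltr01 divr_gt0.
have [d d0 Hd] := cf _ e'0; have [r r0 Hr] := cc _ d0.
exists r => // p' p1 p2; have := Hd _ (Hr p' p1 p2).
rewrite lt_min => /andP[f1 f2]; set a := normc (f (c p')).
have ab : `|a - b| <= normc (f (c p') - f (c p)).
  have l1 := normc_leD (f (c p') - f (c p)) (f (c p)).
  have l2 := normc_leD (f (c p) - f (c p')) (f (c p')).
  rewrite subrK -/a -/b in l1; rewrite subrK -/a -/b normc_sub in l2.
  by rewrite ler_norml; lra.
have -> : a ^+ 2 - b ^+ 2 = (a - b) * (a + b) by ring.
rewrite normrM; have a0 : 0 <= a by exact: normc_ge0.
have abn : `|a + b| = a + b by rewrite ger0_norm // addr_ge0.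
have a1 : a + b <= 2 * b + 1.
  have : `|a - b| <= 1 by exact: le_trans ab (ltW f1).
  by rewrite ler_norml; lra.
rewrite abn; apply: le_lt_trans (_ : `|a - b| * (2 * b + 1) < _).
  by rewrite ler_wpM2l.
by rewrite -ltr_pdivlMr //; exact: le_lt_trans ab f2.
Qed.

Lemma cplx_cont2 p (e : R) : 0 < e -> exists2 r : R, 0 < r &
  forall p', `|p'.1 - p.1| < r -> `|p'.2 - p.2| < r -> normc (cplx p' - cplx p) < e.
Proof.
move=> e0; exists (e / 2); first by rewrite divr_gt0.
move=> p' p1 p2; apply: le_lt_trans (normc_ReIm _) _.
by rewrite cReD cImD cReN cImN /=; lra.
Qed.

Lemma normc2_measurable A (f : R[i] -> R[i]) : open2 A ->
  (forall p, A p -> ccont f (cplx p)) ->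
  measurable_fun A (fun p => normc (f (cplx p)) ^+ 2).
Proof.
move=> oA cf; apply: cont2_measurable => // p Ap; apply: cont2_normc2.
  exact: cplx_cont2.
exact: cf.
Qed.

End PlaneMeasurability.

Section Slices.
Variables (R : realType) (H : R).
Hypothesis H0 : 0 < H.
Notation mu := (@lebesgue_measure R).
Local Notation carc := (carc H).
Local Notation hw := (hw H).

Definition strip : set (R * R) := [set p | `|p.1| < 1 /\ - H < p.2 < H].

Lemma strip_open : open2 strip.
Proof.
move=> [s t] /= [s1 /andP[t1 t2]].
exists (Num.min (1 - `|s|) (Num.min (t + H) (H - t))).
  by rewrite !lt_min !subr_gt0 s1 t2 -ltrBlDr sub0r t1.
move=> [s' t'] /=; rewrite !lt_min => /andP[a1 _] /andP[_ /andP[b1 b2]]; split.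
  have := ler_normD (s' - s) s; rewrite subrK; lra.
move: b1 b2; rewrite !ltr_norml => /andP[b1 b2] /andP[c1 c2] /=; apply/andP; split; lra.
Qed.

Lemma carc_cont2 p (e : R) : strip p -> 0 < e -> exists2 r : R, 0 < r &
  forall p', `|p'.1 - p.1| < r -> `|p'.2 - p.2| < r ->
    normc (carc p'.1 p'.2 - carc p.1 p.2) < e.
Proof.
move=> pS e0; have [r r0 Hr] := strip_open pS.
have k0 : 0 < (H + 2) * 2 by rewrite mulr_gt0 // addr_gt0.
exists (Num.min r (e / ((H + 2) * 2))); first by rewrite lt_min r0 divr_gt0.
move=> p'; rewrite !lt_min => /andP[a1 a2] /andP[b1 b2].
have [_ /andP[t1 t2]] := Hr p' a1 b1; have [s3 /andP[t3 t4]] := pS.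
apply: le_lt_trans (carc_sub H0 _ _ _ _ _ _) _; try exact: ltW.
move: a2 b2; rewrite !ltr_pdivlMr //; set x := `|_|; set y := `|_|.
have -> : (H + 2) * (x + y) = (x * ((H + 2) * 2) + y * ((H + 2) * 2)) / 2 by field.
by lra.
Qed.

Lemma slice_measurable (f : R[i] -> R[i]) :
  (forall s t, `|s| < 1 -> - H < t < H -> ccont f (carc s t)) ->
  measurable_fun strip (fun p => normc (f (carc p.1 p.2)) ^+ 2).
Proof.
move=> cf; apply: cont2_measurable; first exact: strip_open.
move=> p pS; apply: (@cont2_normc2 _ f (fun p => carc p.1 p.2)).
  by move=> e e0; exact: carc_cont2.
by case: pS => ? ?; exact: cf.
Qed.

End Slices.

(** * Slicing the diamond by the arcs *)

(** Tonelli's theorem on a product of measurable sets, for functions that are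
    measurable and nonnegative there only: extend them by 0. *)
Section TonelliRect.
Local Open Scope ereal_scope.
Context d1 d2 (T1 : measurableType d1) (T2 : measurableType d2) (R : realType).
Variable m1 : {sigma_finite_measure set T1 -> \bar R}.
Variable m2 : {sigma_finite_measure set T2 -> \bar R}.
Variables (A : set T1) (B : set T2) (f : T1 * T2 -> \bar R).
Hypotheses (mA : measurable A) (mB : measurable B).
Hypothesis mf : measurable_fun (A `*` B) f.
Hypothesis f0 : forall p, (A `*` B) p -> 0 <= f p.

Let h := f \_ (A `*` B).

Let mh : measurable_fun setT h.
Proof. by apply/(measurable_restrictT _ _).1 => //; exact: measurableX. Qed.

Let h0 p : 0 <= h p. Proof. exact: erestrict_ge0. Qed.

Let FE : fubini_F m2 h = (fun x => \int[m2]_(y in B) f (x, y)) \_ A.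
Proof.
apply/funext => x; rewrite /fubini_F /patch; case: ifPn => xA.
  rewrite [RHS]integral_mkcond; apply: eq_integral => y _.
  rewrite /h /patch; have -> : ((x, y) \in A `*` B) = (y \in B).
    apply/idP/idP; rewrite !inE; first by case.
    by move=> yB; split => //; exact/set_mem.
  by [].
rewrite (eq_integral (fun=> 0)) ?integral0 // => y _.
by rewrite /h /patch ifN //; apply: contra xA; rewrite !inE => -[].
Qed.

Let GE : fubini_G m1 h = (fun y => \int[m1]_(x in A) f (x, y)) \_ B.
Proof.
apply/funext => y; rewrite /fubini_G /patch; case: ifPn => yB.
  rewrite [RHS]integral_mkcond; apply: eq_integral => x _.
  rewrite /h /patch; have -> : ((x, y) \in A `*` B) = (x \in A).
    apply/idP/idP; rewrite !inE; first by case.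
    by move=> xA; split => //; exact/set_mem.
  by [].
rewrite (eq_integral (fun=> 0)) ?integral0 // => x _.
by rewrite /h /patch ifN //; apply: contra yB; rewrite !inE => -[].
Qed.

Lemma tonelli_measurable1 : measurable_fun A (fun x => \int[m2]_(y in B) f (x, y)).
Proof.
apply/(measurable_restrictT _ mA); rewrite -FE.
exact: measurable_fun_fubini_tonelli_F.
Qed.

Lemma tonelli_measurable2 : measurable_fun B (fun y => \int[m1]_(x in A) f (x, y)).
Proof.
apply/(measurable_restrictT _ mB); rewrite -GE.
exact: measurable_fun_fubini_tonelli_G.
Qed.

Lemma tonelli_rect : \int[m1]_(x in A) \int[m2]_(y in B) f (x, y) =
  \int[m2]_(y in B) \int[m1]_(x in A) f (x, y).
Proof.
rewrite [LHS]integral_mkcond -FE [RHS]integral_mkcond -GE.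
by rewrite -fubini_tonelli1 // fubini_tonelli2.
Qed.

End TonelliRect.

Section ChangeOfVariables.
Variables (R : realType) (H : R).
Hypothesis H0 : 0 < H.
Notation mu := (@lebesgue_measure R).
Local Notation carc := (carc H).
Local Notation hw := (hw H).
Implicit Types (s t : R).

Lemma affine_subst (c r : R) (G : R -> R) : 0 < c -> 0 < r ->
  (forall x, H - r * c <= x <= H + r * c -> {for x, continuous G}) ->
  (\int[mu]_(x in `[(H - r * c)%R, (H + r * c)%R]) (G x)%:E =
   \int[mu]_(s in `[(- r)%R, r]) (G (H + s * c)%R * c)%:E)%E.
Proof.
move=> c0 r0 cG; pose F s := H + s * c.
have dF s : is_derive s (1 : R) F c.
  have := is_deriveD (is_derive_cst H s 1) (is_derive_mulR (is_derive_id s 1) (is_derive_cst c s 1)).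
  by apply: is_derive_ext => //=; ring.
have F' : (F^`())%classic = cst c by apply/funext => s; rewrite derive1E; case: (dF s).
have cF s : {for s, continuous F} by exact: is_derive_continuous (dF s).
have -> : H - r * c = F (- r) by rewrite /F mulNr.
rewrite (@integration_by_substitution_increasing _ F G (- r) r) //.
- by apply: eq_integral => s _; rewrite F'.
- by rewrite ge0_cp // ltW.
- by move=> x y _ _ xy; rewrite /F ltrD2l ltr_pM2r.
- by rewrite F' => ? _; exact: cvg_cst.
- by rewrite F'; exact: is_cvg_cst.
- by rewrite F'; exact: is_cvg_cst.
- split => [s _||]; first by case: (dF s).
    by apply: cvg_at_right_filter; exact: cF.
  by apply: cvg_at_left_filter; exact: cF.
- apply: continuous_in_subspaceT => x /set_mem /=; rewrite in_itv /= => xI.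
  by apply: cG; move: xI; rewrite /F mulNr.
Qed.

Variable Phi : R[i] -> R[i].
Hypothesis cPhi : forall z, `|Re z - H| + `|Im z| < H -> ccont Phi z.

Definition diamond : set (R * R) := [set p | `|p.1 - H| + `|p.2| < H].

Lemma diamond_open : open2 diamond.
Proof.
move=> [x y] /= xy.
exists ((H - (`|x - H| + `|y|)) / 2); first by rewrite divr_gt0 // subr_gt0.
move=> [x' y'] /= a b; rewrite /diamond /=.
have := ler_normD (x' - x) (x - H); have -> : x' - x + (x - H) = x' - H by ring.
have := ler_normD (y' - y) y; rewrite subrK.
move: a b; set u := `|x' - x|; set v := `|y' - y|; set u' := `|x' - H|.
set v' := `|y'|; set p := `|x - H| in xy *; set q := `|y| in xy *; lra.
Qed.

Lemma carc_diamond s t : `|s| < 1 -> - H < t < H -> `|Re (carc s t) - H| + `|Im (carc s t)| < H.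
Proof.
move=> s1 /andP[t1 t2]; have q0 := hw_gt0 H0 t1 t2.
rewrite /= addrAC subrr add0r normrM (gtr0_norm q0).
have tH : `|t| <= H by rewrite ler_norml !ltW.
have := hw_le H0 tH; have : `|s| * hw t < hw t by rewrite -[ltRHS]mul1r ltr_pM2r.
set a := _ * _; lra.
Qed.

(** The factor [hw p.2] is the Jacobian of [(s, t) |-> carc s t]. *)
Definition slice_density (p : R * R) := normc (Phi (carc p.1 p.2)) ^+ 2 * hw p.2.

Let I : set R := `[(- (2 / 3))%R, (2 / 3)%R].
Let J : set R := `](- H)%R, H[.

Let Istrip : I `*` J `<=` strip H.
Proof.
move=> [s t] [] /=; rewrite /I /J /= !in_itv /= => s1 t1; split => //=.
by rewrite ltr_norml; move: s1; lra.
Qed.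

Let cPhic s t : `|s| < 1 -> - H < t < H -> ccont Phi (carc s t).
Proof. by move=> s1 t1; apply: cPhi; exact: carc_diamond. Qed.

Lemma slice_density_measurable : measurable_fun (I `*` J) slice_density.
Proof.
apply: measurable_funM.
  apply: measurable_funS (slice_measurable H0 cPhic) => //.
  exact: open2_measurable (@strip_open R H).
apply: measurableT_comp; last exact: measurable_funTS measurable_snd.
by apply: continuous_measurable_fun => t; exact: is_derive_continuous (hw_diff H0 t).
Qed.

Lemma slice_density_ge0 s t : J t -> 0 <= slice_density (s, t).
Proof.
rewrite /J /= in_itv /= => /andP[t1 t2].
by rewrite mulr_ge0 ?sqr_ge0 // hw_ge0 // ltW.
Qed.

Let g p := normc (Phi (cplx p)) ^+ 2.

Lemma density_measurable : measurable_fun diamond g.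
Proof. by apply: normc2_measurable; [exact: diamond_open|move=> p Ap; exact: cPhi]. Qed.

Lemma slice_cont s t : `|s| < 1 -> - H < t < H ->
  {for s, continuous (fun s => slice_density (s, t))}.
Proof.
move=> s1 tH.
have E u : normc (Phi (carc u t)) ^+ 2 * hw t = slice_density (u, t) by [].
apply: (continuous_for_ext E).
apply: (@continuousM _ _ _ (fun=> hw t) s); last exact: cvg_cst.
apply: contR_normc2; apply: (@contR_comp _ _ (carc^~ t)); first exact: cPhic.
exact: cderiv_contR (carc_cderiv_s _ _ _).
Qed.

Lemma slice_change t : J t ->
  (\int[mu]_(s in I) (slice_density (s, t))%:E <=
   \int[mu]_x (((EFin \o g) \_ diamond) (x, t)))%E.
Proof.
rewrite /J /= in_itv /= => tH; have [t1 t2] := andP tH.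
have q0 := hw_gt0 H0 t1 t2.
have seg x : H - 2 / 3 * hw t <= x <= H + 2 / 3 * hw t -> diamond (x, t).
  move=> xI; have -> : (x, t) = (Re (carc ((x - H) / hw t) t), Im (carc ((x - H) / hw t) t)).
    by rewrite /= divfK ?gt_eqF //; congr pair; ring.
  apply: carc_diamond => //; rewrite normrM normfV (gtr0_norm q0) ltr_pdivrMr // mul1r.
  by rewrite ltr_norml; lra.
have gcont x : H - 2 / 3 * hw t <= x <= H + 2 / 3 * hw t -> {for x, continuous (fun x => g (x, t))}.
  move=> /seg xd; apply: (@contR_normc2 _ (fun x => Phi (cplx (x, t)))).
  apply: (@contR_comp _ _ (fun x => cplx (x, t))); first exact: cPhi.
  by split => /=; [exact: cvg_id|exact: cvg_cst].
have r0 : (0 : R) < 2 / 3 by [].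
have := @affine_subst (hw t) (2 / 3) (fun x => g (x, t)) q0 r0 gcont.
rewrite [X in _ = X -> _](_ : _ = (\int[mu]_(s in I) (slice_density (s, t))%:E)%E) // => <-.
rewrite integral_mkcond; apply: ge0_le_integral => //.
- move=> x _; apply: erestrict_ge0 => y _; rewrite lee_fin; exact: sqr_ge0.
- apply/(measurable_restrictT _ _).1 => //.
  apply/measurable_EFinP; apply: subspace_continuous_measurable_fun => //.
  by apply: continuous_in_subspaceT => x /set_mem /=; rewrite in_itv /=; exact: gcont.
- have mg : measurable_fun setT ((EFin \o g) \_ diamond).
    apply/(measurable_restrictT _ _).1; first exact: open2_measurable diamond_open.
    by apply/measurable_EFinP; exact: density_measurable.
  exact: measurableT_comp mg (measurable_pair2 _).
move=> x _; rewrite /patch; case: ifPn => [/set_mem /=|_].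
  rewrite in_itv /= => /seg xd; case: ifPn => //.
  by rewrite notin_setE.
by case: ifP => // _; rewrite lee_fin; exact: sqr_ge0.
Qed.

(** At each height the change of variables is affine in [s]; integrating over the
    heights gives the two-dimensional inequality. *)
Lemma slice_area :
  (\int[mu]_(t in J) \int[mu]_(s in I) (slice_density (s, t))%:E <=
   \int[mu \x mu]_(p in diamond) (g p)%:E)%E.
Proof.
have mg : measurable_fun setT ((EFin \o g) \_ diamond).
  apply/(measurable_restrictT _ _).1; first exact: open2_measurable diamond_open.
  by apply/measurable_EFinP; exact: density_measurable.
have g0 p : (0 <= ((EFin \o g) \_ diamond) p)%E.
  by apply: erestrict_ge0 => y _; rewrite lee_fin; exact: sqr_ge0.
rewrite [leRHS]integral_mkcond fubini_tonelli2 //.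
have mI : measurable I by exact: measurable_itv.
have mJ : measurable J by exact: measurable_itv.
apply: le_trans (_ : \int[mu]_(t in J) fubini_G mu ((EFin \o g) \_ diamond) t <= _)%E.
  apply: ge0_le_integral => //.
  - move=> t Jt; apply: integral_ge0 => s _; rewrite lee_fin; exact: slice_density_ge0.
  - apply: (@tonelli_measurable2 _ _ _ _ R mu I J (EFin \o slice_density)) => //.
      by apply/measurable_EFinP; exact: slice_density_measurable.
    by move=> [s t] [_ Jt]; rewrite lee_fin; exact: slice_density_ge0.
  - by apply: measurable_funTS; exact: measurable_fun_fubini_tonelli_G.
  - by move=> t Jt; exact: slice_change.
apply: ge0_subset_integral => //.
  exact: measurable_fun_fubini_tonelli_G.
by move=> t _; apply: integral_ge0.
Qed.

End ChangeOfVariables.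

Section GoodSlices.
Variables (R : realType) (H : R).
Hypothesis H0 : 0 < H.
Notation mu := (@lebesgue_measure R).
Local Notation carc := (carc H).
Local Notation hw := (hw H).
Implicit Types (s t : R).

Lemma exists_le_average (a b c : R) (phi : R -> \bar R) : a < b -> 0 <= c ->
  measurable_fun `]a, b[ phi -> (forall t, `]a, b[%classic t -> (0 <= phi t)%E) ->
  (\int[mu]_(t in `]a, b[) phi t < (c * (b - a))%:E)%E ->
  exists t, a < t < b /\ (phi t <= c%:E)%E.
Proof.
move=> ab c0 mphi phi0; apply: contraPP => /forallNP no.
apply/negP; rewrite -leNgt.
have -> : (c * (b - a))%:E = (\int[mu]_(t in `]a, b[) (cst c%:E t))%E.
  have muE : mu `]a, b[ = (b - a)%:E by rewrite lebesgue_measure_itv /= lte_fin ab.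
  by rewrite EFinM -muE; apply/esym/(integral_cst mu); exact: measurable_itv.
apply: ge0_le_integral => //.
move=> t /= tI; rewrite leNgt; apply/negP => /ltW tc; apply: (no t).
by split => //; move: tI; rewrite in_itv.
Qed.

Variable Phi : R[i] -> R[i].
Hypothesis cPhi : forall z, `|Re z - H| + `|Im z| < H -> ccont Phi z.
Local Notation sd := (slice_density H Phi).
Local Notation diamond := (diamond H).
Hypothesis fin : (\int[mu \x mu]_(p in diamond) (normc (Phi (cplx p)) ^+ 2)%:E < +oo)%E.

Let I : set R := `[(- (2 / 3))%R, (2 / 3)%R].
Let J : set R := `](- H)%R, H[.
Let mI : measurable I. Proof. exact: measurable_itv. Qed.
Let mJ : measurable J. Proof. exact: measurable_itv. Qed.
Let psi t := (\int[mu]_(s in I) (sd (s, t))%:E)%E.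

Let msd : measurable_fun (I `*` J) (EFin \o sd).
Proof. by apply/measurable_EFinP; exact: slice_density_measurable. Qed.

Let psi0 t : J t -> (0 <= psi t)%E.
Proof.
by move=> Jt; apply: integral_ge0 => s _; rewrite lee_fin; exact: slice_density_ge0.
Qed.

Let mpsi : measurable_fun J psi.
Proof.
apply: (@tonelli_measurable2 _ _ _ _ R mu I J (EFin \o sd)) => //.
by move=> [s t] [_ Jt]; rewrite lee_fin; exact: slice_density_ge0.
Qed.

Let psi_fin : (\int[mu]_(t in J) psi t < +oo)%E.
Proof. exact: le_lt_trans (slice_area H0 cPhi) fin. Qed.

Let psi_int0 : (0 <= \int[mu]_(t in J) psi t)%E.
Proof. by apply: integral_ge0 => t; exact: psi0. Qed.

(** On an interval of heights of length [h], some chord does no worse than the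
    average, which is at most [K / h]. *)
Lemma good_heights : exists K : R, 0 <= K /\ forall h : R, 0 < h -> h < H ->
  (exists T : R, H - h < T < H /\ (psi T <= (K / h)%:E)%E) /\
  (exists T : R, - H < T < - (H - h) /\ (psi T <= (K / h)%:E)%E).
Proof.
pose V := fine (\int[mu]_(t in J) psi t).
have VE : (\int[mu]_(t in J) psi t)%E = V%:E.
  by rewrite fineK // ge0_fin_numE.
have V0 : 0 <= V by rewrite fine_ge0.
exists (V + 1); split; first by rewrite addr_ge0.
move=> h h0 hH.
have K0 : 0 <= (V + 1) / h by rewrite divr_ge0 ?addr_ge0 // ltW.
have small (I' : interval R) : (I' <= `]- H, H[)%O ->
   (\int[mu]_(t in [set` I']) psi t < (V + 1)%:E)%E.
  move=> II; apply: (@le_lt_trans _ _ V%:E); last by rewrite lte_fin ltrDl ltr01.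
  rewrite -VE; apply: ge0_subset_integral => //.
  by move=> t; exact: (subitvP II).
have sub1 : (`]H - h, H[ <= `]- H, H[)%O.
  by rewrite subitvE !bnd_simp ?lexx ?andbT; lra.
have sub2 : (`]- H, (- (H - h))[ <= `]- H, H[)%O.
  by rewrite subitvE !bnd_simp ?lexx /=; lra.
split.
  apply: exists_le_average => //.
  - by rewrite ltrBlDr ltrDl.
  - apply: (measurable_funS mJ _ mpsi) => t; exact: (subitvP sub1).
  - by move=> t tI; apply: psi0; exact: (subitvP sub1).
  - have -> : (V + 1) / h * (H - (H - h)) = V + 1 by field; rewrite gt_eqF.
    exact: small.
apply: exists_le_average => //.
- by rewrite ltrN2 ltrBlDr ltrDl.
- apply: (measurable_funS mJ _ mpsi) => t; exact: (subitvP sub2).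
- by move=> t tI; apply: psi0; exact: (subitvP sub2).
- have -> : (V + 1) / h * (- (H - h) - - H) = V + 1 by field; rewrite gt_eqF.
  exact: small.
Qed.

Let msdN : measurable_fun (I `*` J) (fun p => (sd (- p.1, p.2))%:E).
Proof.
apply/measurable_EFinP; apply: measurable_funM.
  apply: (@measurable_funS _ _ _ _ (strip H)).
  - exact: open2_measurable (@strip_open R H).
  - move=> [s t] [] /=; rewrite /I /J /= !in_itv /= => s1 t1; split => //=.
    by rewrite ltr_norml; move: s1; lra.
  apply: cont2_measurable; first exact: strip_open.
  move=> [s t] [s1 tH]; apply: (@cont2_normc2 _ Phi (fun p => carc (- p.1) p.2)).
    move=> e e0.
    have pS : strip H (- s, t) by split => //=; rewrite normrN.
    have [r r0 Hr] := carc_cont2 H0 pS e0; exists r => // p' p1 p2.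
    by apply: (Hr (- p'.1, p'.2)) => //=; rewrite -opprD normrN.
  by apply: cPhi; apply: carc_diamond => //=; rewrite normrN.
apply: measurableT_comp; last exact: measurable_funTS measurable_snd.
by apply: continuous_measurable_fun => t; exact: is_derive_continuous (hw_diff H0 t).
Qed.

Let sdN t : J t -> (\int[mu]_(s in I) (sd (- s, t))%:E)%E = psi t.
Proof.
rewrite /J /= in_itv /= => tH; rewrite /psi /I.
have := @integration_by_substitution_oppr R (fun s => sd (s, t)) (- (2 / 3)) (2 / 3).
rewrite opprK => -> //; first by lra.
apply: continuous_in_subspaceT => s /set_mem /=; rewrite ?/I /= in_itv /= => sI.
by apply: slice_cont => //; rewrite ltr_norml; lra.
Qed.

(** By Tonelli the sum of the integrals over the arcs [s] and [- s] is integrable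
    in [s], hence finite for some [s] between [1/3] and [2/3]. *)
Lemma good_slice : exists s, [/\ 3^-1 <= s, s < 1, s <= 2 / 3,
  (\int[mu]_(t in J) (sd (s, t))%:E < +oo)%E &
  (\int[mu]_(t in J) (sd (- s, t))%:E < +oo)%E].
Proof.
pose ka p := ((sd p)%:E + (sd (- p.1, p.2))%:E)%E.
have mka : measurable_fun (I `*` J) ka by exact: emeasurable_funD.
have sd0 s t : J t -> (0 <= (sd (s, t))%:E)%E.
  by move=> Jt; rewrite lee_fin; exact: slice_density_ge0.
have ka0 p : (I `*` J) p -> (0 <= ka p)%E.
  by case: p => s t [_ Jt]; rewrite adde_ge0 // sd0.
have mslice s : `|s| < 1 -> measurable_fun J (fun t => (sd (s, t))%:E).
  move=> s1; apply/measurable_EFinP; apply: open_continuous_measurable_fun => //.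
  move=> t /set_mem /=; rewrite /J /= in_itv /= => tH.
  have E u : normc (Phi (carc s u)) ^+ 2 * hw u = sd (s, u) by [].
  apply: (continuous_for_ext E).
  apply: (@continuousM _ _ _ _ t); last first.
    exact: is_derive_continuous (hw_diff H0 t).
  apply: contR_normc2; apply: contR_comp; last exact: carc_contR.
  by apply: cPhi; exact: carc_diamond.
have mslice2 t : J t -> measurable_fun I (fun s => (sd (s, t))%:E) /\
    measurable_fun I (fun s => (sd (- s, t))%:E).
  rewrite /J /= in_itv /= => tH; split; apply/measurable_EFinP;
    apply: subspace_continuous_measurable_fun => //;
    apply: continuous_in_subspaceT => s /set_mem /=; rewrite ?/I /= in_itv /= => sI.
    by apply: slice_cont => //; rewrite ltr_norml; lra.
  apply: (@continuous_comp _ _ _ -%R (fun s => sd (s, t))); first exact: opp_continuous.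
  by apply: slice_cont => //; rewrite ltr_norml; lra.
have tot : (\int[mu]_(s in I) \int[mu]_(t in J) ka (s, t) < +oo)%E.
  rewrite (@tonelli_rect _ _ _ _ R mu mu I J ka mI mJ mka ka0).
  apply: (@le_lt_trans _ _ (\int[mu]_(t in J) (psi t + psi t))%E); last first.
    by rewrite ge0_integralD // lte_add_pinfty.
  rewrite le_eqVlt; apply/orP; left; apply/eqP; apply: eq_integral => t /set_mem Jt.
  have [m1 m2] := mslice2 t Jt.
  rewrite /ka ge0_integralD //.
  - by rewrite sdN.
  - by move=> s _; exact: sd0.
  - by move=> s _; exact: sd0.
pose phi s := (\int[mu]_(t in J) ka (s, t))%E.
have phi0 s : I s -> (0 <= phi s)%E by move=> Is; apply: integral_ge0 => t Jt; exact: ka0.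
have mphi : measurable_fun I phi.
  exact: (@tonelli_measurable1 _ _ _ _ R mu I J ka mI mJ mka ka0).
have sub : (`](3^-1 : R), 2 / 3[ <= `[- (2 / 3), 2 / 3])%O.
  by rewrite subitvE !bnd_simp; lra.
have tot' : (\int[mu]_(s in `]3^-1%R, (2 / 3)%R[) phi s < +oo)%E.
  apply: le_lt_trans tot; apply: ge0_subset_integral => //.
  by move=> s; exact: (subitvP sub).
pose V := fine (\int[mu]_(s in `]3^-1%R, (2 / 3)%R[) phi s).
have p0 : (0 <= \int[mu]_(s in `]3^-1%R, (2 / 3)%R[) phi s)%E.
  by apply: integral_ge0 => s sI; apply: phi0; exact: (subitvP sub).
have VE : (\int[mu]_(s in `]3^-1%R, (2 / 3)%R[) phi s)%E = V%:E.
  by rewrite fineK // ge0_fin_numE.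
have V0 : 0 <= V by rewrite fine_ge0.
have [s [/andP[s1 s2] sV]] : exists s, 3^-1 < s < 2 / 3 /\ (phi s <= (3 * (V + 1))%:E)%E.
  apply: exists_le_average => //.
  - by lra.
  - by rewrite mulr_ge0 // addr_ge0.
  - apply: (measurable_funS mI _ mphi) => s; exact: (subitvP sub).
  - by move=> s sI; apply: phi0; exact: (subitvP sub).
  - by rewrite VE lte_fin; lra.
have Is : I s by apply: (subitvP sub); rewrite in_itv /= s1.
have phifin : (phi s < +oo)%E by apply: le_lt_trans sV _; exact: ltry.
have sn1 : `|s| < 1 by rewrite ltr_norml; lra.
move: phifin; rewrite /phi /ka ge0_integralD //; first last.
- by apply: (mslice (- s)); rewrite normrN.
- by move=> t; exact: sd0.
- exact: (mslice s).
- by move=> t; exact: sd0.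
move=> fin2; exists s; split; [exact: ltW|by lra|exact: ltW| |].
  apply: le_lt_trans fin2; rewrite leeDl //.
  by apply: integral_ge0 => t; exact: sd0.
apply: le_lt_trans fin2; rewrite leeDr //.
by apply: integral_ge0 => t; exact: sd0.
Qed.

End GoodSlices.

Section WeightedBound.
Variables (R : realType) (H : R).
Hypothesis H0 : 0 < H.
Notation mu := (@lebesgue_measure R).
Local Notation carc := (carc H).
Local Notation dcarc := (dcarc H).
Local Notation hw := (hw H).
Implicit Types (s t : R).
Variables F Phi : R[i] -> R[i].
Variable C : R.
Hypothesis C0 : 0 <= C.
Hypothesis hF : arc_holo H F.
Hypothesis cPhi : forall z, `|Re z - H| + `|Im z| < H -> ccont Phi z.
Hypothesis FPhi : forall s t, `|s| < 1 -> - H < t < H ->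
  normc (F (carc s t)) ^+ 2 <= C * normc (Phi (carc s t)) ^+ 2 * hw t ^+ 2.
Local Notation sd := (slice_density H Phi).

(** The two factors [hw] gained in passing from [Phi] to [F] turn the Jacobian
    [hw] into the weight [(hw t)^-1] of [arc_l2]. *)
Lemma arc_l2_of s : `|s| < 1 ->
  (\int[mu]_(t in `](- H)%R, H[) (sd (s, t))%:E < +oo)%E -> arc_l2 H F s.
Proof.
move=> s1 fin.
have cF t : - H < t < H -> contR (fun u => F (carc s u)) t.
  by move=> tH; exact: arcF_contR.
have cP t : - H < t < H -> contR (fun u => Phi (carc s u)) t.
  move=> tH; apply: contR_comp; last exact: carc_contR.
  by apply: cPhi; exact: carc_diamond.
have chw t : {for t, continuous hw}.
  exact: is_derive_continuous (hw_diff H0 t).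
have isd : mu.-integrable `]- H, H[ (EFin \o (fun t => sd (s, t))).
  apply/integrableP; split.
    apply/measurable_EFinP; apply: open_continuous_measurable_fun => // t /set_mem /=.
    rewrite in_itv /= => tH.
    have E u : normc (Phi (carc s u)) ^+ 2 * hw u = sd (s, u) by [].
    apply: (continuous_for_ext E); apply: (@continuousM _ _ _ _ t); last exact: chw.
    by apply: contR_normc2; exact: cP.
  apply: le_lt_trans fin; rewrite le_eqVlt; apply/orP; left; apply/eqP.
  apply: eq_integral => t /set_mem /= tI; congr EFin; rewrite ger0_norm //.
  exact: slice_density_ge0.
have isC := integrable_scale C (measurable_itv `]- H, H[) isd.
apply: le_integrable isC => //; last first.
- move=> t /=; rewrite in_itv /= => tH; have [t1 t2] := andP tH.
  have q0 := hw_gt0 H0 t1 t2.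
  rewrite lee_fin ger0_norm; last by rewrite divr_ge0 ?sqr_ge0 // ltW.
  apply: le_trans (ler_norm _); rewrite ler_pdivrMr //.
  by apply: le_trans (FPhi s1 tH) _; rewrite /slice_density /= expr2 !mulrA.
apply/measurable_EFinP; apply: open_continuous_measurable_fun => // t /set_mem /=.
rewrite in_itv /= => tH; have [t1 t2] := andP tH.
have q0 := hw_gt0 H0 t1 t2.
apply: (@continuousM _ _ _ _ t); first by apply: contR_normc2; exact: cF.
by apply: (@continuousV _ _ _ t); [rewrite gt_eqF|exact: chw].
Qed.

(** On a chord at height [T] with [hw T <= h] the mean square of [F] is at most
    [C * hw T * (K / h)]; multiplying by [hw T] leaves a bound linear in [h]. *)
Lemma heights_of s K : 0 < s -> s <= 2 / 3 -> 0 <= K ->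
  (forall h : R, 0 < h -> h < H ->
    (exists T : R, H - h < T < H /\
      (\int[mu]_(r in `[(- (2 / 3))%R, (2 / 3)%R]) (sd (r, T))%:E <= (K / h)%:E)%E) /\
    (exists T : R, - H < T < - (H - h) /\
      (\int[mu]_(r in `[(- (2 / 3))%R, (2 / 3)%R]) (sd (r, T))%:E <= (K / h)%:E)%E)) ->
  heights H F s (C * K).
Proof.
move=> s0 s23 K0 hts h h0 hH.
have key T : - H < T < H -> hw T <= h ->
    (\int[mu]_(r in `[(- (2 / 3))%R, (2 / 3)%R]) (sd (r, T))%:E <= (K / h)%:E)%E ->
    hw T * \int[mu]_(r in `[- s, s]) (normc (F (carc r T)) ^+ 2) <= C * K * h.
  move=> TH qh small; have [T1 T2] := andP TH; have q0 := hw_gt0 H0 T1 T2.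
  have isd : mu.-integrable `[- (2 / 3), 2 / 3] (EFin \o (fun r => sd (r, T))).
    by apply: cont_integrable => r rI; apply: slice_cont => //; rewrite ltr_norml; lra.
  have sub : (`[- s, s] <= `[- (2 / 3), 2 / 3])%O by rewrite subitvE !bnd_simp; lra.
  have isd' := integrable_subitv sub isd.
  have ssd : \int[mu]_(r in `[- s, s]) sd (r, T) <= K / h.
    apply: le_trans (@Rintegral_subset _ _ _ _ sub isd _) _.
      by move=> r _; apply: slice_density_ge0 => //; rewrite in_itv.
    by rewrite -lee_fin fineK //; exact: integrable_fin_num.
  have iF : mu.-integrable `[- s, s] (EFin \o (fun r => normc (F (carc r T)) ^+ 2)).
    apply: cont_integrable => r rI; apply: contR_normc2.
    apply: (@contR_comp _ _ (carc^~ T)).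
      by apply: holo_ccont; apply: hF => //; rewrite ltr_norml; lra.
    exact: cderiv_contR (carc_cderiv_s _ _ _).
  have le : \int[mu]_(r in `[- s, s]) (normc (F (carc r T)) ^+ 2) <= C * hw T * (K / h).
    apply: le_trans (_ : \int[mu]_(r in `[- s, s]) (C * hw T * sd (r, T)) <= _).
      apply: le_Rintegral => //; first exact: integrable_scale.
      move=> r /=; rewrite in_itv /= => rI; apply: le_trans (FPhi _ TH) _.
        by rewrite ltr_norml; lra.
      rewrite /slice_density /= le_eqVlt; apply/orP; left; apply/eqP; ring.
    rewrite RintegralZl // ler_wpM2l // mulr_ge0 // ltW //.
  apply: le_trans (ler_wpM2l (ltW q0) le) _.
  have -> : hw T * (C * hw T * (K / h)) = C * K * (hw T * hw T / h) by ring.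
  rewrite ler_wpM2l ?mulr_ge0 // ler_pdivrMr //.
  by rewrite ler_pM // ltW.
have [[T [TT smallT]] [B [BB smallB]]] := hts h h0 hH.
have [T1 T2] := andP TT; have [B1 B2] := andP BB.
have TH : - H < T < H by lra.
have BH : - H < B < H by lra.
split; [exists T; split => //; apply: key => //|exists B; split => //; apply: key => //].
  apply: le_trans (hw_le H0 _) _; first by rewrite ler_norml; lra.
  by rewrite gtr0_norm; lra.
apply: le_trans (hw_le H0 _) _; first by rewrite ler_norml; lra.
by rewrite ltr0_norm; lra.
Qed.

End WeightedBound.

(** * Poisson kernels along an arc *)

Section SquareIntegrability.
Variables (R : realType) (H : R).
Hypothesis H0 : 0 < H.
Notation mu := (@lebesgue_measure R).
Local Notation carc := (carc H).
Local Notation dcarc := (dcarc H).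
Local Notation hw := (hw H).
Implicit Types (s t : R).

Lemma integral_oneDsqr : (\int[mu]_u ((oneDsqr u)^-1)%:E = (pi : R)%:E)%E.
Proof.
rewrite ge0_symfun_integralT.
- rewrite (_ : [set x | (0 <= x)%R] = `[0, +oo[%classic); last by rewrite set_itvE.
  by rewrite integral0y_oneDsqr -EFinM mulrC divfK.
- by move=> x; rewrite invr_ge0 (le_trans ler01) // oneDsqr_ge1.
- exact: continuous_oneDsqrV.
- by move=> x; rewrite /= /oneDsqr sqrrN.
Qed.

Lemma integral_poisson (a t : R) : 0 < a ->
  (\int[mu]_y (a / (a ^+ 2 + (y - t) ^+ 2))%:E = (pi : R)%:E)%E.
Proof.
move=> a0; pose F (y : R) := (y - t) / a.
have dF y : is_derive y (1 : R) F a^-1.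
  have := is_derive_mulR (is_deriveB (is_derive_id y 1) (is_derive_cst t y 1)) (is_derive_cst a^-1 y 1).
  by apply: is_derive_ext => //=; ring.
have F' : (F^`())%classic = cst a^-1 by apply/funext => s; rewrite derive1E; case: (dF s).
rewrite -integral_oneDsqr (@increasing_ge0_integration_by_substitutionT R F (fun u => (oneDsqr u)^-1)).
- apply: eq_integral => y _; congr EFin; rewrite F'.
  have n0 : a ^+ 2 + (y - t) ^+ 2 != 0.
    by rewrite gt_eqF // ltr_pwDl ?sqr_ge0 // exprn_gt0.
  transitivity ((1 + ((y - t) / a) ^+ 2)^-1 * a^-1) => //.
  by field; rewrite gt_eqF //= n0.
- by move=> x y xy; rewrite ltr_pM2r ?invr_gt0 // ltrD2r.
- by rewrite F' => ?; exact: cvg_cst.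
- by rewrite F'; exact: is_cvg_cst.
- by rewrite F'; exact: is_cvg_cst.
- by move=> x; case: (dF x).
- apply/cvgrNyPle => A; near=> y; rewrite ler_pdivrMr // lerBlDr.
  near: y; apply: nbhs_ninfty_le; exact: num_real.
- apply/cvgryPge => A; near=> y; rewrite ler_pdivlMr // lerBrDr.
  near: y; apply: nbhs_pinfty_ge; exact: num_real.
- exact: continuous_oneDsqrV.
- by move=> x; rewrite invr_ge0 (le_trans ler01) // oneDsqr_ge1.
Unshelve. all: end_near. Qed.

Variable r : R.
Hypothesis r3 : 3^-1 <= `|r|.
Hypothesis r1 : `|r| < 1.

Let J : set R := `](- H)%R, H[.

(** Up to the factor [`|r|], this is in [p.1] the Poisson kernel of width
    [`|r| * hw p.2] centred at [p.2]. *)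
Definition kern (p : R * R) := hw p.2 / ((r * hw p.2) ^+ 2 + (p.2 - p.1) ^+ 2).

Let rhw2 t : - H < t < H -> 0 < (r * hw t) ^+ 2.
Proof.
move=> /andP[t1 t2]; rewrite exprn_even_gt0 //= mulf_neq0 //.
  by rewrite -normr_gt0; apply: lt_le_trans r3; rewrite invr_gt0.
by rewrite gt_eqF // hw_gt0.
Qed.

Let kden t y : - H < t < H -> 0 < (r * hw t) ^+ 2 + (t - y) ^+ 2.
Proof. by move=> /rhw2 h; rewrite ltr_pwDl ?sqr_ge0. Qed.

Lemma kern_ge0 y t : J t -> 0 <= kern (y, t).
Proof.
rewrite /J /= in_itv /= => tH; have [t1 t2] := andP tH.
by rewrite divr_ge0 ?hw_ge0 ?ltW // kden.
Qed.

Lemma kern_measurable : measurable_fun ([set: R] `*` J) kern.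
Proof.
have oS : open2 ([set: R] `*` J).
  move=> [y t] [_]; rewrite /J /= in_itv /= => /andP[t1 t2].
  exists (Num.min (t + H) (H - t)); first by rewrite lt_min subr_gt0 t2 -ltrBlDr sub0r t1.
  move=> [y' t'] /= _; rewrite lt_min => /andP[b1 b2]; split => //.
  rewrite /= in_itv /=; move: b1 b2; rewrite !ltr_norml => /andP[b1 b2] /andP[c1 c2].
  by apply/andP; split; lra.
have E p : kern p = hw p.2 * normc ((r * hw p.2 +i* (p.2 - p.1))^-1) ^+ 2.
  by rewrite /kern normcV exprVn normcE2.
rewrite (_ : kern = fun p => hw p.2 * normc ((r * hw p.2 +i* (p.2 - p.1))^-1) ^+ 2); last first.
  exact/funext.
apply: measurable_funM.
  apply: measurableT_comp; last exact: measurable_funTS measurable_snd.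
  by apply: continuous_measurable_fun => t; exact: is_derive_continuous (hw_diff H0 t).
apply: cont2_measurable => // p pS.
apply: (@cont2_normc2 _ (fun w => w^-1) (fun p => r * hw p.2 +i* (p.2 - p.1))).
  move=> e e0; have [d d0 Hd] := oS p pS.
  exists (Num.min d (e / 4)); first by rewrite lt_min d0 divr_gt0.
  move=> p'; rewrite !lt_min => /andP[a1 a2] /andP[b1 b2].
  have [_ J'] := Hd p' a1 b1; have [_ Jp] := pS.
  have Jin u : J u -> - H < u /\ u < H by rewrite /J /= in_itv /= => /andP.
  have [t1 t2] := Jin _ J'; have [t3 t4] := Jin _ Jp.
  apply: le_lt_trans (normc_ReIm _) _; rewrite cReD cImD cReN cImN /=.
  have l1 : `|r * hw p'.2 - r * hw p.2| <= `|p'.2 - p.2|.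
    rewrite -mulrBr normrM -[leRHS]mul1r ler_pM ?(ltW r1) //.
    by apply: hw_lip => //; exact: ltW.
  have l2 : `|p'.2 - p'.1 - (p.2 - p.1)| <= `|p'.2 - p.2| + `|p'.1 - p.1|.
    have -> : p'.2 - p'.1 - (p.2 - p.1) = (p'.2 - p.2) - (p'.1 - p.1) by ring.
    exact: ler_normB.
  lra.
apply: holo_ccont; apply: holoV; last exact: holo_id.
have [_] := pS; rewrite /J /= in_itv /= => tH.
by rewrite -normc_eq0 -sqrf_eq0 normcE2 /= gt_eqF // kden.
Qed.

Definition kernI y := (\int[mu]_(t in J) (kern (y, t))%:E)%E.

Let mJ : measurable J. Proof. exact: measurable_itv. Qed.

Lemma kernI_ge0 y : (0 <= kernI y)%E.
Proof. by apply: integral_ge0 => t Jt; rewrite lee_fin; exact: kern_ge0. Qed.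

Lemma kernI_measurable : measurable_fun setT kernI.
Proof.
apply: (@tonelli_measurable1 _ _ _ _ R mu setT J (EFin \o kern)) => //.
  by apply/measurable_EFinP; exact: kern_measurable.
by move=> [y t] [_ Jt]; rewrite lee_fin; exact: kern_ge0.
Qed.

(** Integrating in [y] first, each [t] contributes [pi / `|r|]. *)
Lemma kernI_integral : (\int[mu]_y kernI y < +oo)%E.
Proof.
have mk : measurable_fun ([set: R] `*` J) (EFin \o kern).
  by apply/measurable_EFinP; exact: kern_measurable.
have k0 p : ([set: R] `*` J) p -> (0 <= (EFin \o kern) p)%E.
  by case: p => y t [_ Jt]; rewrite lee_fin; exact: kern_ge0.
have := @tonelli_rect _ _ _ _ R mu mu setT J (EFin \o kern) measurableT mJ mk k0.
rewrite /kernI => ->.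
have r0 : 0 < `|r| by apply: lt_le_trans r3; rewrite invr_gt0.
apply: (@le_lt_trans _ _ (\int[mu]_(t in J) (cst (pi / `|r|)%:E t))%E); last first.
  have muJ : mu J = (H - - H)%:E.
    by rewrite lebesgue_measure_itv /= lte_fin ifT // ltrNl (lt_trans _ H0) // oppr_lt0.
  have -> : (\int[mu]_(t in J) (cst (pi / `|r|)%:E t))%E = (pi / `|r| * (H - - H))%:E.
    by rewrite [RHS]EFinM -muJ; exact: (integral_cst mu mJ).
  exact: ltry.
apply: ge0_le_integral => //.
- by move=> t Jt; apply: integral_ge0 => y _; exact: (k0 (y, t)).
- exact: (@tonelli_measurable2 _ _ _ _ R mu setT J (EFin \o kern) measurableT mJ mk k0).
move=> t Jt; move: (Jt); rewrite /J /= in_itv /= => tH; have [t1 t2] := andP tH.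
have q0 := hw_gt0 H0 t1 t2.
have a0 : 0 < `|r| * hw t by rewrite mulr_gt0.
pose P y := (`|r| * hw t / ((`|r| * hw t) ^+ 2 + (y - t) ^+ 2))%:E.
have P0 y : (0 <= P y)%E by rewrite lee_fin divr_ge0 ?(ltW a0) // addr_ge0 ?sqr_ge0.
have mP : measurable_fun setT P.
  apply/measurable_EFinP; apply: continuous_measurable_fun => y.
  apply: (@continuousM _ _ _ _ y); first exact: cvg_cst.
  apply: (@continuousV _ _ _ y); first by rewrite gt_eqF // ltr_pwDl ?sqr_ge0 // exprn_gt0.
  apply: (@continuousD _ _ _ _ _ y); first exact: cvg_cst.
  apply: (@continuousM _ _ _ _ y);
    by apply: (@continuousB _ _ _ _ _ y); [exact: cvg_id|exact: cvg_cst].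
have PE : (pi / `|r|)%:E = (\int[mu]_y ((`|r|^-1)%:E * P y))%E.
  rewrite ge0_integralZl ?lee_fin ?invr_ge0 //.
  by rewrite integral_poisson // -EFinM mulrC.
rewrite [leRHS]PE.
rewrite le_eqVlt; apply/orP; left; apply/eqP; apply: eq_integral => y _.
rewrite /P -EFinM /kern /=; congr EFin.
have -> : (`|r| * hw t) ^+ 2 = (r * hw t) ^+ 2 by rewrite !exprMn real_normK ?num_real.
have -> : (t - y) ^+ 2 = (y - t) ^+ 2 by rewrite -sqrrN opprB.
have kd : (r * hw t) ^+ 2 + (y - t) ^+ 2 != 0 by rewrite -(sqrrN (y - t)) opprB gt_eqF // kden.
have rn : `|r| != 0 by rewrite gt_eqF.
by field; rewrite rn andbT; exact: kd.
Qed.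

End SquareIntegrability.

(** * Mean square of a Cauchy integral *)

(** The best [la] is [X / A].  In this form, Cauchy-Schwarz for integrals only
    asks for the pointwise inequality of arithmetic and geometric means. *)
Lemma cauchy_schwarz_amgm (R : realType) (X A B : R) : 0 <= X -> 0 <= A -> 0 <= B ->
  (forall la, 0 < la -> 2 * X <= la * A + B / la) -> X ^+ 2 <= A * B.
Proof.
move=> X0 A0 B0 h; have [->|XN] := eqVneq X 0; first by rewrite expr0n mulr_ge0.
have Xp : 0 < X by rewrite lt_neqAle eq_sym XN.
have [A00|AN] := eqVneq A 0.
  have l0 : 0 < (B + 1) / X by rewrite divr_gt0 // ltr_wpDl.
  have := h _ l0; rewrite A00 mulr0 add0r invf_div mulrA ler_pdivlMr ?ltr_wpDl //.
  have := mulr_ge0 (ltW Xp) B0; nra.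
have Ap : 0 < A by rewrite lt_neqAle eq_sym AN.
have := h _ (divr_gt0 Xp Ap); rewrite divfK // invf_div => h'.
have : X <= B * (A / X) by lra.
by rewrite mulrA ler_pdivlMr // -expr2 (mulrC B).
Qed.

Section Pointwise.
Variables (R : realType) (H : R).
Hypothesis H0 : 0 < H.
Notation mu := (@lebesgue_measure R).
Local Notation carc := (carc H).
Local Notation dcarc := (dcarc H).
Local Notation hw := (hw H).
Implicit Types (s t : R).
Variables (F : R[i] -> R[i]) (r : R).
Hypothesis hF : arc_holo H F.
Hypothesis r3 : 3^-1 <= `|r|.
Hypothesis r1 : `|r| < 1.
Hypothesis lF : arc_l2 H F r.

Lemma cauchyI_holo z d : 0 < d -> separated_by (- H) H (carc r) z d ->
  holo_at (cauchyI H F r) z.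
Proof.
move=> d0 sep; eexists; apply: ctransform_cdiff d0 sep => //.
- by move=> t _; exact: carc_contR.
- by move=> t tH; apply: contRM; [exact: arcF_contR|exact: dcarc_contR].
- exact: arc_density_integrable.
Qed.

(** The hypothesis says that [z] and the arc are on opposite sides of the axis
    [x = H], so the horizontal distances to the axis add up. *)
Lemma opposite_le z t : r * (Re z - H) <= 0 -> - H < t < H ->
  (r * hw t) ^+ 2 + (t - Im z) ^+ 2 <= normc (carc r t - z) ^+ 2 /\
  `|Re z - H| <= normc (carc r t - z).
Proof.
move=> rz /andP[t1 t2]; have q0 := hw_gt0 H0 t1 t2.
have rq : 0 <= - (r * (Re z - H)) * hw t by rewrite mulr_ge0 ?oppr_ge0 // ltW.
have E : normc (carc r t - z) ^+ 2 = (r * hw t - (Re z - H)) ^+ 2 + (t - Im z) ^+ 2.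
  rewrite normcE2 cReD cImD cReN cImN /=; congr (_ ^+ 2 + _); ring.
split.
  rewrite E lerD2r; have := sqr_ge0 (Re z - H); nra.
rewrite -(ler_pXn2r (n := 2)) ?nnegrE ?normc_ge0 // real_normK ?num_real // E.
have := sqr_ge0 (t - Im z); have := sqr_ge0 (r * hw t); nra.
Qed.

Lemma opposite_separated z : r * (Re z - H) <= 0 ->
  separated_by (- H) H (carc r) z `|Re z - H|.
Proof. by move=> rz t tH; case: (opposite_le rz tH). Qed.

(** Cauchy-Schwarz between [`|F|^2 / hw] and [hw / `|carc r t - z|^2]; the latter is
    at most [kern] by [opposite_le].  Of the constant [16 = (2 * 2) ^+ 2], one
    factor bounds [dcarc] and the other comes from [cint_norm_le]. *)
Lemma cauchyI_sq z d : 0 < d -> separated_by (- H) H (carc r) z d ->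
  r * (Re z - H) <= 0 ->
  ((normc (cauchyI H F r z) ^+ 2)%:E <=
   (16 * \int[mu]_(t in `]- H, H[) (normc (F (carc r t)) ^+ 2 / hw t))%:E * kernI H r (Im z))%E.
Proof.
move=> d0 sep rz.
have mJ : measurable (`]- H, H[%classic : set R) by exact: measurable_itv.
have cF t : - H < t < H -> contR (fun u => F (carc r u)) t by move=> tH; exact: arcF_contR.
have cN t : - H < t < H -> {for t, continuous (fun u => normc (carc r u - z))}.
  by move=> tH; apply: contR_normc; apply: contRB; [exact: carc_contR|exact: contR_cst].
have chw t : {for t, continuous hw}.
  exact: is_derive_continuous (hw_diff H0 t).
have N0 t : - H < t < H -> 0 < normc (carc r t - z).
  by move=> tH; apply: lt_le_trans d0 _; exact: sep.
pose a t := normc (F (carc r t)) ^+ 2 / hw t.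
pose b t := hw t / normc (carc r t - z) ^+ 2.
pose x t := normc (F (carc r t)) / normc (carc r t - z).
have q0 t : - H < t < H -> 0 < hw t by move=> /andP[]; exact: hw_gt0.
have cb t : - H < t < H -> {for t, continuous b}.
  move=> tH; apply: (@continuousM _ _ _ _ t); first exact: chw.
  apply: (@continuousV _ _ _ t); first by rewrite sqrf_eq0 gt_eqF // N0.
  by apply: (@continuousM _ _ _ _ t); exact: cN.
have cx t : - H < t < H -> {for t, continuous x}.
  move=> tH; apply: (@continuousM _ _ _ _ t); first exact: contR_normc (cF t tH).
  by apply: (@continuousV _ _ _ t); [rewrite gt_eqF // N0|exact: cN].
have mc (k : R -> R) : (forall t, - H < t < H -> {for t, continuous k}) ->
    measurable_fun `]- H, H[ (EFin \o k).
  move=> ck; apply/measurable_EFinP; apply: open_continuous_measurable_fun => // t /set_mem /=.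
  by rewrite in_itv /=; exact: ck.
have ib : mu.-integrable `]- H, H[ (EFin \o b).
  apply: le_integrable (oo_cst_integrable (- H) H (H / d ^+ 2)) => //; first exact: mc.
  move=> t /=; rewrite in_itv /= => tH; rewrite lee_fin.
  rewrite ger0_norm; last by rewrite divr_ge0 ?sqr_ge0 // ltW // q0.
  apply: le_trans (ler_norm _); rewrite ler_pM ?(ltW (q0 t tH)) ?hw_leH //.
    by rewrite invr_ge0 sqr_ge0.
  by rewrite lef_pV2 ?posrE ?exprn_gt0 ?N0 // lerXn2r ?nnegrE ?(ltW d0) ?normc_ge0 // sep.
have xab t : - H < t < H -> forall la, 0 < la -> 2 * x t <= la * a t + la^-1 * b t.
  move=> tH la la0; have q := q0 t tH; have n := N0 t tH; rewrite /x /a /b.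
  set f := normc _; set N := normc _ in n *.
  rewrite -subr_ge0.
  have -> : la * (f ^+ 2 / hw t) + la^-1 * (hw t / N ^+ 2) - 2 * (f / N) =
     (la * f - hw t / N) ^+ 2 / (la * hw t).
    by field; rewrite !gt_eqF.
  by rewrite divr_ge0 ?sqr_ge0 // mulr_ge0 // ltW.
have ia : mu.-integrable `]- H, H[ (EFin \o a) by exact: lF.
have iab la : mu.-integrable `]- H, H[ (EFin \o (fun t => la * a t + la^-1 * b t)).
  rewrite (_ : _ \o _ = ((EFin \o (fun t => (la * a t)%R))
      \+ (EFin \o (fun t => (la^-1 * b t)%R)))%E); last by apply/funext => t /=; rewrite EFinD.
  by apply: integrableD => //; exact: integrable_scale.
have x0 t : 0 <= x t by rewrite divr_ge0 ?normc_ge0.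
have ix : mu.-integrable `]- H, H[ (EFin \o x).
  apply: le_integrable (iab 1) => //; first exact: mc.
  move=> t /=; rewrite in_itv /= => tH; rewrite lee_fin ger0_norm //.
  apply: le_trans (ler_norm _); apply: le_trans (xab t tH 1 ltr01).
  by have := x0 t; lra.
set A := \int[mu]_(t in `]- H, H[) a t.
pose B := \int[mu]_(t in `]- H, H[) b t.
pose X := \int[mu]_(t in `]- H, H[) x t.
have A0 : 0 <= A.
  apply: Rintegral_ge0 => t; rewrite /= in_itv /= => tH.
  by rewrite divr_ge0 ?sqr_ge0 // ltW // q0.
have B0 : 0 <= B.
  apply: Rintegral_ge0 => t; rewrite /= in_itv /= => tH.
  by rewrite divr_ge0 ?sqr_ge0 // ltW // q0.
have X0 : 0 <= X by apply: Rintegral_ge0.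
have cs : X ^+ 2 <= A * B.
  apply: cauchy_schwarz_amgm => // la la0.
  rewrite -RintegralZl //.
  have -> : la * A + B / la = \int[mu]_(t in `]- H, H[) (la * a t + la^-1 * b t).
    rewrite RintegralD //; [|exact: integrable_scale|exact: integrable_scale].
    by rewrite !RintegralZl // (mulrC B).
  apply: le_Rintegral => //; first exact: integrable_scale.
  by move=> t /=; rewrite in_itv /= => tH; exact: xab.
have IX : normc (cauchyI H F r z) <= 4 * X.
  have -> : 4 * X = 2 * \int[mu]_(t in `]- H, H[) (2 * x t).
    by rewrite RintegralZl // -/X; ring.
  apply: cint_norm_le => //.
  - apply: (@pole_integrable _ (- H) H (carc r) (fun t => F (carc r t) * dcarc r t)) d0 sep.
    + by move=> t _; exact: carc_contR.
    + by move=> t tH; apply: contRM; [exact: cF|exact: dcarc_contR].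
    + exact: arc_density_integrable.
  - exact: integrable_scale.
  move=> t /=; rewrite in_itv /= => tH; have [t1 t2] := andP tH.
  rewrite !normcM normcV /x mulrA ler_wpM2r ?invr_ge0 ?normc_ge0 // mulrC.
  rewrite ler_wpM2r ?normc_ge0 //; apply: dcarc_le => //; exact: ltW.
have BK : (B%:E <= kernI H r (Im z))%E.
  rewrite /B /Rintegral fineK; last exact: integrable_fin_num.
  have bk t : - H < t < H -> b t <= kern H r (Im z, t).
    move=> tH; have [le _] := opposite_le rz tH.
    rewrite /b /kern /= ler_wpM2l ?(ltW (q0 t tH)) // lef_pV2 ?posrE //.
      by rewrite exprn_gt0 // N0.
    rewrite ltr_pwDl ?sqr_ge0 // exprn_even_gt0 //= mulf_neq0 //.
      by rewrite -normr_gt0; apply: lt_le_trans r3; rewrite invr_gt0.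
    by rewrite gt_eqF // q0.
  apply: ge0_le_integral => //.
  - move=> t /=; rewrite in_itv /= => tH; rewrite lee_fin.
    by rewrite divr_ge0 ?sqr_ge0 // ltW // q0.
  - exact: mc.
  - apply: mc => t tH; apply: (@continuousM _ _ _ _ t); first exact: chw.
    apply: (@continuousV _ _ _ t).
      rewrite /= gt_eqF // ltr_pwDl ?sqr_ge0 // exprn_even_gt0 //= mulf_neq0 //.
        by rewrite -normr_gt0; apply: lt_le_trans r3; rewrite invr_gt0.
      by rewrite gt_eqF // q0.
    apply: (@continuousD _ _ _ _ _ t); apply: (@continuousM _ _ _ _ t).
    + by apply: (@continuousM _ _ _ _ t); [exact: cvg_cst|exact: chw].
    + by apply: (@continuousM _ _ _ _ t); [exact: cvg_cst|exact: chw].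
    + by apply: (@continuousB _ _ _ _ _ t); [exact: cvg_id|exact: cvg_cst].
    + by apply: (@continuousB _ _ _ _ _ t); [exact: cvg_id|exact: cvg_cst].
apply: (@le_trans _ _ ((16 * A)%:E * B%:E)%E); last first.
  by rewrite lee_wpmul2l // lee_fin mulr_ge0.
rewrite -EFinM lee_fin.
apply: le_trans (_ : (4 * X) ^+ 2 <= _).
  by rewrite lerXn2r ?nnegrE ?normc_ge0 // mulr_ge0.
by rewrite exprMn -mulrA; have := cs; lra.
Qed.

End Pointwise.

(** * The two summands *)

Section Halves.
Variables (R : realType) (H : R).
Hypothesis H1 : 1 <= H.
Notation mu := (@lebesgue_measure R).
Local Notation carc := (carc H).
Local Notation hw := (hw H).
Let H0 : 0 < H. Proof. exact: lt_le_trans ltr01 H1. Qed.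

Variables (F : R[i] -> R[i]) (s : R).
Hypothesis hF : forall z, `|Re z - H| + `|Im z| < H -> holo_at F z.
Hypothesis s3 : 3^-1 <= s.
Hypothesis s1 : s < 1.
Hypothesis lF : arc_l2 H F s.
Hypothesis lFN : arc_l2 H F (- s).
Variable n : R[i].
Hypothesis n0 : n != 0.
Hypothesis repr : forall z, middle H z ->
  cauchyI H F s z - cauchyI H F (- s) z = F z * n.

Definition pole : R[i] := H +i* (2 * H).

(** For [sg = 1], the summand on the sector open to the right; for [sg = -1] its
    mirror image.  Seen from the vertex of the sector, beyond the axis [x = H] it
    is built from the Cauchy integral over the arc that precedes the axis, and
    before the axis from [F] and the Cauchy integral over the arc that follows
    it.  In both cases the arc and [z] are on opposite sides of the axis, and
    the two expressions agree around the axis by Cauchy's formula. *)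
Definition summand (sg : R) (z : R[i]) :=
  (if sg * (Re z - H) < 0 then F z - sg%:C * cauchyI H F (sg * s) z / n
   else - sg%:C * cauchyI H F (- sg * s) z / n) / (pole - z).

Definition omega (sg : R) (z : R[i]) := `|Im z| < H + sg * (Re z - H).

Let s0 : 0 < s. Proof. by apply: lt_le_trans s3; rewrite invr_gt0. Qed.

Let aF : arc_holo H F.
Proof. by move=> r t r1 tH; apply: hF; exact: carc_diamond. Qed.

Let sgs (sg r : R) : `|sg| = 1 -> r = sg * s \/ r = - sg * s -> 3^-1 <= `|r| /\ `|r| < 1.
Proof.
by move=> sg1 [] ->; rewrite normrM ?normrN sg1 mul1r (gtr0_norm s0).
Qed.

Let sgE (sg : R) : `|sg| = 1 -> sg = 1 \/ sg = -1.
Proof. by move/eqP; rewrite eqr_norml ler01 andbT => /orP[]/eqP; [left|right]. Qed.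

Let lsg (sg : R) : `|sg| = 1 -> arc_l2 H F (sg * s) /\ arc_l2 H F (- sg * s).
Proof. by move=> /sgE[] ->; rewrite ?opprK ?mul1r ?mulN1r. Qed.

(** In the sector, [pole] is higher than [z] by at least [H - `|Re z - H|]; hence
    either this height or [`|Re z - H|] is at least [1 / 2]. *)
Lemma pole_dist (sg : R) z : `|sg| = 1 -> omega sg z ->
  1 + (Re z - H) ^+ 2 <= 8 * normc (pole - z) ^+ 2.
Proof.
move=> sg1; rewrite /omega normcE2 cReD cImD cReN cImN /= ltr_norml => /andP[y1 y2].
have -> : (H - Re z) ^+ 2 = (Re z - H) ^+ 2 by rewrite -sqrrN opprB.
set X := Re z - H in y1 y2 *; set y := Im z in y1 y2 *.
have sX : sg * X <= `|X| by rewrite (le_trans (ler_norm _)) // normrM sg1 mul1r.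
have [X1|X1] := leP `|X| (1 / 2).
  have : 1 / 2 <= 2 * H - y by have := H1; lra.
  have := sqr_ge0 X; nra.
have X2 : `|X| ^+ 2 = X ^+ 2 by rewrite real_normK ?num_real.
have := sqr_ge0 (2 * H - y); rewrite -X2; nra.
Qed.

Lemma pole_neq (sg : R) z : `|sg| = 1 -> omega sg z -> pole - z != 0.
Proof.
move=> sg1 zo; have := pole_dist sg1 zo; apply: contraTneq => ->.
by rewrite normc0 expr0n /= mulr0 -ltNge ltr_pwDl ?sqr_ge0.
Qed.

Lemma cauchyI_holo_off (r : R) z : 3^-1 <= `|r| -> `|r| < 1 -> arc_l2 H F r ->
  r * (Re z - H) < 0 -> holo_at (cauchyI H F r) z.
Proof.
move=> r3 r1 lr rz; apply: (@cauchyI_holo _ H H0 F r aF r1 lr z `|Re z - H|).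
  rewrite normr_gt0; apply: contraTneq rz => ->; by rewrite mulr0 ltxx.
by apply: opposite_separated => //; exact: ltW.
Qed.

Lemma middle_near z : Re z = H -> `|Im z| < H -> exists2 d : R, 0 < d &
  forall w, normc (w - z) < d -> middle H w.
Proof.
move=> zx zy; have q0 : 0 < hw (Im z).
  by move: zy; rewrite ltr_norml => /andP[]; exact: hw_gt0.
exists (hw (Im z) / 12); first by rewrite divr_gt0.
move=> w wz.
have wx : `|Re w - H| < hw (Im z) / 12.
  by apply: le_lt_trans wz; rewrite -zx -cReN -cReD normc_Re.
have wy : `|Im w - Im z| < hw (Im z) / 12.
  by apply: le_lt_trans wz; rewrite -cImN -cImD normc_Im.
have qz := hw_le H0 (ltW zy).
have wyH : `|Im w| < H.
  have := ler_normD (Im w - Im z) (Im z); rewrite subrK; lra.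
split => //.
have := hw_lip H0 (t := Im z) (t' := Im w).
move: zy wyH; rewrite !ltr_norml => /andP[z1 z2] /andP[w1 w2] /(_ (ltW z1) (ltW z2) (ltW w1) (ltW w2)).
rewrite (distrC (Im z)); have := ler_norm (hw (Im z) - hw (Im w)); lra.
Qed.

(** Off the axis the definition is locally one of the two expressions.  On the
    axis, [repr] shows that both coincide in a neighbourhood. *)
Lemma summand_holo (sg : R) z : `|sg| = 1 -> omega sg z -> holo_at (summand sg) z.
Proof.
move=> sg1 zo.
have [r3 r1] := sgs sg1 (or_introl erefl).
have [r3' r1'] := sgs sg1 (or_intror erefl).
have [l1 l2] := lsg sg1.
have hp : holo_at (fun w => (pole - w)^-1) z.
  apply: holoV; first exact: pole_neq zo.
  by apply: holoB; [exact: holo_cst|exact: holo_id].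
have hc c (I : R[i] -> R[i]) : holo_at I z -> holo_at (fun w => c * I w / n) z.
  move=> hI; apply: holoM; last exact: holo_cst.
  by apply: holoM => //; exact: holo_cst.
have shift (w : R[i]) : Re w - Re z = Re (w - z) by rewrite cReD cReN.
have far (c : R) w : normc (w - z) < `|Re z - H| ->
    c * (Re z - H) < 0 -> c * (Re w - H) < 0.
  move=> wz; have := normc_Re (w - z); rewrite -shift => /le_lt_trans/(_ wz).
  have [zp|zp|->] := ltgtP (Re z - H) 0; last by rewrite mulr0 ltxx.
    rewrite (ltr0_norm zp) ltr_norml => /andP[a b].
    have wn : Re w - H < 0 by lra.
    by rewrite !nmulr_llt0.
  rewrite (gtr0_norm zp) ltr_norml => /andP[a b].
  have wn : 0 < Re w - H by lra.
  by rewrite !pmulr_llt0.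
have [neg|pos|eq] := ltgtP (sg * (Re z - H)) 0.
- have zD : `|Re z - H| + `|Im z| < H.
    have : `|Re z - H| = - (sg * (Re z - H)).
      by rewrite -(ltr0_norm neg) normrM sg1 mul1r.
    by move=> ->; rewrite addrC -ltrBrDr opprK.
  have d0 : 0 < `|Re z - H|.
    by rewrite normr_gt0; apply: contraTneq neg => ->; rewrite mulr0 ltxx.
  apply: (@holo_local _ (fun w => (F w - sg%:C * cauchyI H F (sg * s) w / n) / (pole - w)) _ _ _ d0).
    by move=> w wz; rewrite /summand (far _ _ wz neg).
  apply: holoM => //; apply: holoB; first exact: hF.
  apply: hc; apply: cauchyI_holo_off => //.
  by rewrite mulrAC nmulr_rlt0.
- have neg : - sg * (Re z - H) < 0 by rewrite mulNr oppr_lt0.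
  have d0 : 0 < `|Re z - H|.
    by rewrite normr_gt0; apply: contraTneq neg => ->; rewrite mulr0 ltxx.
  apply: (@holo_local _ (fun w => (- sg%:C * cauchyI H F (- sg * s) w / n) / (pole - w)) _ _ _ d0).
    move=> w wz; have := far _ _ wz neg; rewrite mulNr oppr_lt0 => k.
    by rewrite /summand ltNge (ltW k).
  apply: holoM => //; apply: hc; apply: cauchyI_holo_off => //.
  by rewrite mulrAC nmulr_rlt0.
- have zx : Re z = H.
    apply/eqP; rewrite -subr_eq0; move/eqP: eq; rewrite mulf_eq0 => /orP[/eqP s00|//].
    by move: sg1; rewrite s00 normr0 => /esym/eqP; rewrite oner_eq0.
  have zy : `|Im z| < H by move: zo; rewrite /omega eq addr0.
  have [d d0 mid] := middle_near zx zy.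
  apply: (@holo_local _ (fun w => (- sg%:C * cauchyI H F (- sg * s) w / n) / (pole - w)) _ _ _ d0).
    move=> w /mid wm; rewrite /summand; case: ifP => // _; congr (_ / _).
    have -> : F w = (cauchyI H F s w - cauchyI H F (- s) w) / n by rewrite repr // mulfK.
    by case: (sgE sg1) => ->; rewrite ?opprK ?mul1r ?mulN1r ?rmorphN ?rmorph1; field.
  apply: holoM => //; apply: hc.
  have mz : middle H z by apply: mid; rewrite subrr normc0.
  apply: (@cauchyI_holo _ H H0 F (- sg * s) aF r1' l2 z (hw (Im z) / 12)).
    exact: middle_hw_gt0.
  exact: middle_separated.
Qed.

Lemma summand_sum z : `|Re z - H| + `|Im z| < H ->
  summand 1 z + summand (-1) z = F z / (pole - z).
Proof.
move=> zD; rewrite /summand !mul1r !mulN1r !opprK !rmorphN !rmorph1 !mulN1r !mul1r -mulrDl.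
congr (_ / _); rewrite oppr_lt0.
have [neg|pos|eq] := ltgtP (Re z - H) 0; [ring|ring|].
have mz : middle H z.
  rewrite /middle eq normr0; move: zD; rewrite eq normr0 add0r => zy; split => //.
  move: zy; rewrite ltr_norml => /andP[a b].
  by rewrite divr_ge0 // hw_ge0 // ltW.
have -> : F z = (cauchyI H F s z - cauchyI H F (- s) z) / n by rewrite repr // mulfK.
by field.
Qed.

Lemma omega_open (sg : R) : `|sg| = 1 -> open2 [set p | omega sg (cplx p)].
Proof.
move=> sg1 [x y] /=; rewrite /omega /= => xy.
exists ((H + sg * (x - H) - `|y|) / 2); first by rewrite divr_gt0 // subr_gt0.
move=> [x' y'] /= a b.
have := ler_normD (y' - y) y; rewrite subrK.
have : `|sg * (x' - x)| = `|x' - x| by rewrite normrM sg1 mul1r.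
have -> : sg * (x' - H) = sg * (x' - x) + sg * (x - H) by ring.
have := ler_norm (- (sg * (x' - x))); rewrite normrN.
move: xy a b; set u := sg * (x - H); set v := sg * (x' - x); lra.
Qed.

(* The integrable majorant [dom] of the Cauchy integral part: [(1 + X ^+ 2)^-1]
   comes from the division by [pole - z], and [kernI] from [cauchyI_sq]. *)
Let A (r : R) := \int[mu]_(t in `]- H, H[) (normc (F (carc r t)) ^+ 2 / hw t).
Let A0 r : 0 <= A r.
Proof.
apply: Rintegral_ge0 => t; rewrite /= in_itv /= => /andP[t1 t2].
by rewrite divr_ge0 ?sqr_ge0 // hw_ge0 // ltW.
Qed.

Let c := 16 * (16 * (A s + A (- s))) / normc n ^+ 2.
Let c0 : 0 <= c.
Proof.
apply: divr_ge0; last exact: sqr_ge0.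
by rewrite !mulr_ge0 //; apply: addr_ge0; exact: A0.
Qed.

Let dom (z : R[i]) : \bar R :=
  ((c / (1 + (Re z - H) ^+ 2))%:E * kernI H s (Im z))%E.

Let kI0 y : (0 <= kernI H s y)%E.
Proof. by apply: (kernI_ge0 H0); rewrite gtr0_norm. Qed.

Let kernIE (r y : R) : `|r| = s -> kernI H r y = kernI H s y.
Proof.
move=> rs; rewrite /kernI; apply: eq_integral => t _; rewrite /kern /= !exprMn.
by rewrite -rs real_normK ?num_real.
Qed.

Lemma cauchyI_dom (sg r d : R) (u : R[i]) z : `|sg| = 1 -> omega sg z ->
  `|r| = s -> arc_l2 H F r -> r * (Re z - H) <= 0 -> 0 < d ->
  separated_by (- H) H (carc r) z d -> normc u = 1 ->
  ((2 * normc (u * cauchyI H F r z / n / (pole - z)) ^+ 2)%:E <= dom z)%E.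
Proof.
move=> sg1 zo rs lr rz d0 sep u1.
have [r3 r1] : 3^-1 <= `|r| /\ `|r| < 1 by rewrite rs.
have := cauchyI_sq H0 aF r3 r1 lr d0 sep rz; rewrite -/(A r) (kernIE _ rs) => le.
have nn : 0 < normc n ^+ 2 by rewrite exprn_gt0 // normc_gt0.
have X1 : 0 < 1 + (Re z - H) ^+ 2 by rewrite ltr_pwDl ?sqr_ge0.
have pz : 0 < normc (pole - z) ^+ 2 by rewrite exprn_gt0 // normc_gt0 // (pole_neq sg1 zo).
pose k := 16 / (normc n ^+ 2 * (1 + (Re z - H) ^+ 2)).
have k0 : 0 <= k by rewrite divr_ge0 // ltW // mulr_gt0.
apply: (@le_trans _ _ (k%:E * (normc (cauchyI H F r z) ^+ 2)%:E)%E).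
  rewrite -EFinM lee_fin !normcM !normcV u1 mul1r !exprMn !exprVn.
  set I2 := normc (cauchyI _ _ _ _) ^+ 2.
  have -> : 2 * (I2 / normc n ^+ 2 / normc (pole - z) ^+ 2) =
      2 / normc n ^+ 2 / normc (pole - z) ^+ 2 * I2 by ring.
  rewrite ler_wpM2r ?sqr_ge0 // /k.
  have -> : 16 / (normc n ^+ 2 * (1 + (Re z - H) ^+ 2)) =
    2 / normc n ^+ 2 * (8 / (1 + (Re z - H) ^+ 2)).
    by rewrite invfM; ring.
  rewrite ler_wpM2l ?divr_ge0 ?(ltW nn) // ler_pdivlMr // mulrC ler_pdivrMr //.
  exact: pole_dist sg1 zo.
apply: le_trans (lee_wpmul2l _ le) _; first by rewrite lee_fin.
rewrite muleA -EFinM /dom; apply: lee_wpmul2r; first exact: kI0.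
rewrite lee_fin.
have -> : c / (1 + (Re z - H) ^+ 2) = k * (16 * (A s + A (- s))).
  by rewrite /c /k; set n2 := normc n ^+ 2; set X2 := 1 + _; rewrite (invfM n2 X2); ring.
rewrite ler_wpM2l // ler_pM2l //.
have [->|->] : r = s \/ r = - s.
- by move/eqP: rs; rewrite eqr_norml (ltW s0) andbT => /orP[]/eqP; [left|right].
- by rewrite lerDl.
by rewrite lerDr.
Qed.

Let diamond_fin :=
  (\int[mu \x mu]_(p in diamond H) (normc (F (cplx p) / (pole - cplx p)) ^+ 2)%:E < +oo)%E.

Let f2 (p : R * R) : \bar R := (2 * normc (F (cplx p) / (pole - cplx p)) ^+ 2)%:E.

(** The term [F / (pole - z)] occurs in the diamond only, where it is square
    integrable, and [`|a + b| ^+ 2 <= 2 * `|a| ^+ 2 + 2 * `|b| ^+ 2] separates it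
    from the Cauchy integral. *)
Lemma summand_dom (sg : R) p : `|sg| = 1 -> omega sg (cplx p) ->
  ((normc (summand sg (cplx p)) ^+ 2)%:E <= (f2 \_ (diamond H)) p + dom (cplx p))%E.
Proof.
move=> sg1; set z := cplx p => zo.
have [l1 l2] := lsg sg1.
have f20 : (0 <= (f2 \_ (diamond H)) p)%E.
  by apply: erestrict_ge0 => q _; rewrite lee_fin mulr_ge0 ?sqr_ge0.
have rs1 : `|sg * s| = s by rewrite normrM sg1 mul1r gtr0_norm.
have rs2 : `|- sg * s| = s by rewrite mulNr normrN.
have u1 : normc (- sg%:C) = 1 by rewrite normc_opp normc_real sg1.
have off : sg * (Re z - H) != 0 -> 0 < `|Re z - H|.
  by move=> k; rewrite normr_gt0; apply: contraNneq k => ->; rewrite mulr0.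
have [neg|nneg] := ltP (sg * (Re z - H)) 0.
  have zD : diamond H p.
    have : `|Re z - H| = - (sg * (Re z - H)).
      by rewrite -(ltr0_norm neg) normrM sg1 mul1r.
    by rewrite /diamond /= => ->; rewrite addrC -ltrBrDr opprK.
  have rz : sg * s * (Re z - H) <= 0 by rewrite mulrAC ltW // nmulr_rlt0.
  have d0 : 0 < `|Re z - H| by apply: off; rewrite lt_eqF.
  have sep := @opposite_separated _ H H0 (sg * s) z rz.
  have J2 := cauchyI_dom sg1 zo rs1 l1 rz d0 sep u1.
  rewrite /patch mem_set //; apply: le_trans (leeD2l _ J2).
  rewrite /f2 -EFinD lee_fin /summand neg.
  have -> : (F z - sg%:C * cauchyI H F (sg * s) z / n) / (pole - z) =
     F z / (pole - z) + - sg%:C * cauchyI H F (sg * s) z / n / (pole - z).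
    by rewrite -mulrDl !mulNr.
  set a := F z / _; set b := - _ * _ / _ / _.
  apply: le_trans (_ : (normc a + normc b) ^+ 2 <= _).
    by rewrite lerXn2r ?nnegrE ?addr_ge0 ?normc_ge0 // normc_leD.
  have := sqr_ge0 (normc a - normc b); nra.
have [d d0 sep] : exists2 d : R, 0 < d & separated_by (- H) H (carc (- sg * s)) z d.
  have rz : - sg * s * (Re z - H) <= 0 by rewrite mulrAC !mulNr oppr_le0 mulr_ge0 // ltW.
  have [eq|ne] := eqVneq (sg * (Re z - H)) 0; last first.
    by exists `|Re z - H|; [exact: off|exact: (@opposite_separated _ H H0)].
  have zx : Re z = H.
    apply/eqP; rewrite -subr_eq0; move/eqP: eq; rewrite mulf_eq0 => /orP[/eqP s00|//].
    by move: sg1; rewrite s00 normr0 => /esym/eqP; rewrite oner_eq0.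
  have zy : `|Im z| < H by move: zo; rewrite /omega eq addr0.
  have [d' d'0 mid] := middle_near zx zy.
  have mz : middle H z by apply: mid; rewrite subrr normc0.
  exists (hw (Im z) / 12); first exact: middle_hw_gt0.
  by apply: middle_separated => //; rewrite rs2.
have rz : - sg * s * (Re z - H) <= 0 by rewrite mulrAC !mulNr oppr_le0 mulr_ge0 // ltW.
have J2 := cauchyI_dom sg1 zo rs2 l2 rz d0 sep u1.
apply: le_trans (leeDr _ f20); apply: le_trans J2.
rewrite lee_fin /summand ltNge nneg /=.
by rewrite -[leLHS]mul1r ler_wpM2r ?sqr_ge0 // ler1n.
Qed.

Let dom_ge0 z : (0 <= dom z)%E.
Proof.
apply: mule_ge0; last exact: kI0.
by rewrite lee_fin divr_ge0 // addr_ge0 ?sqr_ge0.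
Qed.

Let mc : measurable_fun setT (fun x : R => (c / (1 + (x - H) ^+ 2))%:E).
Proof.
apply/measurable_EFinP; apply: continuous_measurable_fun => x.
apply: (@continuousM _ _ _ _ x); first exact: cvg_cst.
apply: (@continuousV _ _ _ x); first by rewrite gt_eqF // ltr_pwDl ?sqr_ge0.
apply: (@continuousD _ _ _ _ _ x); first exact: cvg_cst.
apply: (@continuousM _ _ _ _ x);
  by apply: (@continuousB _ _ _ _ _ x); [exact: cvg_id|exact: cvg_cst].
Qed.

Let dom_measurable : measurable_fun setT (fun p : R * R => dom (cplx p)).
Proof.
apply: emeasurable_funM.
  exact: (measurableT_comp mc measurable_fst).
have s3' : 3^-1 <= `|s| by rewrite gtr0_norm.
have s1' : `|s| < 1 by rewrite gtr0_norm.
exact: (measurableT_comp (kernI_measurable H0 s3' s1') measurable_snd).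
Qed.

Let dom_fin : (\int[mu \x mu]_p dom (cplx p) < +oo)%E.
Proof.
have s3' : 3^-1 <= `|s| by rewrite gtr0_norm.
have s1' : `|s| < 1 by rewrite gtr0_norm.
have mk := kernI_measurable H0 s3' s1'.
rewrite fubini_tonelli1 //.
pose V := fine (\int[mu]_y kernI H s y).
have VE : (\int[mu]_y kernI H s y)%E = V%:E.
  rewrite fineK // ge0_fin_numE; first exact: kernI_integral.
  by apply: integral_ge0 => y _; exact: kI0.
have V0 : 0 <= V by rewrite fine_ge0 // integral_ge0 // => y _; exact: kI0.
have -> : (\int[mu]_x fubini_F mu (fun p => dom (cplx p)) x =
    \int[mu]_x ((c * V)%:E * (1 / (1 ^+ 2 + (x - H) ^+ 2))%:E))%E.
  apply: eq_integral => x _; rewrite /fubini_F /dom /= ge0_integralZl //.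
    by rewrite VE -!EFinM; congr EFin; rewrite expr1n mul1r; ring.
  by rewrite lee_fin divr_ge0 // addr_ge0 ?sqr_ge0.
rewrite ge0_integralZl //.
- by rewrite integral_poisson // -EFinM ltry.
- apply/measurable_EFinP; apply: continuous_measurable_fun => x.
  apply: (@continuousM _ _ _ _ x); first exact: cvg_cst.
  apply: (@continuousV _ _ _ x); first by rewrite gt_eqF // ltr_pwDl ?sqr_ge0 // exprn_gt0.
  apply: (@continuousD _ _ _ _ _ x); first exact: cvg_cst.
  apply: (@continuousM _ _ _ _ x);
    by apply: (@continuousB _ _ _ _ _ x); [exact: cvg_id|exact: cvg_cst].
- by move=> x _; rewrite lee_fin divr_ge0 // addr_ge0 ?sqr_ge0.
- by rewrite lee_fin mulr_ge0.
Qed.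

Lemma summand_l2 (sg : R) : `|sg| = 1 -> diamond_fin ->
  (\int[mu \x mu]_(p in [set p | omega sg (cplx p)])
     (normc (summand sg (cplx p)) ^+ 2)%:E < +oo)%E.
Proof.
move=> sg1 fin.
have mO : measurable [set p : R * R | omega sg (cplx p)].
  exact: open2_measurable (omega_open sg1).
have mD : measurable (diamond H) by exact: open2_measurable (@diamond_open R H).
have mf2 : measurable_fun (diamond H) f2.
  apply/measurable_EFinP; apply: measurable_funM => //.
  apply: (@normc2_measurable _ _ (fun z => F z / (pole - z))); first exact: diamond_open.
  move=> p pD; apply: holo_ccont; apply: holoM; first exact: hF.
  apply: holoV; last by apply: holoB; [exact: holo_cst|exact: holo_id].
  apply: (@pole_neq 1); first by rewrite normr1.
  rewrite /omega mul1r; move: pD; rewrite /diamond /= => pD.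
  by have := ler_norm (- (p.1 - H)); rewrite normrN; lra.
have mf2' : measurable_fun setT (f2 \_ (diamond H)).
  by apply/(measurable_restrictT _ _).1.
have f20 p : (0 <= (f2 \_ (diamond H)) p)%E.
  by apply: erestrict_ge0 => q _; rewrite lee_fin mulr_ge0 ?sqr_ge0.
apply: (@le_lt_trans _ _ (\int[mu \x mu]_p ((f2 \_ (diamond H)) p + dom (cplx p)))%E); last first.
  rewrite ge0_integralD //; apply: lte_add_pinfty => //.
  rewrite -integral_mkcond /f2.
  under eq_integral do rewrite EFinM.
  rewrite ge0_integralZl //.
  - by apply: lte_mul_pinfty.
  - apply/measurable_EFinP; apply: (@normc2_measurable _ _ (fun z => F z / (pole - z))); first exact: diamond_open.
    move=> p pD; apply: holo_ccont; apply: holoM; first exact: hF.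
    apply: holoV; last by apply: holoB; [exact: holo_cst|exact: holo_id].
    apply: (@pole_neq 1); first by rewrite normr1.
    rewrite /omega mul1r; move: pD; rewrite /diamond /= => pD.
    by have := ler_norm (- (p.1 - H)); rewrite normrN; lra.
  - by move=> p _; rewrite lee_fin sqr_ge0.
apply: (@le_trans _ _ (\int[mu \x mu]_(p in [set p | omega sg (cplx p)])
    ((f2 \_ (diamond H)) p + dom (cplx p)))%E).
  apply: ge0_le_integral => //.
  - by move=> p _; rewrite lee_fin sqr_ge0.
  - apply/measurable_EFinP; apply: normc2_measurable; first exact: omega_open.
    by move=> p po; apply: holo_ccont; exact: summand_holo.
  - by apply: measurable_funTS; exact: emeasurable_funD.
  - by move=> p po; exact: summand_dom.
apply: ge0_subset_integral => //; first exact: emeasurable_funD.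
by move=> p _; rewrite adde_ge0.
Qed.

End Halves.

(** * The sectors, the weight and the decomposition *)

Section Domains.
Variable R : realType.
Notation mu := (@lebesgue_measure R).
Local Notation H := (pi / 2 : R).

Lemma half_pi_ge1 : 1 <= H.
Proof. by have := pi_ge2 R; lra. Qed.

Lemma half_pi_gt0 : 0 < H. Proof. exact: lt_le_trans ltr01 half_pi_ge1. Qed.

Lemma Delta_omega z : Delta R z <-> omega H 1 z.
Proof. by rewrite DeltaE /omega mul1r addrC subrK. Qed.

Lemma pi_sub_Delta_omega z : pi_sub_Delta R z <-> omega H (-1) z.
Proof.
have E : H + -1 * (Re z - H) = pi - Re z by field.
rewrite /omega E; split=> [[u /DeltaE uD <-]|zo].
  by rewrite cReD cImD cReN cImN /= sub0r normrN; move: uD; lra.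
exists (pi%:C - z); last by rewrite opprB addrC subrK.
by apply/DeltaE; rewrite cReD cImD cReN cImN /= sub0r normrN.
Qed.

Lemma vertex0_neq z : `|Re z - H| + `|Im z| < H -> z - z0 R != 0.
Proof.
move=> zD; rewrite subr_eq0; apply: contraTneq zD => ->.
by rewrite /z0 /= subrr normr0 add0r ger0_norm ?ltxx // ltW // half_pi_gt0.
Qed.

Lemma vertex1_neq z : `|Re z - H| + `|Im z| < H -> z - z1 R != 0.
Proof.
move=> zD; rewrite subr_eq0; apply: contraTneq zD => ->.
by rewrite /z1 /z0 /= subrr normr0 add0r normrN ger0_norm ?ltxx // ltW // half_pi_gt0.
Qed.

(** The distances to the two vertices are at most [2 * (H - t)] and
    [2 * (H + t)], and [(H - t) * (H + t) = 2 * H * hw t]. *)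
Lemma vertices_arc s t : `|s| < 1 -> - H < t < H ->
  normc ((carc H s t - z0 R) * (carc H s t - z1 R)) <= 8 * H * hw H t.
Proof.
move=> s1 /andP[t1 t2]; have H0 := half_pi_gt0.
have q0 : 0 < hw H t by exact: hw_gt0.
have tH : `|t| <= H by rewrite ler_norml !ltW.
have qt := hw_le H0 tH.
have qs : `|s * hw H t| <= hw H t.
  by rewrite normrM (gtr0_norm q0) -[leRHS]mul1r ler_wpM2r ?ltW.
have a : normc (carc H s t - z0 R) <= 2 * (H - t).
  apply: le_trans (normc_ReIm _) _; rewrite cReD cImD cReN cImN /=.
  rewrite addrAC subrr add0r (@ltr0_norm _ (t - H)) ?subr_lt0 //.
  by have := ler_norm t; lra.
have b : normc (carc H s t - z1 R) <= 2 * (H + t).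
  apply: le_trans (normc_ReIm _) _; rewrite cReD cImD cReN cImN /= opprK.
  rewrite addrAC subrr add0r (@gtr0_norm _ (t + H)); last by rewrite -ltrBlDr sub0r.
  by have := ler_norm (- t); rewrite normrN; lra.
rewrite normcM; apply: le_trans (ler_pM _ _ a b) _; rewrite ?normc_ge0 //.
have := hwE H0 t; set q := hw H t; nra.
Qed.

Lemma vertices_le z : `|Re z - H| + `|Im z| < H ->
  normc ((z - z0 R) * (z - z1 R)) <= (3 * H) ^+ 2.
Proof.
move=> zD; have H0 := half_pi_gt0.
have x0 := normr_ge0 (Re z - H); have y0 := normr_ge0 (Im z).
have a : normc (z - z0 R) <= 3 * H.
  apply: le_trans (normc_ReIm _) _; rewrite cReD cImD cReN cImN /=.
  have := ler_normB (Im z) H; rewrite (gtr0_norm H0); lra.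
have b : normc (z - z1 R) <= 3 * H.
  apply: le_trans (normc_ReIm _) _; rewrite cReD cImD cReN cImN /= opprK.
  have := ler_normD (Im z) H; rewrite (gtr0_norm H0); lra.
by rewrite normcM expr2 ler_pM ?normc_ge0.
Qed.

Lemma pole_le z : `|Re z - H| + `|Im z| < H -> normc (pole H - z) <= 4 * H.
Proof.
move=> zD; have H0 := half_pi_gt0.
apply: le_trans (normc_ReIm _) _; rewrite cReD cImD cReN cImN /= distrC.
have h2 : 0 < 2 * H by rewrite mulr_gt0.
have := ler_normB (2 * H) (Im z); rewrite (gtr0_norm h2).
have := normr_ge0 (Im z); have := normr_ge0 (Re z - H); lra.
Qed.

Lemma diamond_omega z : `|Re z - H| + `|Im z| < H -> omega H 1 z.
Proof.
by rewrite /omega mul1r => zD; have := ler_norm (- (Re z - H)); rewrite normrN; lra.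
Qed.

End Domains.

Theorem theorem1p2 (R : realType) :
  bergman (D R) (fun z => normc ((z - z0 R) * (z - z1 R)) ^- 2)
    `<=` bergman_sum R.
Proof.
move=> f [fhol ffin].
pose H : R := pi / 2; have H0 : 0 < H := half_pi_gt0 R.
have H1 : 1 <= H := half_pi_ge1 R.
pose P z := (z - z0 R) * (z - z1 R).
pose F z := f z * (pole H - z).
pose Phi z := f z / P z.
have hf z : `|Re z - H| + `|Im z| < H -> holo_at f z.
  by move=> zD; apply/holo_atP; apply: fhol; exact/DE.
have hF z : `|Re z - H| + `|Im z| < H -> holo_at F z.
  move=> zD; apply: holoM; first exact: hf.
  by apply: holoB; [exact: holo_cst|exact: holo_id].
have P0 z : `|Re z - H| + `|Im z| < H -> P z != 0.
  by move=> zD; rewrite mulf_neq0 // ?vertex0_neq ?vertex1_neq.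
have hPhi z : `|Re z - H| + `|Im z| < H -> holo_at Phi z.
  move=> zD; apply: holoM; first exact: hf.
  apply: holoV; first exact: P0.
  by apply: holoM; apply: holoB; (exact: holo_id || exact: holo_cst).
have cPhi z : `|Re z - H| + `|Im z| < H -> ccont Phi z by move=> /hPhi; exact: holo_ccont.
have aF : arc_holo H F by move=> r t r1 tH; apply: hF; exact: carc_diamond.
have domE : [set p : R * R | D R (p.1 +i* p.2)] = diamond H.
  by apply/seteqP; split => p /=; [move=> /DE|move=> ?; apply/DE].
have fin : (\int[lebesgue_measure \x lebesgue_measure]_(p in diamond H)
    (normc (Phi (cplx p)) ^+ 2)%:E < +oo)%E.
  apply: le_lt_trans ffin; rewrite /area_integral domE.
  rewrite le_eqVlt; apply/orP; left; apply/eqP; apply: eq_integral => p _.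
  by congr EFin; rewrite /Phi normcM normcV exprMn exprVn.
(* This is where the weight is used: on the arcs [P] is at most of the size of [hw]. *)
have FPhi s t : `|s| < 1 -> - H < t < H ->
    normc (F (carc H s t)) ^+ 2 <= (32 * H ^+ 2) ^+ 2 * normc (Phi (carc H s t)) ^+ 2 * hw H t ^+ 2.
  move=> s1 tH; have zD := carc_diamond H0 s1 tH; set z := carc H s t in zD *.
  have q0 : 0 <= hw H t by have /andP[t1 t2] := tH; rewrite ltW // hw_gt0.
  have nn : 0 <= 32 * H ^+ 2 * normc (Phi z) * hw H t.
    apply: mulr_ge0 => //; apply: mulr_ge0; last exact: normc_ge0.
    by apply: mulr_ge0 => //; exact: sqr_ge0.
  rewrite -!exprMn; apply: lerXn2r; rewrite ?nnegrE ?normc_ge0 //.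
  have -> : F z = Phi z * (P z * (pole H - z)) by rewrite /F /Phi; field; exact: P0.
  have -> : 32 * H ^+ 2 * normc (Phi z) * hw H t = normc (Phi z) * (32 * H ^+ 2 * hw H t).
    by ring.
  rewrite normcM ler_wpM2l ?normc_ge0 // normcM.
  have -> : 32 * H ^+ 2 * hw H t = 8 * H * hw H t * (4 * H) by ring.
  by rewrite ler_pM ?normc_ge0 ?pole_le //; exact: vertices_arc.
have [s [s3 s1 s23 l1 l2]] := good_slice H0 cPhi fin.
have [K [K0 hts]] := good_heights H0 cPhi fin.
have s0 : 0 < s by apply: lt_le_trans s3; rewrite invr_gt0.
have C0 : 0 <= (32 * H ^+ 2) ^+ 2 by exact: sqr_ge0.
have as1 : `|s| < 1 by rewrite gtr0_norm.
have aNs1 : `|- s| < 1 by rewrite normrN.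
have lF := arc_l2_of H0 aF cPhi FPhi as1 l1.
have lFN := arc_l2_of H0 aF cPhi FPhi aNs1 l2.
have htF := heights_of H0 C0 aF cPhi FPhi s0 s23 K0 hts.
pose n := windex H s H%:C.
have mH : middle H H%:C.
  by rewrite /middle /= subrr !normr0; split => //; rewrite divr_ge0 // hw_ge0 // ?oppr_le0 ltW.
have n0 : n != 0 by apply: windex_neq0 => //; exact: ltW.
have repr z : middle H z -> cauchyI H F s z - cauchyI H F (- s) z = F z * n.
  move=> mz; rewrite /n -(windex_const H0 s3 mz).
  by apply: (cauchy_arcs H0 aF s3 s1 _ lF lFN htF mz); rewrite mulr_ge0.
(* On the diamond [f] itself is square integrable, the weight being bounded below
   by [vertices_le]. *)
have dfin : (\int[lebesgue_measure \x lebesgue_measure]_(p in diamond H)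
    (normc (F (cplx p) / (pole H - cplx p)) ^+ 2)%:E < +oo)%E.
  have mD : measurable (diamond H) by exact: open2_measurable (@diamond_open R H).
  have mPhi : measurable_fun (diamond H) (EFin \o (fun p => normc (Phi (cplx p)) ^+ 2)).
    apply/measurable_EFinP; apply: normc2_measurable; first exact: diamond_open.
    by move=> p pD; exact: cPhi.
  have pn z : `|Re z - H| + `|Im z| < H -> pole H - z != 0.
    by move=> /diamond_omega; apply: (pole_neq H1); rewrite normr1.
  apply: (@le_lt_trans _ _ (\int[lebesgue_measure \x lebesgue_measure]_(p in diamond H)
     ((((3 * H) ^+ 2) ^+ 2)%:E * (normc (Phi (cplx p)) ^+ 2)%:E))%E); last first.
    rewrite ge0_integralZl //.
    - by apply: lte_mul_pinfty => //; rewrite lee_fin sqr_ge0.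
    - by move=> p _; rewrite lee_fin sqr_ge0.
    - by rewrite lee_fin sqr_ge0.
  apply: ge0_le_integral => //.
  - by move=> p _; rewrite lee_fin sqr_ge0.
  - apply/measurable_EFinP; apply: (@normc2_measurable _ _ (fun z => F z / (pole H - z))).
      exact: diamond_open.
    move=> p pD; apply: holo_ccont; apply: holoM; first exact: hF.
    apply: holoV; first exact: pn.
    by apply: holoB; [exact: holo_cst|exact: holo_id].
  - exact: measurable_funeM.
  move=> p pD; rewrite -EFinM lee_fin -exprMn; apply: lerXn2r.
  - by rewrite nnegrE normc_ge0.
  - by rewrite nnegrE; apply: mulr_ge0; [exact: sqr_ge0|exact: normc_ge0].
  have -> : F (cplx p) / (pole H - cplx p) = P (cplx p) * Phi (cplx p).
    by rewrite /F /Phi; field; rewrite P0 //= pn.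
  by rewrite normcM ler_wpM2r ?normc_ge0 //; exact: vertices_le.
have one1 : `|1 : R| = 1 by rewrite normr1.
have oneN1 : `|-1 : R| = 1 by rewrite normrN1.
exists (summand H F s n 1), (summand H F s n (-1)); split.
- split=> [z /Delta_omega zo|].
    by apply/holo_atP; apply: (summand_holo H1 hF s3 s1 lF lFN n0 repr one1 zo).
  have := summand_l2 H1 hF s3 s1 lF lFN n0 repr one1 dfin.
  apply: le_lt_trans; rewrite /area_integral le_eqVlt; apply/orP; left; apply/eqP.
  have -> : [set p : R * R | Delta R (p.1 +i* p.2)] = [set p | omega H 1 (cplx p)].
    by apply/seteqP; split => p /=; [move=> /Delta_omega|move=> ?; apply/Delta_omega].
  by apply: eq_integral => p _; rewrite mulr1.
- split=> [z /pi_sub_Delta_omega zo|].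
    by apply/holo_atP; apply: (summand_holo H1 hF s3 s1 lF lFN n0 repr oneN1 zo).
  have := summand_l2 H1 hF s3 s1 lF lFN n0 repr oneN1 dfin.
  apply: le_lt_trans; rewrite /area_integral le_eqVlt; apply/orP; left; apply/eqP.
  have -> : [set p : R * R | pi_sub_Delta R (p.1 +i* p.2)] = [set p | omega H (-1) (cplx p)].
    by apply/seteqP; split => p /=; [move=> /pi_sub_Delta_omega|move=> ?; apply/pi_sub_Delta_omega].
  by apply: eq_integral => p _; rewrite mulr1.
move=> z /DE zD; rewrite (summand_sum H1 n0 repr zD) /F mulfK //.
by apply: (pole_neq H1 one1); exact: diamond_omega.
Qed.
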